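(* Assume $\gamma>0$ and that $R$ is regularly varying at $\infty$ with index $\theta>1$. Let $\varphi(b)=\frac{1}{\gamma}\int_b^\infty\frac{\mathrm{d}x}{R(x)}$ and $V(z,\rho)=\sup_{x\ge z}\left(\frac{R(x)}{R(x+\rho z)}-1\right)_+$. Suppose that one of the following holds: (a) $\Psi(\lambda)-\gamma\lambda\sim c\lambda^{1+\delta}$ as $\lambda\to0+$ for some $\delta\in(0,1)$ and $c>0$, and $V(z,1/\sqrt{z})=O(z^{-\delta/2})$ as $z\to\infty$; (b) there exists $\nu\in(0,\infty)$ with $\Psi(-\nu)=0$, $\int_0^1u\,\pi(\mathrm{d}u)<\infty$, and $V\!\left(z,\frac{2\ln\ln z}{\nu z}\right)=O\big((\ln z)^{-2}\big)$ as $z\to\infty$. Then $\frac{X_t}{\varphi^{-1}(t)}\to1$ $\mathbb{P}_\infty$-almost surely as $t\to0+$, and $\varphi^{-1}$ is regularly varying at $0$ with index $-1/(\theta-1)$.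
   Context: Let $\Psi(\lambda)=\gamma\lambda+\frac{\sigma^2}{2}\lambda^2+\int_0^\infty(e^{-\lambda z}-1+\lambda z)\,\pi(\mathrm{d}z)$ for $\lambda\ge0$ (and at negative $\lambda$ by the same formula whenever it is finite), where $\gamma\in\mathbb{R}$, $\sigma\ge0$, $\pi$ a measure on $(0,\infty)$ with $\int_0^\infty(z\wedge z^2)\pi(\mathrm{d}z)<\infty$. Let $Z$ be a spectrally positive Lévy process with $\mathbb{E}[e^{-\lambda Z_1}\mid Z_0=x]=e^{-\lambda x+\Psi(\lambda)}$. Let $R$ be continuous on $[0,\infty)$, strictly positive on $(0,\infty)$. With $\tau_0^-=\inf\{t:Z_t<0\}$, $\eta(s)=\int_0^{s\wedge\tau_0^-}\frac{\mathrm{d}r}{R(Z_r)}$, $\eta^{-1}(t)=\inf\{s:\eta(s)>t\}$, the process is $X_t=Z_{\eta^{-1}(t)\wedge\tau_0^-}$. Under the hypotheses, $\infty$ is an instantaneous entrance boundary for $X$ (no explosion, and $\lim_{b\to\infty}\liminf_{x\to\infty}\mathbb{P}_x(T_b\le t)=1$ for all $t>0$, with $T_b=\inf\{t:X_t<b\}$); $\mathbb{P}_\infty$ is the law of the càdlàg strong Markov process started at $\infty$ leaving it instantaneously and evolving from finite states as $X$. A positive function $f$ is regularly varying at $\infty$ (resp. $0$) with index $\theta$ if $f(\lambda x)/f(x)\to\lambda^\theta$ as $x\to\infty$ (resp. $x\to0+$) for every $\lambda>0$. $(y)_+=\max(y,0)$. *)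

(* Defs.v *)
From HB Require Import structures.
From mathcomp Require Import all_boot all_order all_algebra.
From mathcomp Require Import all_classical all_reals all_analysis.
Set Implicit Arguments. Unset Strict Implicit. Unset Printing Implicit Defensive.
Import Order.TTheory GRing.Theory Num.Theory.
Import numFieldNormedType.Exports.
Local Open Scope classical_set_scope.
Local Open Scope ring_scope.

Section Defs.
Variable R : realType.

(* Psi(lambda) = gamma lambda + sigma^2/2 lambda^2 + int_(0,oo) (e^{-lambda z}-1+lambda z) pi(dz),
   as an extended real (the integrand is nonnegative for every real lambda, so
   the integral always exists in [0,+oo]; Psi is "finite" iff this is finite). *)
Definition PsiE (gam sig : R) (pi : {measure set R -> \bar R}) (lam : R) : \bar R :=
  ((gam * lam + sig ^+ 2 / 2 * lam ^+ 2)%:E +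
   \int[pi]_(z in `]0%R, +oo[%classic) (expR (- (lam * z)) - 1 + lam * z)%:E)%E.

Definition Psi gam sig pi lam : R := fine (PsiE gam sig pi lam).

Definition regvar_infty (f : R -> R) (th : R) : Prop :=
  forall lam : R, 0 < lam -> (f (lam * x) / f x) @[x --> +oo] --> lam `^ th.

Definition regvar_0 (f : R -> R) (th : R) : Prop :=
  (\forall t \near 0^'+, 0 < f t) /\
  forall lam : R, 0 < lam -> (f (lam * t) / f t) @[t --> 0^'+] --> lam `^ th.

Definition phi (gam : R) (Rf : R -> R) (b : R) : R :=
  fine (\int[@lebesgue_measure R]_(x in `[b, +oo[%classic) ((Rf x)^-1)%:E) / gam.

Definition phi_inv (gam : R) (Rf : R -> R) (t : R) : R :=
  inf [set b | 0 < b /\ phi gam Rf b <= t].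

Definition Vfun (Rf : R -> R) (z rho : R) : \bar R :=
  ereal_sup [set (Num.max (Rf x / Rf (x + rho * z) - 1) 0)%:E | x in [set x | z <= x]].

Definition bigO_infty (f : R -> \bar R) (g : R -> R) : Prop :=
  exists C : R, exists z0 : R, forall z, z0 <= z -> (`|f z| <= (C * `|g z|)%:E)%E.

(* ---- The time-changed process, pathwise.  l is a path of the Levy process
   started at 0, so Z_s = x + l s is the path started at x. ---- *)
Definition tau0 (x : R) (l : R -> R) : \bar R :=
  ereal_inf [set s%:E | s in [set s | 0 <= s /\ x + l s < 0]].

Definition eta_int (Rf : R -> R) (x : R) (l : R -> R) (r : R) : \bar R :=
  if 0 < Rf (x + l r) then ((Rf (x + l r))^-1)%:E else +oo%E.

Definition eta (Rf : R -> R) (x : R) (l : R -> R) (s : R) : \bar R :=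
  \int[@lebesgue_measure R]_(r in [set r | 0 <= r /\ r < s /\ (r%:E < tau0 x l)%E])
     eta_int Rf x l r.

Definition eta_inv (Rf : R -> R) (x : R) (l : R -> R) (t : R) : \bar R :=
  ereal_inf [set s%:E | s in [set s | 0 <= s /\ (t%:E < eta Rf x l s)%E]].

(* X_t = Z_{eta^{-1}(t) /\ tau_0^-}; the value 0 is an arbitrary cemetery value
   used only if both times are infinite (explosion, which does not occur). *)
Definition Xpath (Rf : R -> R) (x : R) (l : R -> R) (t : R) : R :=
  match Order.min (eta_inv Rf x l t) (tau0 x l) with
  | EFin u => x + l u
  | _ => 0
  end.

Definition cadlag_on (A : set R) (f : R -> R) : Prop :=
  (forall t, A t -> f x @[x --> t^'+] --> f t) /\
  (forall t, A t -> (exists t', A t' /\ t' < t) -> cvg (f x @[x --> t^'-])).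

Definition levy_process {d} {Om : measurableType d} (P : probability Om R)
  (L : R -> Om -> R) (gam sig : R) (pi : {measure set R -> \bar R}) : Prop :=
  (forall t, 0 <= t -> measurable_fun setT (L t)) /\
  (forall w, L 0 w = 0) /\
  (forall w, cadlag_on `[0%R, +oo[%classic (fun s => L s w)) /\
  (forall (n : nat) (t : nat -> R) (A : nat -> set R),
      t 0%N = 0 -> (forall i, t i <= t i.+1) -> (forall i, measurable (A i)) ->
      (P (\bigcap_(i in [set i | (i < n)%N]) [set w | A i (L (t i.+1) w - L (t i) w)%R]) =
      \big[*%E/1%E]_(i < n) P [set w | A i (L (t i.+1 - t i)%R w)])%E) /\
  (forall lam, 0 <= lam ->
      (\int[P]_(w in setT) (expR (- (lam * L 1 w))%R)%:E = (expR (Psi gam sig pi lam))%:E)%E).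

Definition Xkernel {d} {Om : measurableType d} (P : probability Om R)
  (L : R -> Om -> R) (Rf : R -> R) (h x : R) (B : set R) : \bar R :=
  P [set w | B (Xpath Rf x (fun s => L s w) h)].

(* Y has law P_infty: cadlag on (0,oo), Y_t -> oo as t -> 0+ (starts at oo and
   leaves it instantaneously), and Markov with the transition kernel of X. *)
Definition law_P_infty {d} {Om : measurableType d} (P : probability Om R)
  (L : R -> Om -> R) (Rf : R -> R)
  {d'} {Om' : measurableType d'} (P' : probability Om' R) (Y : R -> Om' -> R) : Prop :=
  (forall t, 0 < t -> measurable_fun setT (Y t)) /\
  (forall w, cadlag_on `]0%R, +oo[%classic (fun t => Y t w)) /\
  (forall w, Y t w @[t --> 0^'+] --> +oo) /\
  (forall (s h : R) (n : nat) (ts : nat -> R) (As : nat -> set R) (B : set R),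
      0 < s -> 0 <= h -> (forall i, (i < n)%N -> 0 < ts i <= s) ->
      (forall i, measurable (As i)) -> measurable B ->
      let E := \bigcap_(i in [set i | (i < n)%N]) [set w | As i (Y (ts i) w)] in
      (P' (E `&` [set w | B (Y (s + h)%R w)]) =
      \int[P']_(w in E) Xkernel P L Rf h (Y s w) B)%E).

End Defs.

(* Main.v *)
Require Import Defs.
From HB Require Import structures.
From mathcomp Require Import all_boot all_order all_algebra.
From mathcomp Require Import all_classical all_reals all_analysis.
From mathcomp Require Import measurable_realfun.
From mathcomp Require Import ring lra.
Import Order.TTheory GRing.Theory Num.Theory.
Import numFieldNormedType.Exports.
Set Implicit Arguments. Unset Strict Implicit. Unset Printing Implicit Defensive.
Local Open Scope classical_set_scope.
Local Open Scope ring_scope.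

(** Write phi for the function of the statement and Y for the process started
    at infinity.  Both (a) and (b) bound Psi(l) - gamma l by C l^(1+delta) near
    0; via exponential moments and Ottaviani's inequality this gives
    |L_u + gamma u| <= e (n + u) for all u with probability 1 - O(n^-delta).
    On that event regular variation of R yields phi(X_h) = phi(x) + h up to a
    small multiple of phi(x), for x >= n and h of order phi(x).  Chaining this
    along a geometric sequence of times with the Markov property, and letting
    the starting time tend to 0, gives P(|phi(Y_t) - t| > e t) = O(t^kappa),
    which is summable over t = (1+e)^-k.  Between two such times a first-passage
    argument applies: when phi(Y) becomes too small the chain estimate keeps it
    too small, and when it becomes too large, Y would have to climb, which the
    negative drift makes unlikely.  So phi(Y_t)/t -> 1 almost surely, and this
    passes to Y_t / phi^-1(t) because phi is regularly varying with nonzero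
    index 1 - theta. *)

(* [lra] normalises every comparison in the context, which dominates its cost. *)
Ltac hide_comparisons :=
  repeat match goal with H : is_true ?b |- _ => change (hide (is_true b)) in H end.

(** Heuristically dX = -gamma R(X) dt and phi' = -1/(gamma R), so phi(X) grows at unit speed and
    infinity becomes the origin of the phi scale; hence every estimate concerns phi(Y) with relative
    errors. A step of length rho phi(x) has error at most e rho phi(x), proportional to its length.
    Over a geometric chain the errors therefore add up to a relative error of the same order, and
    the failure probabilities, of order phi^kappa, add up to a multiple of the last one. Here kappa
    = delta/theta, because x^-theta is at most a multiple of phi(x). The law at infinity gives the
    Markov property at deterministic times only, and for events fixed by finitely many coordinates.
    First passages are therefore taken on finite dyadic grids, limits are monotone unions of events,
    and right continuity carries the result from the grids to all times. Within a block of times, a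
    deviation is still visible at the end of the block with conditional probability at least 1/4, so
    its probability is at most four times that of a deviation at that one fixed time. *)

Lemma ratio_bounds (R : realType) (e p q E : R) : 0 < e -> e <= 1 ->
  `|p - 1| <= e / 10 -> `|q - 1| <= e / 10 -> `|E - 1| < e / 10 ->
  p * E <= (1 + e) * q /\ q <= (1 + e) * (p * E).
Proof.
rewrite !ler_norml ltr_norml => e0 e1 /andP[p1 p2] /andP[q1 q2] /andP[E1 E2].
have p0 : 0 <= p by lra.
have E0 : 0 <= E by lra.
have pE1 : p * E <= (1 + e / 10) * (1 + e / 10) by apply: ler_pM => //; lra.
have pE2 : (1 - e / 10) * (1 - e / 10) <= p * E by apply: ler_pM => //; lra.
have e2 : e * e <= e by rewrite ler_piMr// ltW.
split.
  have : (1 + e) * (1 - e / 10) <= (1 + e) * q by rewrite ler_pM2l; lra.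
  by nra.
have : (1 + e) * ((1 - e / 10) * (1 - e / 10)) <= (1 + e) * (p * E) by rewrite ler_pM2l; lra.
by nra.
Qed.

(** * Regularly varying functions: local uniformity by Baire category *)

Section RegularVariation.
Variables (R : realType) (Rf : R -> R) (th : R).
Hypothesis Rf_cont : {within `[0%R, +oo[%classic, continuous Rf}.
Hypothesis Rf_gt0 : forall x : R, 0 < x -> 0 < Rf x.
Hypothesis Rf_rv : regvar_infty Rf th.

Lemma near_pinftyP (Q : R -> Prop) :
  (\forall x \near +oo, Q x) -> exists x0, 0 < x0 /\ forall x, x0 <= x -> Q x.
Proof.
move=> [M [_ MQ]]; exists (Num.max 1 (M + 1)); split; first by rewrite lt_max ltr01.
by move=> x; rewrite ge_max => /andP[_ Mx]; apply: MQ; rewrite (lt_le_trans _ Mx)// ltrDl.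
Qed.

Lemma Rf_cont_gt0 x : 0 < x -> {for x, continuous Rf}.
Proof.
by move=> x0; have /continuous_within_itvcyP[+ _] := Rf_cont; apply; rewrite in_itv/= x0.
Qed.


(** The scale is logarithmic and the threshold an integer, so that the line is covered by countably
    many closed sets, as Baire's theorem requires. *)
Lemma regvar_relP u e : 0 < e -> exists n : nat, forall x : R, n.+1%:R <= x ->
  `|Rf (expR u * x) / (Rf x * expR (u * th)) - 1| <= e.
Proof.
move=> e0; have := Rf_rv (expR_gt0 u); rewrite /powR gt_eqF ?expR_gt0// expRK.
have e1 : 0 < e * expR (u * th) by rewrite mulr_gt0// expR_gt0.
move=> /cvgrPdist_le /(_ _ e1) /near_pinftyP[x0 [x00 x0P]].
exists (Num.truncn x0) => x xx; have xx0 : x0 <= x.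
  by rewrite (le_trans _ xx)// ltW// truncnS_gt.
have := x0P _ xx0; rewrite (mulrC th) => H.
have E := expR_gt0 (u * th).
have -> : Rf (expR u * x) / (Rf x * expR (u * th)) - 1 =
  (Rf (expR u * x) / Rf x - expR (u * th)) / expR (u * th).
  field; rewrite !gt_eqF// Rf_gt0// (lt_le_trans x00)//.
by rewrite normrM normfV (gtr0_norm E) ler_pdivrMr// distrC.
Qed.

Lemma regvar_rel_closed (e : R) (n : nat) : closed [set u | forall x : R, n.+1%:R <= x ->
  `|Rf (expR u * x) / (Rf x * expR (u * th)) - 1| <= e].
Proof.
have -> : [set u | forall x : R, n.+1%:R <= x ->
    `|Rf (expR u * x) / (Rf x * expR (u * th)) - 1| <= e] =
  \bigcap_(x in [set x : R | n.+1%:R <= x])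
    ((fun u => `|Rf (expR u * x) / (Rf x * expR (u * th)) - 1|) @^-1` [set y | y <= e]).
  by apply/seteqP; split => u /=.
apply: closed_bigI => x /= nx; apply: closed_comp; last exact: closed_le.
have x0 : 0 < x by apply: lt_le_trans nx.
move=> u _.
apply: (@continuous_comp _ _ _ (fun u => Rf (expR u * x) / (Rf x * expR (u * th)) - 1) (fun y : R => `|y|)); last exact: norm_continuous.
apply: cvgB; last exact: cvg_cst.
apply: cvgM.
  apply: (@continuous_comp _ _ _ (fun u => expR u * x) Rf).
    by apply: cvgMl; exact: continuous_expR.
  by apply: Rf_cont_gt0; rewrite mulr_gt0// expR_gt0.
apply: cvgV; first by rewrite gt_eqF// mulr_gt0 ?Rf_gt0// expR_gt0.
apply: cvgM; first exact: cvg_cst.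
apply: (cvg_comp (fun u : R => u * th) expR); last exact: continuous_expR.
by apply: cvgMl; exact: cvg_id.
Qed.

(** The open complements [F n] have no common point, by the pointwise limit. So they cannot all be
    dense, and an open set missed by one of them contains the ball. *)
Lemma regvar_rel_ball (e : R) : 0 < e -> exists u r : R, exists n : nat, 0 < r /\
  forall v x : R, `|v - u| < r -> n.+1%:R <= x ->
  `|Rf (expR v * x) / (Rf x * expR (v * th)) - 1| <= e.
Proof.
move=> e0.
pose F (n : nat) : set R := ~` [set u | forall x : R, n.+1%:R <= x ->
  `|Rf (expR u * x) / (Rf x * expR (u * th)) - 1| <= e].
have oF n : open (F n) by rewrite openC; exact: regvar_rel_closed.
have [dF|] := pselect (forall n, dense (F n)).
  have /Baire : forall n, open (F n) /\ dense (F n) by [].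
  have t0 : ([set: R] !=set0) by exists 0.
  move=> /(_ setT t0 openT)[u [_ uF]].
  have [n nP] := regvar_relP u e0.
  by have := uF n I; move/(_ nP).
move=> /existsNP[n] /existsNP[V] /not_implyP[] [u Vu] /not_implyP[oV] VF.
have /nbhs_ballP[r /= r0 rV] := open_nbhs_nbhs (conj oV Vu).
exists u, r, n; split => // v x vu.
have vV : V v by apply: rV; rewrite /ball/= distrC.
have : ~ F n v by move=> Fv; apply: VF; exists v.
by rewrite /F /= => /contrapT; apply.
Qed.

(* Baire category replaces the measure-theoretic step of the usual proof of
   the uniform convergence theorem. *)
Lemma regvar_equicontinuous (e : R) : 0 < e -> exists rho x0 : R,
  [/\ 0 < rho, rho <= 1 / 2, 0 < x0 & forall x y : R, x0 <= x -> `|y - x| <= rho * x ->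
  Rf y <= (1 + e) * Rf x /\ Rf x <= (1 + e) * Rf y].
Proof.
wlog e1 : e / e <= 1.
  move=> wl e0; have [le1|/ltW ge1] := leP e 1; first exact: wl.
  have [rho [x0 [r0 r1 x00 H]]] := wl 1 (lexx 1) ltr01.
  exists rho, x0; split => // x y xx yx; have [h1 h2] := H _ _ xx yx.
  have y0 : 0 < y.
    have : `|y - x| <= 1/2 * x by rewrite (le_trans yx)// ler_wpM2r// (le_trans _ xx) // ltW.
    rewrite ler_norml => /andP[+ _]; have := lt_le_trans x00 xx; lra.
  have Ry := Rf_gt0 y0; have Rx := Rf_gt0 (lt_le_trans x00 xx).
  by split; [apply: le_trans h1 _|apply: le_trans h2 _]; rewrite ler_pM2r// lerD2l.
move=> e0; have e10 : 0 < e / 10 by rewrite divr_gt0.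
have [u [r [n [r0 H]]]] := regvar_rel_ball e10.
have c1 : (expR (v * th) @[v --> (0:R)]) --> (1 : R).
  rewrite -[X in _ --> X]expR0 -[X in expR X](mul0r th).
  apply: (cvg_comp (fun u : R => u * th) expR); last exact: continuous_expR.
  by apply: cvgMl; exact: cvg_id.
have lnc : ln y @[y --> (1:R)] --> (0:R).
  by rewrite -[X in _ --> X]ln1; apply: continuous_ln; rewrite ltr01.
have c2 : (expR (ln y * th) @[y --> (1:R)]) --> (1 : R) by apply: cvg_comp lnc c1.
have n1 : \forall y \near (1:R), `|ln y| < r.
  move/cvgrPdist_lt : lnc => /(_ _ r0); apply: filterS => y /=.
  by rewrite sub0r normrN.
have n2 : \forall y \near (1:R), `|expR (ln y * th) - 1| < e / 10.
  move/cvgrPdist_lt : c2 => /(_ _ e10); apply: filterS => y /=; by rewrite distrC.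
have : \forall y \near (1:R), `|ln y| < r /\ `|expR (ln y * th) - 1| < e / 10.
  by apply: filterS2 n1 n2 => y; split.
move=> /nbhs_ballP[rho /= rho0 rhoP].
exists (Num.min (rho / 2) (1 / 2)), (expR u * n.+1%:R); split.
- by rewrite lt_min; apply/andP; split; lra.
- by rewrite ge_min lexx orbT.
- by rewrite mulr_gt0// expR_gt0.
move=> x y xx yx; have x0 : 0 < x by apply: lt_le_trans xx; rewrite mulr_gt0// expR_gt0.
have yx1 : `|y / x - 1| < rho.
  have -> : y / x - 1 = (y - x) / x by field; rewrite gt_eqF.
  rewrite normrM normfV (gtr0_norm x0) ltr_pdivrMr//.
  rewrite (le_lt_trans yx)// ltr_pM2r// gt_min; apply/orP; left; lra.
have y0 : 0 < y.
  have : `|y - x| <= 1/2 * x by rewrite (le_trans yx)// (ler_pM2r x0) ge_min lexx orbT.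
  rewrite ler_norml => /andP[+ _]; lra.
have [] : `|ln (y / x)| < r /\ `|expR (ln (y / x) * th) - 1| < e / 10.
  by apply: rhoP; rewrite /ball/= distrC.
set v := ln (y / x) => vr ve.
have yE : y = expR v * x by rewrite /v lnK ?posrE ?divr_gt0// divfK// gt_eqF.
(* The ball is centred at an uncontrolled [u]. Both points are therefore compared with z = e^-u x: x
   is the shift of z by [u] and y the shift by [u + v], and both shifts lie in the ball. *)
pose z := expR (- u) * x.
have xE : x = expR u * z by rewrite /z mulrA -expRD subrr expR0 mul1r.
have zn : n.+1%:R <= z by rewrite -(@ler_pM2l _ (expR u)) ?expR_gt0// -xE.
have z0 : 0 < z by apply: lt_le_trans zn.
have yE' : y = expR (u + v) * z by rewrite yE xE mulrA -expRD addrC.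
have h1 := H (u + v) z; have h2 := H u z.
have {}h1 := h1 ltac:(by rewrite addrAC subrr add0r) zn.
have {}h2 := h2 ltac:(by rewrite subrr normr0) zn.
rewrite -yE' in h1; rewrite -xE in h2.
have Rx := Rf_gt0 x0; have Ry := Rf_gt0 y0; have Rz := Rf_gt0 z0.
pose K := Rf z * expR (u * th); have K0 : 0 < K by rewrite mulr_gt0// expR_gt0.
pose E := expR (v * th).
rewrite mulrDl expRD mulrA -/K -/E in h1; rewrite -/K in h2; rewrite -/E in ve.
pose p := Rf y / (K * E); pose q := Rf x / K.
have RyE : Rf y = p * E * K.
  by rewrite /p; field; rewrite !gt_eqF// expR_gt0.
have RxE : Rf x = q * K by rewrite /q divfK// gt_eqF.
rewrite -/p in h1; rewrite -/q in h2.
clearbody p q K E; rewrite RyE RxE !(mulrA (1 + e)) !(ler_pM2r K0) -(mulrA _ p).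
exact: (ratio_bounds e0 e1).
Qed.

End RegularVariation.

(** * Power functions and growth under doubling *)

Section PowerBounds.
Variable R : realType.

(** Plays the part of Potter's bounds: it is applied to R(x)/x^p and to phi(x) x^th, whose growth
    under doubling follows from the ratio limit at 2 alone. *)
Lemma doubling_lower (h : R -> R) (x0 c : R) : 0 < x0 ->
  (forall x, x0 <= x <= 2 * x0 -> c <= h x) ->
  (forall x, x0 <= x -> h x <= h (2 * x)) ->
  forall x, x0 <= x -> c <= h x.
Proof.
move=> x00 h0 h2 x x0x.
have H n y : x0 <= y -> y <= 2 ^+ n * x0 -> c <= h y.
  elim: n y => [|n IH] y y0 y1.
    by apply: h0; rewrite y0/= (le_trans y1)// expr0 ler_pM2r// ler1n.
  have [yle|ygt] := leP y (2 * x0); first by apply: h0; rewrite y0.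
  have -> : y = 2 * (y / 2) by field.
  apply: (@le_trans _ _ (h (y / 2))); last by apply: h2; lra.
  apply: IH; first by lra.
  by move: y1; rewrite exprS -mulrA ler_pdivrMr// mulrC (mulrC _ 2).
apply: (H (Num.truncn (x / x0)).+1 x x0x).
rewrite -ler_pdivrMr// (le_trans (ltW (truncnS_gt _)))//.
by rewrite -natrX ler_nat ltnW// ltn_expl.
Qed.

Lemma powRN_cvg_pinfty (a : R) : 0 < a -> x `^ (- a) @[x --> +oo] --> (0 : R).
Proof.
move=> a0; apply: (@cvg_trans _ (expR (- (a * ln x)) @[x --> +oo])).
  apply: near_eq_cvg; near=> x.
  have x0 : 0 < x by near: x; exact: nbhs_pinfty_gt.
  by rewrite /powR gt_eqF// mulNr.
apply: (cvg_comp (fun x : R => a * ln x) (fun y => expR (- y))); last exact: cvgr_expR.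
apply/cvgryPge => A; near=> x.
rewrite -ler_pdivrMl// -[X in X <= _]expRK ler_ln ?posrE ?expR_gt0//.
Unshelve. all: by end_near. Qed.

Lemma powR_continuous (a x : R) : 0 < x -> {for x, continuous (@powR R ^~ a)}.
Proof.
move=> x0; apply/differentiable_continuous/derivable1_diffP.
by apply: derivable_powR; rewrite in_itv/= andbT.
Qed.

Lemma integral_powRN_lty (b p : R) : 0 < b -> 1 < p ->
  (\int[lebesgue_measure]_(x in `[b, +oo[) (x `^ (- p))%:E < +oo)%E.
Proof.
move=> b0 p1; pose F (x : R) := (1 - p)^-1 * x `^ (1 - p).
have dF (x : R) : 0 < x -> is_derive x 1 F (x `^ (- p)).
  move=> x0; rewrite (_ : x `^ (- p) = (1 - p)^-1 * ((1 - p) * x `^ (1 - p - 1))); last first.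
    by rewrite mulrA mulVf ?mul1r; [congr (_ `^ _); ring|lra].
  exact: (is_deriveZ (1 - p)^-1 (is_derive1_powR (1 - p) x0)).
rewrite (@ge0_continuous_FTC2y _ (fun x => x `^ (- p)) F _ 0).
- by rewrite -EFinB ltry.
- by move=> x _; exact: powR_ge0.
- apply/continuous_within_itvcyP; split => [x|].
    rewrite in_itv/= andbT => bx.
    by apply: powR_continuous; rewrite (lt_trans b0).
  exact/cvg_at_right_filter/powR_continuous.
- rewrite -[X in _ --> X](mulr0 (1 - p)^-1); apply: cvgM; first exact: cvg_cst.
  by rewrite -(opprK (1 - p)); apply: powRN_cvg_pinfty; lra.
- by move=> x bx; have := dF x (lt_trans b0 bx) => -[].
- apply: cvg_at_right_filter.
  by apply: cvgM; [exact: cvg_cst|exact: powR_continuous].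
- move=> x; rewrite in_itv/= andbT => bx; rewrite derive1E.
  by have := dF x (lt_trans b0 bx) => -[].
Qed.

End PowerBounds.

(** * The function phi: finiteness, scaling and comparison with x/(gamma R(x)) *)

Section Phi.
Variables (R : realType) (gam : R) (Rf : R -> R) (th : R).
Hypothesis Rf_cont : {within `[0%R, +oo[%classic, continuous Rf}.
Hypothesis Rf_gt0 : forall x : R, 0 < x -> 0 < Rf x.
Hypothesis gam0 : 0 < gam.
Hypothesis th1 : 1 < th.
Hypothesis Rf_rv : regvar_infty Rf th.

Notation If b := (\int[@lebesgue_measure R]_(x in `[b%R, +oo[%classic) ((Rf x)^-1)%:E)%E.

Let Rf_cont0 (x : R) : 0 < x -> {for x, continuous Rf}.
Proof. exact: Rf_cont_gt0. Qed.

Lemma Rf_within (b : R) (i : interval R) : 0 < b -> [set` i] `<=` `[b, +oo[%classic ->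
  {within [set` i], continuous (fun x => (Rf x)^-1)}.
Proof.
move=> b0 ib; apply: (continuous_subspaceW ib).
apply/continuous_within_itvcyP; split => [x|].
  rewrite in_itv/= andbT => bx; have x0 := lt_trans b0 bx.
  by apply: cvgV; [rewrite gt_eqF// Rf_gt0|exact: Rf_cont0].
by apply: cvg_at_right_filter; apply: cvgV; [rewrite gt_eqF// Rf_gt0|exact: Rf_cont0].
Qed.

Lemma invRf_measurable (b : R) (i : interval R) : 0 < b -> [set` i] `<=` `[b, +oo[%classic ->
  measurable_fun [set` i] (fun x => (Rf x)^-1).
Proof.
move=> b0 ib; apply: subspace_continuous_measurable_fun; first exact: measurable_itv.
exact: Rf_within ib.
Qed.

Lemma invRf_ge0 (b x : R) : 0 < b -> b <= x -> 0 <= (Rf x)^-1.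
Proof. by move=> b0 bx; rewrite invr_ge0 ltW// Rf_gt0// (lt_le_trans b0). Qed.

(** The exponent (1 + th)/2 lies strictly between 1 and [th]: below [th], so that R(x)/x^p
    eventually grows under doubling; above 1, so that 1/R is integrable at infinity. Compactness
    handles the bounded range starting at [b]. *)
Lemma Rf_power_lower (b : R) : 0 < b ->
  exists c : R, 0 < c /\ forall x, b <= x -> c * x `^ ((1 + th) / 2) <= Rf x.
Proof.
move=> b0; set p := (1 + th) / 2.
have pth : p < th by have := th1; rewrite /p; lra.
have p1 : 0 <= p by have := th1; rewrite /p; lra.
have := Rf_rv (ltr0n R 2 : 0 < 2) => /cvgrPdist_lt H.
have d0 : 0 < 2 `^ th - 2 `^ p :> R by rewrite subr_gt0 /powR !gt_eqF// ltr_expR ltr_pM2r// ln_gt0// ltr1n.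
have := H _ d0 => /near_pinftyP[x0 [x00 x0P]].
pose x1 := Num.max b x0.
have x10 : 0 < x1 by rewrite /x1 lt_max b0.
have x12 : b <= 2 * x1 by rewrite (@le_trans _ _ x1)// ?le_max ?lexx//; lra.
have p0 : 0 < p by have := th1; rewrite /p; lra.
have [||c cb cP] := @EVT_min R Rf b (2 * x1); first exact: x12.
  by apply: (continuous_subspaceW _ Rf_cont) => y /=; rewrite !in_itv/= andbT => /andP[? _]; rewrite (le_trans _ (_ : b <= y))// ltW.
have Rc : 0 < Rf c by apply: Rf_gt0; move: cb; rewrite in_itv/= => /andP[+ _]; exact: lt_le_trans.
exists (Rf c / (2 * x1) `^ p); split; first by rewrite divr_gt0// powR_gt0// mulr_gt0.
have x1p : 0 < (2 * x1) `^ p by rewrite powR_gt0// mulr_gt0.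
have small x : b <= x -> x <= 2 * x1 -> Rf c / (2 * x1) `^ p * x `^ p <= Rf x.
  move=> bx xx; apply: (@le_trans _ _ (Rf c)); last by apply: cP; rewrite in_itv/= bx.
  rewrite -mulrA; apply: ler_piMr; first exact: ltW.
  rewrite mulrC ler_pdivrMr// mul1r; apply: ge0_ler_powR => //; rewrite nnegrE.
  - by rewrite (le_trans _ bx)// ltW.
  - by rewrite mulr_ge0// ltW.
move=> x bx; have [/small|] := leP x (2 * x1); first exact.
move=> xx; have xx1 : x1 <= x by lra.
have xp : 0 < x `^ p by rewrite powR_gt0// (lt_le_trans x10).
rewrite -ler_pdivlMr//; move: x xx1 {xx bx xp}.
apply: (@doubling_lower _ (fun x => Rf x / x `^ p)) => //.
  move=> x /andP[x1x xx]; rewrite ler_pdivlMr ?powR_gt0 ?(lt_le_trans x10)//.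
  by apply: small => //; rewrite (le_trans _ x1x)// le_max lexx.
move=> x x1x; have x0' : 0 < x := lt_le_trans x10 x1x.
have xp : 0 < x `^ p by rewrite powR_gt0.
have := x0P x (le_trans (_ : x0 <= x1) x1x); rewrite /x1 le_max lexx orbT => /(_ isT).
rewrite ltr_norml => /andP[_]; rewrite ltrD2l ltrN2 ltr_pdivlMr ?Rf_gt0// => h2.
rewrite powRM//; last exact: ltW.
rewrite invfM mulrA ler_pM2r ?invr_gt0// ler_pdivlMr ?powR_gt0//.
by rewrite mulrC ltW.
Qed.

Lemma If_lty (b : R) : 0 < b -> (If b < +oo)%E.
Proof.
move=> b0; have [c [c0 cP]] := Rf_power_lower b0.
set p := (1 + th) / 2 in cP.
have p1 : 1 < p by have := th1; rewrite /p; lra.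
have := integral_powRN_lty b0 p1 => pfin.
have mp : measurable_fun (`[b, +oo[%classic : set R) (fun x : R => x `^ (- p)).
  by apply: measurable_funTS; exact: measurable_powR.
apply: (@le_lt_trans _ _ (\int[lebesgue_measure]_(x in `[b, +oo[) (c^-1%:E * (x `^ (- p))%:E))%E).
  apply: ge0_le_integral => //=.
  - by move=> x; rewrite in_itv/= andbT => bx; rewrite lee_fin (invRf_ge0 b0).
  - by apply/measurable_EFinP; exact: invRf_measurable b0 _.
  - by apply: measurable_funeM; exact/measurable_EFinP.
  - move=> x; rewrite in_itv/= andbT => bx; rewrite -EFinM lee_fin.
    have x0 : 0 < x := lt_le_trans b0 bx.
    by rewrite powRN -invfM lef_pV2 ?posrE ?Rf_gt0 ?mulr_gt0 ?powR_gt0// cP.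
rewrite ge0_integralZl//.
- by rewrite lte_mul_pinfty// lee_fin invr_ge0 ltW.
- exact/measurable_EFinP.
- by move=> x _; rewrite lee_fin powR_ge0.
- by rewrite lee_fin invr_ge0 ltW.
Qed.

Lemma If_ge0 (b : R) : 0 < b -> (0 <= If b)%E.
Proof.
move=> b0; apply: integral_ge0 => x /=; rewrite in_itv/= andbT => bx.
by rewrite lee_fin (invRf_ge0 b0).
Qed.

Lemma phiE (b : R) : 0 < b -> If b = (gam * phi gam Rf b)%:E.
Proof.
move=> b0; rewrite /phi mulrC divfK ?gt_eqF// fineK//.
by rewrite ge0_fin_numE ?If_ge0// If_lty.
Qed.

Lemma If_split (a b : R) : 0 < a -> a <= b ->
  If a = ((\int[lebesgue_measure]_(x in `[a, b[) ((Rf x)^-1)%:E) + If b)%E.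
Proof.
move=> a0 ab.
have -> : `[a, +oo[%classic = `[a, b[%classic `|` `[b, +oo[%classic :> set R.
  apply/seteqP; split=> x /=; rewrite !in_itv/= !andbT.
    by move=> ax; have [?|?] := ltP x b; [left; rewrite ax|right].
  by move=> [/andP[]//|]; exact: le_trans.
rewrite ge0_integral_setU//.
- apply/measurable_EFinP; apply: (@measurable_funS _ _ _ _ `[a, +oo[%classic) => //.
    move=> x /=; rewrite !in_itv/= !andbT => -[/andP[]//|]; exact: le_trans.
  exact: invRf_measurable a0 _.
- by move=> x /=; rewrite !in_itv/= !andbT lee_fin => -[/andP[ax _]|bx]; rewrite (invRf_ge0 a0)// (le_trans ab).
- by rewrite disj_set2E; apply/eqP/seteqP; split=> x //=; rewrite !in_itv/= andbT => -[/andP[_]]; rewrite ltNge => /negP.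
Qed.

(** Serves as a mean value inequality for phi, whose derivative is -1/(gam R). *)
Lemma phi_diff_bounds (a b m M : R) : 0 < a -> a <= b -> 0 < m ->
  (forall x, a <= x -> x <= b -> m <= Rf x <= M) ->
  (b - a) / (gam * M) <= phi gam Rf a - phi gam Rf b <= (b - a) / (gam * m).
Proof.
move=> a0 ab m0 H.
have M0 : 0 < M by have /andP[h1 h2] := H a (lexx a) ab; rewrite (lt_le_trans m0)// (le_trans h1).
have := If_split a0 ab; rewrite !phiE ?(lt_le_trans a0)// => E.
have Ifin : (\int[lebesgue_measure]_(x in `[a, b[) ((Rf x)^-1)%:E)%E = (gam * (phi gam Rf a - phi gam Rf b))%:E.
  by rewrite mulrBr EFinB E addeK.
have mf : measurable_fun (`[a, b[%classic : set R) (fun x : R => ((Rf x)^-1)%:E).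
  apply/measurable_EFinP; apply: (invRf_measurable a0) => x /=.
  by rewrite !in_itv/= andbT => /andP[].
have cstI (r : R) : (\int[lebesgue_measure]_(x in `[a, b[) (cst r%:E x))%E = (r * (b - a))%:E.
  rewrite integral_cst//= lebesgue_measure_itv/= lte_fin; case: ltP => [_|ba]; first by rewrite -EFinB -EFinM.
  by rewrite mule0 (le_anti (introT andP (conj ab ba))) subrr mulr0.
have low : ((b - a) / M <= gam * (phi gam Rf a - phi gam Rf b)).
  rewrite -lee_fin -Ifin mulrC -cstI; apply: ge0_le_integral => //=.
  - by move=> x _; rewrite lee_fin invr_ge0 ltW.
  - move=> x; rewrite in_itv/= => /andP[ax xb]; have /andP[h1 h2] := H x ax (ltW xb).
    by rewrite lee_fin lef_pV2 ?posrE// (lt_le_trans m0).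
have up : (gam * (phi gam Rf a - phi gam Rf b) <= (b - a) / m).
  rewrite -lee_fin -Ifin mulrC -cstI; apply: ge0_le_integral => //=.
  - by move=> x; rewrite in_itv/= => /andP[ax xb]; rewrite lee_fin (invRf_ge0 a0).
  - move=> x; rewrite in_itv/= => /andP[ax xb]; have /andP[h1 h2] := H x ax (ltW xb).
    by rewrite lee_fin lef_pV2 ?posrE// (lt_le_trans m0).
by rewrite !invfM !mulrA !(mulrAC _ gam^-1) ler_pdivrMr// ler_pdivlMr// ![_ * gam]mulrC low up.
Qed.


Lemma phi_ge0 (b : R) : 0 < b -> 0 <= phi gam Rf b.
Proof.
by move=> b0; have := If_ge0 b0; rewrite phiE// lee_fin pmulr_rge0.
Qed.

Lemma Rf_minmax (a b : R) : 0 < a -> a <= b -> exists m M : R, [/\ 0 < m, 0 < M &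
  forall x, a <= x -> x <= b -> m <= Rf x <= M].
Proof.
move=> a0 ab.
have cR : {within `[a, b], continuous Rf}.
  apply: (continuous_subspaceW _ Rf_cont) => y /=.
  by rewrite !in_itv/= andbT => /andP[? _]; rewrite (le_trans _ (_ : a <= y))// ltW.
have [c cab cP] := EVT_min ab cR; have [d dab dP] := EVT_max ab cR.
move: (cab) (dab); rewrite !in_itv/= => /andP[ac _] /andP[ad _].
exists (Rf c), (Rf d); split; try by apply: Rf_gt0; exact: lt_le_trans a0 _.
by move=> x ax xb; rewrite cP ?dP// in_itv/= ax.
Qed.

Lemma phi_lt (a b : R) : 0 < a -> a < b -> phi gam Rf b < phi gam Rf a.
Proof.
move=> a0 ab; have [m [M [m0 M0 mM]]] := Rf_minmax a0 (ltW ab).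
have /andP[+ _] := phi_diff_bounds a0 (ltW ab) m0 mM.
by rewrite -subr_gt0; apply: lt_le_trans; rewrite divr_gt0 ?mulr_gt0// subr_gt0.
Qed.

Lemma phi_le (a b : R) : 0 < a -> a <= b -> phi gam Rf b <= phi gam Rf a.
Proof.
by move=> a0; rewrite le_eqVlt => /predU1P[->//|ab]; exact/ltW/phi_lt.
Qed.

Lemma phi_gt0 (b : R) : 0 < b -> 0 < phi gam Rf b.
Proof.
move=> b0; apply: (le_lt_trans (phi_ge0 (_ : 0 < b + 1))); first by rewrite addr_gt0.
by apply: phi_lt => //; rewrite ltrDl.
Qed.

Lemma If_scale (lam b : R) : 0 < lam -> 0 < b -> If (lam * b) =
  (lam%:E * \int[lebesgue_measure]_(v in `[b, +oo[) ((Rf (lam * v))^-1)%:E)%E.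
Proof.
move=> l0 b0.
have lb0 : 0 < lam * b by rewrite mulr_gt0.
have d1 (v : R) : is_derive v 1 (fun v : R => lam * v) lam.
  have h := is_deriveZ lam (is_derive_id v (1 : R)).
    by rewrite (_ : lam *: 1 = lam) in h; last by rewrite /GRing.scale/= mulr1.
have D : (fun v : R => lam * v)^`()%classic = cst lam.
  by apply/funext => v; rewrite derive1E; have := d1 v => -[].
have cl (v : R) : {for v, continuous (fun v : R => lam * v)}.
  by apply: cvgM; [exact: cvg_cst|exact: cvg_id].
rewrite (@increasing_ge0_integration_by_substitutiony _ (fun v => lam * v) (fun x => (Rf x)^-1) b).
- rewrite -ge0_integralZl//.
  + by apply: eq_integral => v _; rewrite fctE /= D -EFinM mulrC.
  + apply/measurable_EFinP; apply: subspace_continuous_measurable_fun => //.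
    apply/continuous_within_itvcyP; split => [x|].
      rewrite in_itv/= andbT => bx; have x0 := lt_trans b0 bx.
      apply: cvgV; first by rewrite gt_eqF// Rf_gt0// mulr_gt0.
      by apply: (@continuous_comp _ _ _ (fun v => lam * v) Rf) => //; apply: Rf_cont0; rewrite mulr_gt0.
    apply: cvg_at_right_filter.
    apply: cvgV; first by rewrite gt_eqF// Rf_gt0// mulr_gt0.
    by apply: (@continuous_comp _ _ _ (fun v => lam * v) Rf) => //; apply: Rf_cont0; rewrite mulr_gt0.
  + move=> v /=; rewrite in_itv/= andbT => bv; rewrite lee_fin invr_ge0 ltW// Rf_gt0// mulr_gt0//.
    exact: lt_le_trans bv.
  + by rewrite lee_fin ltW.
- by move=> x y _ _; rewrite ltr_pM2l.
- by rewrite D => x _; exact: cst_continuous.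
- by rewrite D; exact: is_cvg_cst.
- by rewrite D; exact: is_cvg_cst.
- split => [x _|]; first by have := d1 x => -[].
  exact/cvg_at_right_filter/cl.
- by apply: gt0_cvgMry => //; exact: cvg_id.
- exact: (Rf_within lb0).
- by move=> x; rewrite in_itv/= andbT => bx; rewrite (invRf_ge0 lb0)// ltW.
Qed.

(** Regular variation of phi with index 1 - th. After the substitution by the factor [lam], the
    integrand 1/R(lam v) is close to lam^-th / R(v) for all v >= x once x is large, and this
    relative error passes through the integral. *)
Lemma phi_scale (lam e : R) : 0 < lam -> 0 < e -> exists x0 : R, 0 < x0 /\
  forall x, x0 <= x -> `|phi gam Rf (lam * x) - lam `^ (1 - th) * phi gam Rf x| <= e * phi gam Rf x.
Proof.
move=> l0 e0; have lth : 0 < lam `^ (- th) by rewrite powR_gt0.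
(* Division by [lam] compensates the Jacobian; the cap lam^-th keeps the lower coefficient
   nonnegative, as integrals of nonnegative functions require. *)
pose e1 := Num.min (e / lam) (lam `^ (- th)).
have e10 : 0 < e1 by rewrite /e1 lt_min divr_gt0.
have /cvgV : lam `^ th != 0 by rewrite gt_eqF// powR_gt0.
move=> /(_ _ _ _ _ (Rf_rv l0)) /cvgrPdist_le /(_ _ e10) /near_pinftyP[x0 [x00 x0P]].
exists x0; split=> // x xx; have xp := lt_le_trans x00 xx.
have B v : x <= v -> (lam `^ (- th) - e1) * (Rf v)^-1 <= (Rf (lam * v))^-1 <= (lam `^ (- th) + e1) * (Rf v)^-1.
  move=> xv; have : `|(lam `^ th)^-1 - (Rf (lam * v) / Rf v)^-1| <= e1 := x0P v (le_trans xx xv).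
  have Rv : 0 < Rf v by apply: Rf_gt0; exact: lt_le_trans xv.
  have Rlv : 0 < Rf (lam * v) by apply: Rf_gt0; rewrite mulr_gt0//; exact: lt_le_trans xv.
  rewrite -powRN invf_div distrC ler_distl => /andP[b1 b2].
  have -> : (Rf (lam * v))^-1 = Rf v / Rf (lam * v) * (Rf v)^-1 by rewrite mulrAC divff ?gt_eqF// mul1r.
  by rewrite !ler_pM2r ?invr_gt0// b1 b2.
have mR : measurable_fun (`[x, +oo[%classic : set R) (fun v : R => ((Rf v)^-1)%:E).
  by apply/measurable_EFinP; exact: invRf_measurable xp _.
have mRl : measurable_fun (`[x, +oo[%classic : set R) (fun v : R => ((Rf (lam * v))^-1)%:E).
  apply/measurable_EFinP; apply: subspace_continuous_measurable_fun => //.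
  apply/continuous_within_itvcyP; split => [y|].
    rewrite in_itv/= andbT => bx; have y0 := lt_trans xp bx.
    apply: cvgV; first by rewrite gt_eqF// Rf_gt0// mulr_gt0.
    apply: (@continuous_comp _ _ _ (fun v => lam * v) Rf); last by apply: Rf_cont0; rewrite mulr_gt0.
    by apply: cvgM; [exact: cvg_cst|exact: cvg_id].
  apply: cvg_at_right_filter.
  apply: cvgV; first by rewrite gt_eqF// Rf_gt0// mulr_gt0.
  apply: (@continuous_comp _ _ _ (fun v => lam * v) Rf); last by apply: Rf_cont0; rewrite mulr_gt0.
  by apply: cvgM; [exact: cvg_cst|exact: cvg_id].
have Z (k : R) : 0 <= k -> (\int[lebesgue_measure]_(v in `[x, +oo[) (k * (Rf v)^-1)%:E)%E = (k * (gam * phi gam Rf x))%:E.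
  move=> k0; rewrite EFinM -phiE// -ge0_integralZl//.
  by move=> v /=; rewrite in_itv/= andbT => bv; rewrite lee_fin (invRf_ge0 xp).
have k0 : 0 <= lam `^ (- th) - e1 by rewrite subr_ge0 ge_min lexx orbT.
have mZ (k : R) : measurable_fun (`[x, +oo[%classic : set R) (fun v : R => (k * (Rf v)^-1)%:E).
  by apply/measurable_EFinP/measurable_funM => //; exact: invRf_measurable xp _.
have lxp : 0 < lam * x by rewrite mulr_gt0.
have E := If_scale l0 xp; rewrite phiE// in E.
set J := (\int[lebesgue_measure]_(v in _) _)%E in E.
have J1 : (((lam `^ (- th) - e1) * (gam * phi gam Rf x))%:E <= J)%E.
  rewrite -Z//; apply: ge0_le_integral; [by []| |exact: mZ|exact: mRl|];
    move=> v /=; rewrite in_itv/= andbT => xv; rewrite lee_fin.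
    by rewrite mulr_ge0// (invRf_ge0 xp).
  by have /andP[] := B v xv.
have J2 : (J <= ((lam `^ (- th) + e1) * (gam * phi gam Rf x))%:E)%E.
  rewrite -Z; last by rewrite addr_ge0// ltW.
  apply: ge0_le_integral; [by []| |exact: mRl|exact: mZ|];
    move=> v /=; rewrite in_itv/= andbT => xv; rewrite lee_fin.
    by rewrite invr_ge0 ltW// Rf_gt0// mulr_gt0// (lt_le_trans xp).
  by have /andP[] := B v xv.
have Jf : J \is a fin_num.
  by rewrite fin_numElt (lt_le_trans _ J1) ?ltNyr// (le_lt_trans J2) ?ltry.
move: E J1 J2; rewrite -(fineK Jf) !lee_fin -EFinM => -[E] J1 J2.
have -> : lam `^ (1 - th) = lam * lam `^ (- th).
  by rewrite powRD; [rewrite powRr1// ltW|rewrite (gt_eqF l0) implybT].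
have px := phi_ge0 xp; rewrite ler_distl -(ler_pM2l gam0) -[X in _ && X](ler_pM2l gam0) E.
have e1l : lam * e1 <= e by rewrite -ler_pdivlMl// mulrC ge_min lexx.
have gp : 0 <= gam * phi gam Rf x by rewrite mulr_ge0// ltW.
have := ler_wpM2r gp e1l.
move: (ler_wpM2l (ltW l0) J1) (ler_wpM2l (ltW l0) J2).
set P := phi gam Rf x in gp *; set A := lam `^ (- th); set F := fine J.
by move=> h1 h2 h3; apply/andP; split; lra.
Qed.


(** Iterates phi(2x) <= q phi(x), with q the midpoint of 2^(1-th) and 1; monotonicity covers the
    points in between. *)
Lemma phi_cvg0 (e : R) : 0 < e -> exists x0, 0 < x0 /\ forall x, x0 <= x -> phi gam Rf x < e.
Proof.
move=> e0; pose l2 := 2 `^ (1 - th) : R.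
have l21 : l2 < 1.
  by rewrite /l2 /powR gt_eqF// -[X in _ < X]expR0 ltr_expR pmulr_llt0 ?ln_gt0 ?ltr1n// subr_lt0.
have l20 : 0 < l2 by rewrite powR_gt0.
pose q := (1 + l2) / 2; have q1 : q < 1 by rewrite /q; lra.
have q0 : 0 < q by rewrite /q; lra.
have d0 : 0 < (1 - l2) / 2 by lra.
have [x0 [x00 x0P]] := phi_scale (ltr0n R 2 : 0 < 2) d0.
have S x : x0 <= x -> phi gam Rf (2 * x) <= q * phi gam Rf x.
  move=> xx; have := x0P x xx; rewrite ler_norml -/l2 => /andP[_].
  by rewrite lerBlDl -mulrDl; congr (_ <= _ * _); rewrite /q; field.
have It n : phi gam Rf (2 ^+ n * x0) <= q ^+ n * phi gam Rf x0.
  elim: n => [|n IH]; first by rewrite !expr0 !mul1r.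
  rewrite exprS -(mulrA 2) (le_trans (S _ _))//.
    by apply: ler_peMl; [exact: ltW|rewrite exprn_ege1// ler1n].
  by rewrite exprS -(mulrA q) ler_pM2l.
have : q ^+ n * phi gam Rf x0 @[n --> \oo] --> (0 : R).
  rewrite -[X in _ --> X](mul0r (phi gam Rf x0)); apply: cvgM; last exact: cvg_cst.
  by apply: cvg_expr; rewrite ger0_norm// ltW.
move=> /cvgrPdist_lt /(_ _ e0) [N _ /(_ N (leqnn N))]; rewrite sub0r normrN => HN.
exists (2 ^+ N * x0); split; first by rewrite mulr_gt0 ?exprn_gt0.
move=> x xx; apply: le_lt_trans (phi_le _ xx) _; first by rewrite mulr_gt0 ?exprn_gt0.
by apply: le_lt_trans (It N) _; apply: le_lt_trans HN; rewrite ler_norm.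
Qed.

(** Karamata's relation up to constants. On [x, (1 + rho) x] the function R varies by a factor at
    most 2, so the drop of phi there is of order x/(gam R(x)); by scaling this drop is also a
    definite fraction of phi(x). *)
Lemma phi_compare : exists C x0 : R, [/\ 0 < C, 0 < x0 & forall x, x0 <= x ->
  x / (gam * Rf x) <= C * phi gam Rf x /\ phi gam Rf x <= C * (x / (gam * Rf x))].
Proof.
have [rho [x0 [rho0 rho1 x00 H]]] := regvar_equicontinuous Rf_cont Rf_gt0 Rf_rv ltr01.
pose lam := 1 + rho; have lam0 : 0 < lam by rewrite /lam; lra.
pose l2 := lam `^ (1 - th).
have l21 : l2 < 1.
  rewrite /l2 /powR gt_eqF// -[X in _ < X]expR0 ltr_expR pmulr_llt0 ?ln_gt0 ?ltrDl//.
  by rewrite subr_lt0.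
have d0 : 0 < (1 - l2) / 2 by lra.
have [x1 [x10 x1P]] := phi_scale lam0 d0.
pose C := Num.max (2 / rho) (4 * rho / (1 - l2)).
have C0 : 0 < C by rewrite /C lt_max divr_gt0.
exists C, (Num.max x0 x1); split => //; first by rewrite lt_max x00.
move=> x; rewrite ge_max => /andP[xx0 xx1].
have xp := lt_le_trans x00 xx0; have Rx := Rf_gt0 xp.
have px := phi_gt0 xp.
have xl : x <= lam * x by rewrite /lam mulrDl mul1r lerDl mulr_ge0// ltW.
have B y : x <= y -> y <= lam * x -> Rf x / 2 <= Rf y <= 2 * Rf x.
  move=> xy yl; have : `|y - x| <= rho * x.
    by rewrite ger0_norm ?subr_ge0// lerBlDl; move: yl; rewrite /lam mulrDl mul1r.
  by move=> /(H _ _ xx0)[h1 h2]; apply/andP; split; lra.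
have /andP[] := phi_diff_bounds xp xl (divr_gt0 Rx (ltr0n _ 2)) B.
have -> : lam * x - x = rho * x by rewrite /lam; ring.
have plx : 0 <= phi gam Rf (lam * x) by apply: phi_ge0; rewrite mulr_gt0.
have := x1P x xx1; rewrite ler_norml -/l2 => /andP[_ h].
set G := x / (gam * Rf x); have G0 : 0 < G by rewrite divr_gt0 ?mulr_gt0.
have -> : rho * x / (gam * (2 * Rf x)) = rho / 2 * G by rewrite /G; field; rewrite !gt_eqF.
have -> : rho * x / (gam * (Rf x / 2)) = 2 * rho * G by rewrite /G; field; rewrite !gt_eqF.
set p := phi gam Rf x in px h *; set p' := phi _ _ _ in plx h * => b1 b2.
split.
  apply: (@le_trans _ _ (2 / rho * p)); last by rewrite ler_pM2r// le_max lexx.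
  rewrite -(@ler_pM2l _ (rho / 2)) ?divr_gt0//.
  have -> : rho / 2 * (2 / rho * p) = p by field; rewrite gt_eqF.
  lra.
apply: (@le_trans _ _ (4 * rho / (1 - l2) * G)); last by rewrite ler_pM2r// le_max lexx orbT.
rewrite mulrAC ler_pdivlMr; lra.
Qed.

(** Since -th < 1 - th, the product phi(x) x^th eventually grows under doubling. The bound converts
    probabilities of order x^-dl into powers of phi(x). *)
Lemma phi_power_lower : exists c x0 : R, [/\ 0 < c, 0 < x0 & forall x, x0 <= x ->
  x `^ (- th) <= c * phi gam Rf x].
Proof.
have d0 : 0 < 2 `^ (1 - th) - 2 `^ (- th) :> R.
  by rewrite subr_gt0 /powR !gt_eqF// ltr_expR ltr_pM2r ?ln_gt0 ?ltr1n//; lra.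
have [x0 [x00 x0P]] := phi_scale (ltr0n R 2 : 0 < 2) d0.
have S x : x0 <= x -> 2 `^ (- th) * phi gam Rf x <= phi gam Rf (2 * x).
  move=> xx; have := x0P x xx; rewrite ler_norml => /andP[+ _].
  by lra.
have x0t : 0 < x0 `^ th by rewrite powR_gt0.
have x20 : 0 < 2 * x0 by rewrite mulr_gt0.
pose c := phi gam Rf (2 * x0) * x0 `^ th.
have c0 : 0 < c by rewrite mulr_gt0// phi_gt0.
have th0 : 0 <= th by have := th1; lra.
exists c^-1, x0; split => //; first by rewrite invr_gt0.
move=> x xx; have xp := lt_le_trans x00 xx.
have xt : 0 < x `^ th by rewrite powR_gt0.
rewrite powRN ler_pdivlMl// ler_pdivrMr//.
move: x xx {xp xt}; apply: (@doubling_lower _ (fun x => phi gam Rf x * x `^ th)) => //.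
  move=> x /andP[xx xx2]; have xp := lt_le_trans x00 xx.
  apply: ler_pM; [exact/ltW/phi_gt0|exact: ltW|exact: phi_le|].
  by apply: ge0_ler_powR => //; rewrite nnegrE ltW.
move=> x xx; have xp := lt_le_trans x00 xx.
rewrite powRM ?(ltW xp)// mulrA ler_pM2r ?powR_gt0//.
by rewrite -ler_pdivrMr ?powR_gt0// -powRN mulrC S.
Qed.

End Phi.

(** * The inverse of phi and its regular variation at 0 *)

Section PhiInverse.
Variables (R : realType) (gam : R) (Rf : R -> R) (th : R).
Hypothesis Rf_cont : {within `[0%R, +oo[%classic, continuous Rf}.
Hypothesis Rf_gt0 : forall x : R, 0 < x -> 0 < Rf x.
Hypothesis gam0 : 0 < gam.
Hypothesis th1 : 1 < th.
Hypothesis Rf_rv : regvar_infty Rf th.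

Let ph := phi gam Rf.
Let psi := phi_inv gam Rf.

Let plt a b : 0 < a -> a < b -> ph b < ph a.
Proof. exact: (phi_lt Rf_cont Rf_gt0 gam0 th1 Rf_rv). Qed.

Let ple a b : 0 < a -> a <= b -> ph b <= ph a.
Proof. exact: (phi_le Rf_cont Rf_gt0 gam0 th1 Rf_rv). Qed.

Let pgt0 b : 0 < b -> 0 < ph b.
Proof. exact: (phi_gt0 Rf_cont Rf_gt0 gam0 th1 Rf_rv). Qed.

Let pscale := phi_scale Rf_cont Rf_gt0 gam0 th1 Rf_rv.

Lemma phi_inv_has_inf (t : R) : 0 < t -> has_inf [set b | 0 < b /\ ph b <= t].
Proof.
move=> t0; split.
  have [x0 [x00 H]] := phi_cvg0 Rf_cont Rf_gt0 gam0 th1 Rf_rv t0.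
  by exists x0; split => //; apply/ltW/H.
by exists 0 => b [/ltW].
Qed.

(** This and the next three comparisons locate [psi t] by monotonicity of phi alone. Levels at a
    positive relative distance from [psi t] then stand in for the identity phi(psi t) = t. *)
Lemma phi_inv_ge (t b : R) : 0 < t -> 0 < b -> t < ph b -> b <= psi t.
Proof.
move=> t0 b0 tb; have [ne _] := phi_inv_has_inf t0.
apply: lb_le_inf => // c [c0 ct]; rewrite leNgt; apply/negP => cb.
by have := plt c0 cb; rewrite ltNge (le_trans ct (ltW tb)).
Qed.

Lemma phi_inv_gt (t b : R) : 0 < t -> 0 < b -> b < psi t -> t < ph b.
Proof.
move=> t0 b0 bp; have [_ lb] := phi_inv_has_inf t0.
rewrite ltNge; apply/negP => pb; move: bp; rewrite ltNge => /negP; apply.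
by apply: ge_inf.
Qed.

Lemma phi_inv_lt (t b : R) : 0 < t -> psi t < b -> ph b <= t.
Proof.
move=> t0 pb; have ne := phi_inv_has_inf t0.
have d0 : 0 < b - psi t by rewrite subr_gt0.
have [c [c0 ct]] := inf_adherent d0 ne.
rewrite -/(phi_inv gam Rf t) -/psi addrC subrK => cb.
exact: le_trans (ple c0 (ltW cb)) ct.
Qed.

Lemma phi_inv_le (t b : R) : 0 < t -> 0 < b -> ph b <= t -> psi t <= b.
Proof.
by move=> t0 b0 bt; have [_ lb] := phi_inv_has_inf t0; apply: ge_inf.
Qed.

Lemma phi_inv_infty (M : R) : 0 < M -> exists t0 : R, 0 < t0 /\
  forall t, 0 < t -> t < t0 -> M <= psi t.
Proof.
by move=> M0; exists (ph M); split => [|t t0 tM]; [exact: pgt0|exact: phi_inv_ge].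
Qed.

(** Quantitative strict decrease: as (1 + h)^(1-th) < 1, a relative gap [h] in the argument costs a
    definite fraction of phi, and [e] is half of the limiting loss. *)
Lemma phi_sep (h : R) : 0 < h -> exists e x0 : R, [/\ 0 < e, e < 1, 0 < x0 &
  forall x y, x0 <= x -> (1 + h) * x <= y -> ph y <= (1 - e) * ph x].
Proof.
move=> h0; pose l2 := (1 + h) `^ (1 - th).
have h10 : 0 < 1 + h by lra.
have l21 : l2 < 1.
  rewrite /l2 /powR gt_eqF// -[X in _ < X]expR0 ltr_expR pmulr_llt0 ?ln_gt0 ?ltrDl//.
  by rewrite subr_lt0.
have l20 : 0 < l2 by rewrite powR_gt0.
have d0 : 0 < (1 - l2) / 2 by lra.
have [x0 [x00 x0P]] := pscale h10 d0.
exists ((1 - l2) / 2), x0; split => //; first by lra.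
move=> x y xx xy; have xp := lt_le_trans x00 xx.
apply: le_trans (ple _ xy) _; first by rewrite mulr_gt0.
have := x0P x xx; rewrite ler_norml -/l2 => /andP[_].
rewrite -/ph; lra.
Qed.

Lemma phi_inv_close (h : R) : 0 < h -> exists e t0 : R, [/\ 0 < e, 0 < t0 &
  forall t y, 0 < t -> t < t0 -> 0 < y -> `|ph y - t| <= e * t -> `|y / psi t - 1| <= h].
Proof.
wlog h1 : h / h <= 1 / 2.
  move=> wl h0; have [le1|/ltW ge1] := leP h (1 / 2); first exact: wl.
  have [//||e [t0 [e0 t00 H]]] := wl (1 / 2); first by lra.
  exists e, t0; split => // t y t1 t2 y0 yt.
  by apply: le_trans (H _ _ t1 t2 y0 yt) _.
move=> h0; have h40 : 0 < h / 4 by lra.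
have [e [x0 [e0 e1 x00 S]]] := phi_sep h40.
have x200 : 0 < 2 * x0 by rewrite mulr_gt0.
have [t0 [t00 T]] := phi_inv_infty x200.
exists (e / 2), t0; split => // [|t y t1 t2 y0].
  by rewrite divr_gt0.
have P := T _ t1 t2; have P0 : 0 < psi t by lra.
rewrite ler_norml => /andP[yt1 yt2].
have et0 : 0 < e * t by rewrite mulr_gt0.
have hp0 : 0 < h * psi t by rewrite mulr_gt0.
have hp1 : h * psi t <= 1 / 2 * psi t by rewrite ler_pM2r.
have hhp1 : h * (h * psi t) <= 1 / 2 * (h * psi t) by rewrite ler_pM2r.
have hhp0 : 0 < h * (h * psi t) by rewrite mulr_gt0.
rewrite ler_norml lerBrDr lerBlDr ler_pdivlMr// ler_pdivrMr//.
apply/andP; split; rewrite leNgt; apply/negP => yl.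
(* The level (1 - h/2) psi t lies between the offending y and psi t, so both the definition of the
   inverse and the separation with gap h/4 apply. The fraction [e] lost there exceeds the tolerance
   e/2. The other side is symmetric. *)
- have b1 : ph ((1 - h / 2) * psi t) > t.
    by apply: phi_inv_gt => //; move: P0 hp0 hp1; hide_comparisons; lra.
  have b2 : ph ((1 - h / 2) * psi t) <= (1 - e) * ph ((1 - h) * psi t).
    by apply: S; move: P P0 x00 hp0 hp1 hhp0 hhp1; hide_comparisons; lra.
  have b3 : ph ((1 - h) * psi t) <= ph y by apply: ple; [|move: yl; hide_comparisons; lra].
  have b4 : (1 - e) * ph ((1 - h) * psi t) <= (1 - e) * ((1 + e / 2) * t) by rewrite ler_pM2l; [move: b3 yt2|move: e1]; hide_comparisons; lra.
  have : e * (e * t) > 0 by rewrite mulr_gt0.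
  move: b1 b2 b4 et0; hide_comparisons; lra.
- have b1 : ph ((1 + h / 2) * psi t) <= t by apply: phi_inv_lt => //; lra.
  have b2 : ph y <= (1 - e) * ph ((1 + h / 2) * psi t).
    by apply: S; move: P P0 x00 yl hp0 hp1 hhp0 hhp1; hide_comparisons; lra.
  have b4 : (1 - e) * ph ((1 + h / 2) * psi t) <= (1 - e) * t.
    by rewrite ler_pM2l; [|move: e1; hide_comparisons; lra].
  move: b2 b4 yt1 et0; hide_comparisons; lra.
Qed.

Lemma regvar_0_phi_inv : regvar_0 psi (- (th - 1)^-1).
Proof.
have near0 (t0 : R) (Q : R -> Prop) : 0 < t0 -> (forall t, 0 < t -> t < t0 -> Q t) ->
    \forall t \near 0^'+, Q t.
  move=> t00 H; near=> t; apply: H; near: t; first exact: nbhs_right_gt.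
  exact: nbhs_right_lt.
split.
  have [t0 [t00 T]] := phi_inv_infty ltr01.
  by apply: (near0 t0) => // t t1 t2; rewrite (lt_le_trans ltr01)// T.
move=> mu mu0; set lam := mu `^ (- (th - 1)^-1).
have l0 : 0 < lam by rewrite powR_gt0.
have lmu : lam `^ (1 - th) = mu.
  rewrite /lam -powRrM -[RHS]powRr1 ?ltW//; congr (_ `^ _).
  by field; rewrite subr_eq0 gt_eqF.
have decr (a b : R) : 0 < a -> a < b -> b `^ (1 - th) < a `^ (1 - th).
  move=> a0 ab; have b0 := lt_trans a0 ab.
  rewrite /powR !gt_eqF// ltr_expR ltr_nM2l ?subr_lt0// ltr_ln ?posrE//.
apply/cvgrPdist_le => e0 e00; pose e := Num.min e0 (lam / 2).
have e_gt0 : 0 < e by rewrite lt_min e00 divr_gt0.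
have e_lam : e <= lam / 2 by rewrite ge_min lexx orbT.
have e_e0 : e <= e0 by rewrite ge_min lexx.
pose lp := lam + e / 2; pose lm := lam - e / 2.
have lp0 : 0 < lp by rewrite /lp; lra.
have lm0 : 0 < lm by rewrite /lm; lra.
have dp : 0 < mu - lp `^ (1 - th) by rewrite subr_gt0 -lmu decr// /lp; lra.
have dm : 0 < lm `^ (1 - th) - mu by rewrite subr_gt0 -lmu decr// /lm; lra.
(* The slack [h] moves the argument off [psi t], where phi can be compared with t. It is small
   enough that lp (1 + h) <= lam + e and lm (1 - h) >= lam - e. *)
pose h := e / (4 * lam).
have h0 : 0 < h by rewrite divr_gt0// mulr_gt0.
have h1 : h <= 1 / 8 by rewrite ler_pdivrMr ?mulr_gt0//; lra.
have hl : h * lam = e / 4 by rewrite /h; field; rewrite gt_eqF.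
have [x1 [x10 X1]] := pscale lp0 dp; have [x2 [x20 X2]] := pscale lm0 dm.
have x120 : 0 < 2 * (x1 + x2) by rewrite mulr_gt0// addr_gt0.
have [t0 [t00 T]] := phi_inv_infty x120.
have tm : 0 < Num.min t0 (t0 / mu) by rewrite lt_min t00 divr_gt0.
apply: (near0 _ _ tm) => t t1; rewrite lt_min => /andP[t2 t3].
have P := T _ t1 t2; have P0 : 0 < psi t by lra.
have mt0 : 0 < mu * t by rewrite mulr_gt0.
have hp0 : 0 < h * psi t by rewrite mulr_gt0.
have hp1 : h * psi t <= 1 / 8 * psi t by rewrite ler_pM2r.
have up : psi (mu * t) <= lp * ((1 + h) * psi t).
  apply: phi_inv_le => //; first by rewrite !mulr_gt0//; lra.
  have : ph ((1 + h) * psi t) <= t by apply: phi_inv_lt => //; lra.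
  have := X1 ((1 + h) * psi t); rewrite -!/ph => /(_ ltac:(lra)).
  rewrite ler_norml => /andP[_ a1] a2.
  have : mu * ph ((1 + h) * psi t) <= mu * t by rewrite ler_pM2l.
  move: a1; hide_comparisons; lra.
have lo : lm * ((1 - h) * psi t) <= psi (mu * t).
  apply: phi_inv_ge => //; first by rewrite !mulr_gt0//; lra.
  have : t < ph ((1 - h) * psi t) by apply: phi_inv_gt => //; move: P0 hp0 hp1; hide_comparisons; lra.
  have := X2 ((1 - h) * psi t); rewrite -!/ph => /(_ ltac:(lra)).
  rewrite ler_norml => /andP[a1 _] a2.
  have : mu * t < mu * ph ((1 - h) * psi t) by rewrite ltr_pM2l.
  move: a1; hide_comparisons; lra.
have eh : 0 <= e * h by rewrite mulr_ge0// ltW.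
have eh1 : e * h <= e * (1 / 8) by rewrite ler_pM2l.
rewrite distrC (le_trans _ e_e0)// ler_norml lerBrDr lerBlDr ler_pdivlMr// ler_pdivrMr//.
apply/andP; split; [apply: le_trans lo|apply: (le_trans up)];
  rewrite mulrA ler_pM2r// /lp /lm; move: hl eh eh1 e_gt0 h0 h1; hide_comparisons; lra.
Unshelve. all: by end_near. Qed.

End PhiInverse.

Lemma ratio_error (R : realType) (e2 h w d q D : R) : 0 <= e2 -> e2 <= 1 -> 0 <= h ->
  h <= (1 + e2) * w -> w <= (1 + e2) * h -> `|d - w| <= q ->
  (0 <= d -> d <= (1 + e2) * D /\ D <= (1 + e2) * d) ->
  (d < 0 -> (1 + e2) * d <= D /\ (1 + e2) * D <= d) ->
  `|D - h| <= 3 * e2 * h + 2 * q.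
Proof.
move=> e0 e1 h0 hw wh; rewrite ler_norml => /andP[q1 q2] dp dn.
have e2p : 0 < 1 + e2 by lra.
have w0 : 0 <= w by rewrite -(pmulr_rge0 _ e2p); lra.
have q0 : 0 <= q by lra.
have e20 : 1 + e2 >= 0 by lra.
have eh : 0 <= e2 * h by rewrite mulr_ge0.
have e2h : e2 * (e2 * h) <= e2 * h by rewrite ler_piMl.
have e2q : e2 * q <= q by rewrite ler_piMl.
have dq : (1 + e2) * d <= (1 + e2) * (w + q) by rewrite ler_wpM2l//; lra.
have dq' : (1 + e2) * (w - q) <= (1 + e2) * d by rewrite ler_wpM2l//; lra.
have ww := ler_wpM2l e20 wh.
have [d0|d0] := leP 0 d.
  have [d1 d2] := dp d0.
  have D0 : 0 <= D by rewrite -(pmulr_rge0 _ e2p); lra.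
  rewrite ler_norml; apply/andP; split; last by lra.
  have [Dh|hD] := leP h D; first by lra.
  have dd := ler_wpM2l e20 d1.
  have eD : e2 * D <= e2 * h by rewrite ler_wpM2l// ltW.
  have eD0 : 0 <= e2 * D by rewrite mulr_ge0.
  have eeD : e2 * (e2 * D) <= e2 * D by rewrite ler_piMl.
  lra.
have [d1 d2] := dn d0.
have D0 : D <= 0.
  rewrite leNgt; apply/negP => D0.
  have : 0 <= (1 + e2) * D by rewrite mulr_ge0// ltW.
  lra.
by rewrite ler_norml; apply/andP; split; lra.
Qed.

(** * Deterministic estimates along one path *)

Section Pathwise.
Variables (R : realType) (gam : R) (Rf : R -> R) (th : R).
Hypothesis Rf_cont : {within `[0%R, +oo[%classic, continuous Rf}.
Hypothesis Rf_gt0 : forall x : R, 0 < x -> 0 < Rf x.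
Hypothesis gam0 : 0 < gam.
Hypothesis th1 : 1 < th.
Hypothesis Rf_rv : regvar_infty Rf th.

Notation mu := (@lebesgue_measure R).

Lemma tau0_ge (x s1 : R) (l : R -> R) :
  (forall r, 0 <= r -> r < s1 -> 0 <= x + l r) -> (s1%:E <= tau0 x l)%E.
Proof.
move=> H; apply: le_ereal_inf_tmp => _ /= [r [r0 rn] <-]; rewrite lee_fin leNgt.
by apply/negP => rs; have := H r r0 rs; rewrite leNgt rn.
Qed.

Lemma eta_inv_ge0 (x h : R) (l : R -> R) : (0 <= eta_inv Rf x l h)%E.
Proof. by apply: le_ereal_inf_tmp => _ /= [r [r0 _] <-]; rewrite lee_fin. Qed.

Lemma tau0_ge0 (x : R) (l : R -> R) : (0 <= tau0 x l)%E.
Proof. by apply: le_ereal_inf_tmp => _ /= [r [r0 _] <-]; rewrite lee_fin. Qed.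

(** The maximum with 0 covers the value 0 that [Xpath] takes when both times are infinite. *)
Lemma Xpath_le_sup (x h c : R) (l : R -> R) : (forall u, 0 <= u -> l u <= c) ->
  Xpath Rf x l h <= Num.max 0 (x + c).
Proof.
move=> lc; rewrite /Xpath.
have : (0 <= Order.min (eta_inv Rf x l h) (tau0 x l))%E.
  by rewrite le_min eta_inv_ge0 tau0_ge0.
case: (Order.min _ _) => [u||]; try by rewrite le_max lexx.
by rewrite lee_fin => u0; rewrite le_max lerD2l lc// orbT.
Qed.

(* Only two-sided bounds on R along the path are needed to locate the time
   change, so continuity of eta is never used. *)
Lemma Xpath_local (x a s1 m M h : R) (l : R -> R) :
  measurable_fun (`[0%R, +oo[%classic : set R) l ->
  0 < a -> 0 < m -> 0 <= h -> 0 < s1 -> M * h < s1 ->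
  (forall r, 0 <= r -> r < s1 -> a <= x + l r /\ m <= Rf (x + l r) <= M) ->
  exists u, [/\ m * h <= u, u <= M * h & Xpath Rf x l h = x + l u].
Proof.
move=> ml a0 m0 h0 s10 Mhs H.
have M0 : 0 < M by have [_ /andP[]] := H 0 (lexx 0) s10; have := m0; lra.
have t0 : (s1%:E <= tau0 x l)%E.
  by apply: tau0_ge => r r0 rs; have [ar _] := H r r0 rs; rewrite (le_trans (ltW a0)).
have etaE s : s <= s1 -> Defs.eta Rf x l s = (\int[mu]_(r in `[0%R, s[) ((Rf (x + l r))^-1)%:E)%E.
  move=> ss; rewrite /Defs.eta.
  have -> : [set r | 0 <= r /\ r < s /\ (r%:E < tau0 x l)%E] = `[0%R, s[%classic.
    apply/seteqP; split => r /=; rewrite in_itv/=; first by move=> [-> [-> _]].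
    move=> /andP[r0 rs]; split => //; split => //; by apply: lt_le_trans t0; rewrite lte_fin (lt_le_trans rs).
  apply: eq_integral => r; rewrite inE/= in_itv/= => /andP[r0 rs].
  by rewrite /eta_int Rf_gt0//; have [ar _] := H r r0 (lt_le_trans rs ss); exact: lt_le_trans ar.
have mf s : s <= s1 -> measurable_fun (`[0%R, s[%classic : set R) (fun r : R => ((Rf (x + l r))^-1)%:E).
  move=> ss; apply/measurable_EFinP.
  apply: (@measurable_comp _ _ _ _ _ _ (`[a, +oo[%classic : set R) (fun y : R => (Rf y)^-1) _ (fun r => x + l r)) => //.
  - move=> _ [r /= + <-]; rewrite !in_itv/= andbT => /andP[r0 rs].
    by have [] := H r r0 (lt_le_trans rs ss).
  - exact: (invRf_measurable Rf_cont Rf_gt0 a0 (@subset_refl _ _)).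
  - apply: measurable_funD => //; apply: measurable_funS ml => // r /=.
    by rewrite !in_itv/= => /andP[->].
have cstI (r s : R) : 0 <= s -> (\int[mu]_(x in `[0%R, s[) (cst r%:E x))%E = (r * s)%:E.
  move=> s0; rewrite integral_cst//= lebesgue_measure_itv/= lte_fin; case: ltP => [_|s0'].
    by rewrite -EFinB -EFinM subr0.
  by rewrite mule0 (le_anti (introT andP (conj s0' s0))) mulr0.
have lo s : 0 <= s -> s <= s1 -> ((s / M)%:E <= Defs.eta Rf x l s)%E.
  move=> s0 ss; rewrite etaE// mulrC -cstI//; apply: ge0_le_integral => //=.
  - by move=> r _; rewrite lee_fin invr_ge0 ltW.
  - exact: mf.
  - move=> r; rewrite in_itv/= => /andP[r0 rs]; have [_ /andP[h1 h2]] := H r r0 (lt_le_trans rs ss).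
    by rewrite lee_fin lef_pV2 ?posrE// (lt_le_trans m0).
have up s : 0 <= s -> s <= s1 -> (Defs.eta Rf x l s <= (s / m)%:E)%E.
  move=> s0 ss; rewrite etaE// mulrC -cstI//; apply: ge0_le_integral => //=.
  - move=> r; rewrite in_itv/= => /andP[r0 rs]; have [_ /andP[h1 h2]] := H r r0 (lt_le_trans rs ss).
    by rewrite lee_fin invr_ge0 (le_trans (ltW m0)).
  - exact: mf.
  - move=> r; rewrite in_itv/= => /andP[r0 rs]; have [_ /andP[h1 h2]] := H r r0 (lt_le_trans rs ss).
    by rewrite lee_fin lef_pV2 ?posrE// (lt_le_trans m0).
have mM : m <= M by have [_ /andP[]] := H 0 (lexx 0) s10; exact: le_trans.
have inv_lo : ((m * h)%:E <= eta_inv Rf x l h)%E.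
  apply: le_ereal_inf_tmp => _ /= [s [s0 hs] <-]; rewrite lee_fin.
  have [ss|ss] := leP s s1.
    by have := lt_le_trans hs (up s s0 ss); rewrite lte_fin ltr_pdivlMr// mulrC => /ltW.
  by apply/ltW/(le_lt_trans _ ss)/(le_trans _ (ltW Mhs)); rewrite ler_wpM2r.
have Mh0 : 0 <= M * h by rewrite mulr_ge0// ltW.
have inv_up : (eta_inv Rf x l h <= (M * h)%:E)%E.
  rewrite leNgt; apply/negP => lt1.
  (* Truncation at [s1] gives a real level even if the inverse is infinite. A midpoint s between M h
     and [s2] has eta(s) >= s/M > h, so the inverse is at most s, a contradiction. *)
  pose s2 := fine (Order.min (eta_inv Rf x l h) s1%:E).
  have s2E : s2%:E = Order.min (eta_inv Rf x l h) s1%:E.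
    rewrite fineK// fin_numElt; apply/andP; split.
      by rewrite lt_min ltNyr andbT (lt_trans _ lt1)// ltNyr.
    by rewrite gt_min ltry orbT.
  have s2M : M * h < s2 by rewrite -lte_fin s2E lt_min lt1 lte_fin.
  have s2s1 : s2 <= s1 by rewrite -lee_fin s2E ge_min lexx orbT.
  pose s := (M * h + s2) / 2.
  have sM : M * h < s by rewrite /s; lra.
  have ss2 : s < s2 by rewrite /s; lra.
  have : (eta_inv Rf x l h <= s%:E)%E.
    apply: ereal_inf_lbound => /=; exists s => //; split; first by lra.
    apply: lt_le_trans (lo s _ _); [|lra|lra].
    by rewrite lte_fin ltr_pdivlMr// mulrC.
  rewrite leNgt => /negP; apply; rewrite (@lt_le_trans _ _ s2%:E) ?lte_fin//.
  by rewrite s2E ge_min lexx.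
have invE : Order.min (eta_inv Rf x l h) (tau0 x l) = eta_inv Rf x l h.
  apply/min_idPl; apply: (le_trans inv_up); apply: le_trans t0.
  by rewrite lee_fin ltW.
rewrite /Xpath invE; case: (eta_inv _ _ _ _) inv_lo inv_up => [u||]//.
by rewrite !lee_fin => h1 h2; exists u.
Qed.

(** Up to Levy time [s1] a path close to its drift moves by at most r' x, a range on which R varies
    by a factor at most 1 + e2. By [phi_compare], a duration of order rho phi(x) needs less Levy
    time than that. The error is a fraction e' of rho phi(x), the length of a step, and not merely
    of phi(x); this is what makes steps composable. *)
Lemma Xpath_step (e' : R) : 0 < e' -> exists rho e1 x0 : R,
  [/\ 0 < rho, rho <= 1 / 2, 0 < e1, 0 < x0 & forall x h (l : R -> R),
    x0 <= x -> 0 <= h -> h <= 4 * rho * phi gam Rf x ->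
    measurable_fun (`[0%R, +oo[%classic : set R) l ->
    (forall u, 0 <= u -> `|l u + gam * u| <= e1 * (x + u)) ->
    x / 2 <= Xpath Rf x l h /\
    `|phi gam Rf (Xpath Rf x l h) - phi gam Rf x - h| <= e' * rho * phi gam Rf x].
Proof.
move=> e'0; pose e2 := Num.min (e' / 24) 1.
have e20 : 0 < e2 by rewrite lt_min divr_gt0 ?ltr01.
have e21 : e2 <= 1 by rewrite ge_min lexx orbT.
have e2e' : e2 <= e' / 24 by rewrite ge_min lexx.
have [r' [xa [r'0 r'1 xa0 RE]]] := regvar_equicontinuous Rf_cont Rf_gt0 Rf_rv e20.
have [C [xb [C0 xb0 PC]]] := phi_compare Rf_cont Rf_gt0 gam0 th1 Rf_rv.
(* Chosen so that the Levy time M h, at most 2 R(x) 4 rho C x/(gam R(x)), stays below [s1]. *)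
pose rho := Num.min (1 / 2) (r' * gam / (64 * C * (gam + 1))).
have g1 : 0 < gam + 1 by rewrite addr_gt0.
have rho0 : 0 < rho.
  by rewrite lt_min; apply/andP; split; [lra|rewrite divr_gt0// ?mulr_gt0].
have rho1 : rho <= 1 / 2 by rewrite ge_min lexx.
have rho2 : rho * (64 * C * (gam + 1)) <= r' * gam.
  by rewrite -ler_pdivlMr ?mulr_gt0// ge_min lexx orbT.
pose e1 := Num.min (r' / 8) (e' * rho / (8 * C)).
have e10 : 0 < e1 by rewrite lt_min !divr_gt0 ?mulr_gt0.
have e1r : e1 <= r' / 8 by rewrite ge_min lexx.
have e1C : e1 * (8 * C) <= e' * rho by rewrite -ler_pdivlMr ?mulr_gt0// ge_min lexx orbT.
clearbody e1 rho e2.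
exists rho, e1, (Num.max xa xb); split => //; first by rewrite lt_max xa0.
move=> x h l; rewrite ge_max => /andP[xxa xxb] h0 hrho ml good.
have xp := lt_le_trans xa0 xxa; have Rx := Rf_gt0 xp.
set p := phi gam Rf x in hrho *.
have p0 : 0 < p by exact: (phi_gt0 Rf_cont Rf_gt0 gam0 th1 Rf_rv).
have [PC1 PC2] := PC x xxb; rewrite -/p in PC1 PC2.
set G := x / (gam * Rf x) in PC1 PC2.
have G0 : 0 < G by rewrite divr_gt0 ?mulr_gt0.
pose s1 := r' * x / (4 * (gam + 1)).
have s10 : 0 < s1 by rewrite divr_gt0 ?mulr_gt0.
have s1E : s1 * (4 * (gam + 1)) = r' * x by rewrite /s1 divfK// gt_eqF// mulr_gt0.
have gs0 : 0 < gam * s1 by rewrite mulr_gt0.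
have r'x : r' * x <= 1 / 2 * x by rewrite ler_pM2r.
have close u : 0 <= u -> u < s1 -> `|l u| <= r' * x /\ `|l u + gam * u| <= 2 * e1 * x.
  move=> u0 us; have := good u u0.
  have gu : gam * u <= gam * s1 by rewrite ler_pM2l// ltW.
  have gu0 : 0 <= gam * u by rewrite mulr_ge0// ltW.
  have ux : e1 * u <= e1 * x.
    by rewrite ler_pM2l//; move: us s1E gs0 s10 r'x xp; hide_comparisons; lra.
  have ex : e1 * x <= r' / 8 * x by rewrite ler_pM2r.
  rewrite !ler_norml => /andP[a1 a2].
  by split; apply/andP; split; move: a1 a2 gu gu0 ux ex s1E s10 gs0; hide_comparisons; lra.
pose m := Rf x / (1 + e2); pose M := (1 + e2) * Rf x.
have e2p : 0 < 1 + e2 by lra.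
have m0 : 0 < m by rewrite divr_gt0.
have M0 : 0 < M by rewrite mulr_gt0.
have RB y : `|y - x| <= r' * x -> m <= Rf y <= M.
  by move=> /(RE _ _ xxa)[h1 h2]; rewrite /m /M h1 ler_pdivrMr// mulrC h2.
have gRx : 0 < gam * Rf x by rewrite mulr_gt0.
have mE : m * (1 + e2) = Rf x by rewrite /m divfK// gt_eqF.
have ME : M = (1 + e2) * Rf x by [].
clearbody m M.
have GE : G * (gam * Rf x) = x by rewrite /G divfK// gt_eqF.
have Mh : M * h < s1.
  have b1 : M * h <= 2 * Rf x * h by rewrite ler_wpM2r// ME ler_pM2r//; move: e21; hide_comparisons; lra.
  have b2 : 2 * Rf x * h <= 2 * Rf x * (4 * rho * p) by rewrite ler_pM2l ?mulr_gt0.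
  have b3 : 2 * Rf x * (4 * rho * p) <= 2 * Rf x * (4 * rho * (C * G)).
    by rewrite ler_pM2l ?mulr_gt0// ler_pM2l ?mulr_gt0.
  apply: (le_lt_trans b1); apply: (le_lt_trans b2); apply: (le_lt_trans b3).
  rewrite -(@ltr_pM2r _ (4 * (gam + 1) * gam)) ?mulr_gt0// (mulrA s1) s1E.
  have -> : 2 * Rf x * (4 * rho * (C * G)) * (4 * (gam + 1) * gam) =
    rho * (64 * C * (gam + 1)) * (G * (gam * Rf x)) / 2 by field.
  rewrite GE; have : rho * (64 * C * (gam + 1)) * x <= r' * gam * x by rewrite ler_pM2r.
  have : 0 < r' * gam * x by rewrite !mulr_gt0.
  hide_comparisons; lra.
have [u [u1 u2 ->]] : exists u, [/\ m * h <= u, u <= M * h & Xpath Rf x l h = x + l u].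
  apply: (@Xpath_local x (x / 2) s1) => //; first by rewrite divr_gt0.
  move=> r r0 rs; have [c1 _] := close r r0 rs; split; last first.
    by apply: RB; rewrite addrAC subrr add0r.
  by move: c1; rewrite ler_norml => /andP[c1 _]; move: c1 r'x; hide_comparisons; lra.
have u0 : 0 <= u by apply: le_trans u1; rewrite mulr_ge0// ltW.
have [c1 c2] := close u u0 (le_lt_trans u2 Mh).
have Xx : x / 2 <= x + l u.
  by move: c1; rewrite ler_norml => /andP[c1 _]; move: c1 r'x; hide_comparisons; lra.
have X0 : 0 < x + l u by apply: lt_le_trans Xx; rewrite divr_gt0.
split => //; set D := phi gam Rf (x + l u) - p.
have diff (y z : R) : y <= z -> `|y - x| <= r' * x -> `|z - x| <= r' * x -> 0 < y ->
  (z - y) / (gam * M) <= phi gam Rf y - phi gam Rf z <= (z - y) / (gam * m).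
  move=> yz; rewrite !ler_norml => /andP[y1 y2] /andP[z1 z2] y0.
  apply: (phi_diff_bounds Rf_cont Rf_gt0 gam0 th1 Rf_rv) => // w yw wz.
  by apply: RB; rewrite ler_norml; apply/andP; split; move: y1 z2 yw wz; hide_comparisons; lra.
have cx : `|x - x| <= r' * x by rewrite subrr normr0 mulr_ge0// ltW.
have cX : `|x + l u - x| <= r' * x by rewrite addrAC subrr add0r.
have key : `|D - h| <= 3 * e2 * h + 2 * (2 * e1 * G).
  apply: (@ratio_error _ e2 h (u / Rf x) (- l u / (gam * Rf x)) (2 * e1 * G) D) => //; try exact: ltW.
  - rewrite mulrA ler_pdivlMr// -mE; have := ler_wpM2r (ltW e2p) u1.
    by rewrite (_ : m * h * (1 + e2) = h * (m * (1 + e2))) 1?(mulrC u)//; ring.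
  - by rewrite ler_pdivrMr// mulrAC -ME.
  - have -> : - l u / (gam * Rf x) - u / Rf x = - ((l u + gam * u) / (gam * Rf x)).
      by field; rewrite !gt_eqF.
    rewrite normrN normrM normfV (gtr0_norm gRx) ler_pdivrMr//.
    by rewrite -(mulrA (2 * e1) G) GE.
  - move=> d0; have lu : l u <= 0.
      by move: d0; rewrite pmulr_lge0 ?invr_gt0// oppr_ge0.
    have /andP[] := diff (x + l u) x ltac:(move: lu; hide_comparisons; lra) cX cx X0.
    rewrite -/p -/D; have -> : x - (x + l u) = - l u by ring.
    rewrite ler_pdivrMr ?mulr_gt0// ler_pdivlMr ?mulr_gt0// => d1 d2; split.
      rewrite ler_pdivrMr//; move: d1; rewrite ME; hide_comparisons; lra.
    rewrite mulrA ler_pdivlMr//.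
    have E : gam * m * (1 + e2) = gam * Rf x by rewrite -mulrA mE.
    by have := ler_wpM2r (ltW e2p) d2; rewrite -(mulrA D) E; hide_comparisons; lra.
  - move=> d0; have lu : 0 < l u.
      by move: d0; rewrite pmulr_llt0 ?invr_gt0// oppr_lt0.
    have /andP[] := diff x (x + l u) ltac:(move: lu; hide_comparisons; lra) cx cX xp.
    have pD : p - phi gam Rf (x + l u) = - D by rewrite /D opprB.
    rewrite -/p pD; have -> : x + l u - x = l u by ring.
    rewrite ler_pdivrMr ?mulr_gt0// ler_pdivlMr ?mulr_gt0// => d1 d2; split.
      rewrite mulrA ler_pdivrMr//.
      have E : gam * m * (1 + e2) = gam * Rf x by rewrite -mulrA mE.
      by have := ler_wpM2r (ltW e2p) d2; rewrite -(mulrA (- D)) E; hide_comparisons; lra.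
    rewrite ler_pdivlMr//; move: d1; rewrite ME; hide_comparisons; lra.
apply: (le_trans key).
(* The constants 24 and 8 make 3 e2 h and 4 e1 G each at most half of e' rho p. *)
have k1 : e2 * h <= e' / 24 * (4 * rho * p) by apply: ler_pM => //; exact: ltW.
have k2 : e1 * G <= e1 * (C * p) by rewrite ler_pM2l.
have k3 : e1 * (8 * C) * p <= e' * rho * p by rewrite ler_pM2r.
move: k1 k2 k3; hide_comparisons; lra.
Qed.

End Pathwise.

(** * Right continuity and rational points *)

Section RightContinuous.
Variable R : realType.

Lemma right_cont_near (f : R -> R) (t : R) (U : set R) :
  f x @[x --> t^'+] --> f t -> nbhs (f t) U ->
  exists d : R, 0 < d /\ forall s, t <= s -> s < t + d -> U (f s).
Proof.
move=> cf nU; have : \forall x \near t^'+, U (f x) by apply: cf.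
rewrite near_withinE => /nbhs_ballP[d /= d0 dP]; exists d; split => // s ts sd.
move: ts; rewrite le_eqVlt => /predU1P[<-|ts]; first exact: nbhs_singleton.
by apply: dP => //; rewrite /ball/= distrC gtr0_norm ?subr_gt0// ltrBlDl.
Qed.

Lemma rat_between (a b : R) : a < b -> exists q : rat, a < ratr q < b.
Proof. by move=> /rat_in_itvoo[q]; rewrite in_itv/=; exists q. Qed.

End RightContinuous.

(** * Measurability of the time-changed process *)

Section JointMeasurability.
Variables (R : realType) (d : measure_display) (Om : measurableType d) (L : R -> Om -> R).
Hypothesis mL : forall t, 0 <= t -> measurable_fun setT (L t).
Hypothesis rcL : forall w t, 0 <= t -> L x w @[x --> t^'+] --> L t w.

(** Sampling at the next grid point to the right, (floor(n t) + 1)/n, gives functions that are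
    measurable piece by piece and converge by right continuity. Negative times are sent to 0 to
    obtain a map on the whole product. *)
Lemma measurable_joint :
  measurable_fun setT (fun p : R * Om => L (Num.max p.1 0) p.2).
Proof.
pose g (n : nat) (p : R * Om) : R := n.+1%:R * Num.max p.1 0.
have g0 n p : 0 <= g n p by rewrite mulr_ge0// le_max lexx orbT.
have mg n : measurable_fun setT (g n).
  apply: measurable_funM => //; apply: measurable_maxr => //; exact: measurable_fst.
pose t (n : nat) (p : R * Om) : R := (Num.truncn (g n p)).+1%:R / n.+1%:R.
pose h n (p : R * Om) := L (t n p) p.2.
apply: (@measurable_fun_cvg _ _ _ _ h).
  move=> n; pose E k := [set p : R * Om | k%:R <= g n p < k.+1%:R].
  have mE k : measurable (E k).
    have := mg n measurableT _ (measurable_itv `[k%:R, k.+1%:R[); rewrite setTI.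
    by congr (measurable _); apply/seteqP; split => p; rewrite /E /= in_itv.
  have -> : setT = \bigcup_k E k.
    apply/seteqP; split => // p _; exists (Num.truncn (g n p)) => //.
    by rewrite /E /= truncn_itv.
  apply/measurable_fun_bigcup => // k.
  apply: (@eq_measurable_fun _ _ _ _ _ (fun p => L (k.+1%:R / n.+1%:R) p.2)).
    by move=> p; rewrite inE /E /= => /truncn_def pk; rewrite /h /t pk.
  apply: measurable_funTS; apply: (@measurableT_comp _ _ _ _ _ _ (L _) _ snd) => //.
  by apply: mL; rewrite divr_ge0.
move=> [r w] _; rewrite /h /t /g /=; set r' := Num.max r 0.
have r'0 : 0 <= r' by rewrite le_max lexx orbT.
apply/cvgrPdist_lt => e e0.
have [d' [d'0 d'P]] := right_cont_near (@rcL w _ r'0) (nbhsx_ballx (L r' w) e e0).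
have : n.+1%:R^-1 @[n --> \oo] --> (0 : R) by exact: cvg_harmonic.
move=> /cvgrPdist_lt /(_ _ d'0); apply: filterS => n /=; rewrite sub0r normrN gtr0_norm// => nd.
have n0 : 0 < n.+1%:R :> R by [].
have /truncn_itv/andP[k1 k2] : 0 <= n.+1%:R * r' by rewrite mulr_ge0.
apply: d'P; first by rewrite ler_pdivlMr// mulrC ltW.
rewrite ltr_pdivrMr// mulrDl (mulrC r') -addn1 natrD.
have : 1 < d' * n.+1%:R by rewrite -ltr_pdivrMr// div1r.
lra.
Qed.

(** The second hypothesis moves any witness before c to a rational one, so the event that the
    infimum is below c is a countable union. *)
Lemma measurable_ereal_inf_times (S : R -> set Om) :
  (forall s, 0 <= s -> measurable (S s)) ->
  (forall w (s c : R), 0 <= s -> s < c -> S s w -> exists q : rat, [/\ 0 <= (ratr q : R), (ratr q : R) < c & S (ratr q) w]) ->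
  measurable_fun setT (fun w => ereal_inf [set s%:E | s in [set s | 0 <= s /\ S s w]]).
Proof.
move=> mS HS; apply: (measurability _ (ErealGenInftyO.measurableE R)) => _ /= -[_ [c ->] <-].
rewrite setTI; have -> : (fun w => ereal_inf [set s%:E | s in [set s | 0 <= s /\ S s w]]) @^-1` `]-oo, c%:E[ =
    \bigcup_(q : rat) (if (0 <= (ratr q : R)) && ((ratr q : R) < c) then S (ratr q) else set0).
  apply/seteqP; split => w /=.
    rewrite in_itv/= => /ereal_inf_lt[_ [s [s0 Ss] <-]]; rewrite lte_fin => sc.
    have [q [q0 qc Sq]] := HS w s c s0 sc Ss.
    by exists q => //; rewrite q0 qc.
  move=> [q _]; case: ifP => // /andP[q0 qc] Sq; rewrite in_itv/=.
  apply: (@le_lt_trans _ _ (ratr q)%:E); last by rewrite lte_fin.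
  by apply: ereal_inf_lbound; exists (ratr q).
apply: bigcupT_measurable_rat => q; case: ifP => [/andP[q0 _]|_]; last exact: measurable0.
exact: mS.
Qed.

Variables (Rf : R -> R) (x : R).
Hypothesis Rf_cont : {within `[0%R, +oo[%classic, continuous Rf}.

(** Extends R to the left of 0 by the constant R(0), giving a function measurable on the whole
    line. *)
Let Rp (y : R) := Rf (Num.max y 0).

Let mRp : measurable_fun setT Rp.
Proof.
apply: (@measurable_comp _ _ _ _ _ _ (`[0, +oo[%classic : set R) Rf _ (fun y : R => Num.max y 0)) => //.
- by move=> _ [y _ <-] /=; rewrite in_itv/= andbT le_max lexx orbT.
- by apply: subspace_continuous_measurable_fun => //; exact: measurable_itv.
- exact: measurable_maxr.
Qed.

Lemma measurable_tau0 : measurable_fun setT (fun w => tau0 x (L ^~ w)).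
Proof.
apply: (@measurable_ereal_inf_times (fun s => [set w | x + L s w < 0])).
  move=> s s0; have m : measurable_fun setT (fun w => x + L s w).
    by apply: measurable_funD => //; exact: mL.
  have := m measurableT _ (measurable_itv `]-oo, 0[); rewrite setTI.
  by congr (measurable _); apply/seteqP; split => w; rewrite /= in_itv.
move=> w s c s0 sc /= n0.
have nU : nbhs (L s w) [set y | x + y < 0].
  apply: open_nbhs_nbhs; split => //.
  have -> : [set y | x + y < 0] = [set y | y < - x].
    by apply/seteqP; split=> y /=; rewrite -ltrBrDl sub0r.
  exact: open_lt.
have [d' [d'0 d'P]] := right_cont_near (@rcL w _ s0) nU.
have : s < Num.min c (s + d') by rewrite lt_min sc ltrDl.
move=> /rat_between[q /andP[sq]]; rewrite lt_min => /andP[qc qd].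
by exists q; split => //; [exact: le_trans s0 (ltW sq)|apply: d'P => //; exact: ltW].
Qed.

(** The integrand of [eta], with its domain as an indicator, as a function of time and sample point
    together, ready for Tonelli. The power -1 is the inverse on positive values. *)
Let G (s : R) (p : R * Om) : \bar R :=
  if [&& 0 <= p.1, p.1 < s & (p.1%:E < tau0 x (L ^~ p.2))%E] then
    (if 0 < Rp (x + L (Num.max p.1 0) p.2) then ((Rp (x + L (Num.max p.1 0) p.2)) `^ (-1))%:E else +oo%E)
  else 0%E.

Let mRpL : measurable_fun setT (fun p : R * Om => Rp (x + L (Num.max p.1 0) p.2)).
Proof.
apply: (@measurableT_comp _ _ _ _ _ _ Rp) => //.
by apply: measurable_funD => //; exact: measurable_joint.
Qed.

Let mG s : measurable_fun setT (G s).
Proof.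
apply: measurable_fun_ifT => //.
  apply: measurable_and; first by apply: measurable_fun_ler => //; exact: measurable_fst.
  apply: measurable_and; first by apply: measurable_fun_ltr => //; exact: measurable_fst.
  apply: measurable_fun_lte.
    by apply/measurable_EFinP; exact: measurable_fst.
  by apply: (@measurableT_comp _ _ _ _ _ _ (fun w => tau0 x (L ^~ w)) _ snd) => //; exact: measurable_tau0.
apply: measurable_fun_ifT => //; first exact: measurable_fun_ltr.
apply/measurable_EFinP; apply: (@measurableT_comp _ _ _ _ _ _ (fun y : R => y `^ (-1))) => //.
Qed.

Let G0 s p : (0 <= G s p)%E.
Proof.
rewrite /G; case: ifP => // _; case: ifPn => [r0|_]; last by rewrite leey.
by rewrite lee_fin powR_ge0.
Qed.

Let etaE s w : Defs.eta Rf x (L ^~ w) s = (\int[@lebesgue_measure R]_r G s (r, w))%E.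
Proof.
rewrite /Defs.eta integral_mkcond; apply: eq_integral => r _.
rewrite patchE /G /=; case: ifPn; rewrite ?inE/= ?notin_setE/=.
  move=> [r0 [rs rt]]; rewrite r0 rs rt /= /eta_int /Rp.
  have -> : Num.max r 0 = r by apply/max_idPl.
  have -> : Num.max (x + L r w) 0 = x + L r w.
    apply/max_idPl; rewrite leNgt; apply/negP => xn; move: rt; rewrite ltNge => /negP; apply.
    by apply: ereal_inf_lbound; exists r.
  by case: ifPn => // p0; rewrite powR_inv1// ltW.
by move=> H; case: ifP => // /and3P[? ? ?]; exfalso; apply: H.
Qed.

Lemma measurable_eta s : measurable_fun setT (fun w => Defs.eta Rf x (L ^~ w) s).
Proof.
under eq_fun do rewrite etaE.
by apply: (measurable_fun_fubini_tonelli_G (m1 := @lebesgue_measure R) (G s)); [exact: mG|exact: G0].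
Qed.

Lemma eta_homo w s s' : s <= s' -> (Defs.eta Rf x (L ^~ w) s <= Defs.eta Rf x (L ^~ w) s')%E.
Proof.
move=> ss; rewrite !etaE; apply: ge0_le_integral => //.
- by apply: (measurable_fun_pair1 w); exact: mG.
- by apply: (measurable_fun_pair1 w); exact: mG.
- move=> r _; rewrite {1}/G /=; case: ifP => // /and3P[r0 rs rt].
  by rewrite /G /= r0 rt (lt_le_trans rs).
Qed.

Lemma measurable_eta_inv h : measurable_fun setT (fun w => eta_inv Rf x (L ^~ w) h).
Proof.
apply: (@measurable_ereal_inf_times (fun s => [set w | (h%:E < Defs.eta Rf x (L ^~ w) s)%E])).
  move=> s s0; have := measurable_eta s measurableT (emeasurable_itv `]h%:E, +oo[); rewrite setTI.
  by congr (measurable _); apply/seteqP; split => w; rewrite /= in_itv/= andbT.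
move=> w s c s0 sc /= hs; have [q /andP[sq qc]] := rat_between sc.
exists q; split => //; first exact: le_trans s0 (ltW sq).
by apply: lt_le_trans hs _; apply: eta_homo; exact: ltW.
Qed.

Lemma measurable_Xpath h : measurable_fun setT (fun w => Xpath Rf x (L ^~ w) h).
Proof.
pose u w := Order.min (eta_inv Rf x (L ^~ w) h) (tau0 x (L ^~ w)).
have mu : measurable_fun setT u.
  by apply: measurable_mine; [exact: measurable_eta_inv|exact: measurable_tau0].
have u0 w : (0 <= u w)%E by rewrite /u le_min eta_inv_ge0 tau0_ge0.
rewrite (_ : (fun w => _) = fun w => if (u w < +oo)%E then x + L (Num.max (fine (u w)) 0) w else 0).
  apply: measurable_fun_ifT => //; first exact: measurable_fun_lte.
  apply: measurable_funD => //.
  apply: (@measurableT_comp _ _ _ _ _ _ (fun p : R * Om => L (Num.max p.1 0) p.2) _ (fun w => (fine (u w), w))).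
    exact: measurable_joint.
  apply: measurable_fun_pair => //.
  by apply: (@measurableT_comp _ _ _ _ _ _ (@fine R)) => //; exact: measurable_fine.
apply/funext => w; rewrite /Xpath -/(u w); have := u0 w.
case: (u w) => [v||] //=; rewrite ?ltxx// ltry lee_fin => v0.
by congr (_ + L _ w); apply/esym/max_idPl.
Qed.

End JointMeasurability.

(** * First-passage decompositions and Ottaviani's inequality *)

Section FirstPassage.
Variables (R : realType) (d : measure_display) (Om : measurableType d) (P : probability Om R).

Lemma measurable_seqDU (A : nat -> set Om) k : (forall k, measurable (A k)) -> measurable (seqDU A k).
Proof.
by move=> mA; apply: measurableD => //; apply: bigsetU_measurable.
Qed.

Lemma seqDU_first (A : nat -> set Om) k :
  seqDU A k = A k `&` \bigcap_(i in [set i | (i < k)%N]) (~` A i).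
Proof.
by rewrite /seqDU -bigcup_mkord setDE setC_bigcup.
Qed.

(** [seqDU A k] is the event that k is the first index at which [A k] occurs, so a bound conditional
    on the first occurrence sums over k without loss. *)
Lemma first_passage (A : nat -> set Om) (G : set Om) (c : R) (N : nat) :
  (forall k, measurable (A k)) -> measurable G ->
  (forall k, (k < N)%N -> (P (seqDU A k `&` G) <= c%:E * P (seqDU A k))%E) ->
  (P ((\bigcup_(k in [set k | (k < N)%N]) A k) `&` G) <=
   c%:E * P (\bigcup_(k in [set k | (k < N)%N]) A k))%E.
Proof.
move=> mA mG H; have mD k : measurable (seqDU A k) by exact: measurable_seqDU.
rewrite bigcup_mkord bigsetU_seqDU big_distrl/=.
rewrite (@measure_semi_additive_ord_I _ _ _ P (fun i => seqDU A i `&` G)); last 3 first.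
- by move=> k _; apply: measurableI.
- by apply: trivIset_setIr; apply: sub_trivIset (trivIset_seqDU A).
- by apply: bigsetU_measurable => k _; apply: measurableI.
rewrite (@measure_semi_additive_ord_I _ _ _ P (seqDU A)); last 3 first.
- by [].
- by apply: sub_trivIset (trivIset_seqDU A).
- by apply: bigsetU_measurable.
rewrite ge0_sume_distrr//; apply: lee_sum => i _; exact: H.
Qed.

(** If |S| first exceeds 2u at k and |S_N| <= u, then the remaining increment exceeds u, which has
    conditional probability at most 1/2. Hence |S_N| > u on at least half of the exceedance
    event. *)
Lemma ottaviani (S : nat -> Om -> R) (u : R) (N : nat) :
  (forall k, measurable_fun setT (S k)) ->
  (forall k, (k <= N)%N ->
     (P (seqDU (fun k => [set w | (2 * u < `|S k w|)%R]) k `&`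
         [set w | (u < `|S N w - S k w|)%R]) <=
      2^-1%:E * P (seqDU (fun k => [set w | (2 * u < `|S k w|)%R]) k))%E) ->
  (P (\bigcup_(k in [set k | (k < N.+1)%N]) [set w | (2 * u < `|S k w|)%R]) <=
   2%:E * P [set w | (u < `|S N w|)%R])%E.
Proof.
move=> mS H; set A := fun k => [set w | (2 * u < `|S k w|)%R].
have mgt (f : Om -> R) (c : R) : measurable_fun setT f -> measurable [set w | (c < `|f w|)%R].
  move=> mf; have mn : measurable_fun setT (fun w => `|f w|) by exact: measurableT_comp.
  have := mn measurableT _ (measurable_itv `]c, +oo[); rewrite setTI.
  by congr measurable; apply/seteqP; split => w; rewrite /= in_itv/= andbT.
have mA k : measurable (A k) by exact: mgt.
have mD k : measurable (seqDU A k) by exact: measurable_seqDU.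
set U := \bigcup_(k in _) _.
have mU : measurable U by apply: bigcup_measurable => k _; exact: mA.
pose F := [set w | u < `|S N w|]; have mF : measurable F by exact: mgt.
have G1 : (P (U `&` ~` F) <= 2^-1%:E * P U)%E.
  apply: first_passage => //; first exact: measurableC.
  move=> k kN; apply: le_trans (H k kN); apply: le_measure; rewrite ?inE.
  - by apply: measurableI => //; exact: measurableC.
  - by apply: measurableI => //; apply: (mgt (fun w => S N w - S k w)); exact: measurable_funB.
  - move=> w [Ek /negP]; rewrite -leNgt => SN; split => //=.
    have Ak : 2 * u < `|S k w| by case: Ek.
    rewrite ltNge; apply/negP => le1.
    have := ler_normB (S N w) (S N w - S k w); rewrite subKr; lra.
have G2 : (P U <= P (U `&` ~` F) + P F)%E.
  rewrite -[X in (P X <= _)%E](setUIDK U F) addeC.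
  rewrite -setDE; apply: (le_trans (measureU2 _ _ _)).
  - by apply: measurableI.
  - by apply: measurableD.
  - by rewrite leeD2r// measureIr.
have [fU fF] : P U \is a fin_num /\ P F \is a fin_num by split; apply: fin_num_measure.
have fUF : P (U `&` ~` F) \is a fin_num by apply: fin_num_measure; apply: measurableI => //; exact: measurableC.
move: G1 G2; rewrite -(fineK fU) -(fineK fF) -(fineK fUF) -!EFinM -EFinD !lee_fin; lra.
Qed.

End FirstPassage.

(** * Independence: from rectangles to sigma-algebras and integrals *)

Section Independence.
Variables (R : realType) (d : measure_display) (Om : measurableType d) (P : probability Om R).

(** The rectangles form a pi-system, on which the finite measures P(. and F) and P(F) P(.) agree, so
    they agree on the generated sigma-algebra. *)
Lemma indep_generated (X : nat -> Om -> R) (k : nat) (F : set Om) :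
  (forall i, measurable_fun setT (X i)) -> measurable F ->
  (forall A : nat -> set R, (forall i, measurable (A i)) ->
    let E := \bigcap_(i in [set i | (i < k)%N]) [set w | A i (X i w)] in
    P (E `&` F) = (P E * P F)%E) ->
  forall E, <<s [set E | exists A : nat -> set R, (forall i, measurable (A i)) /\
      E = \bigcap_(i in [set i | (i < k)%N]) [set w | A i (X i w)] ] >> E ->
  P (E `&` F) = (P E * P F)%E.
Proof.
move=> mX mF H E; set G := [set _ | _] => sE.
have mXA i (A : set R) : measurable A -> measurable [set w | A (X i w)].
  by move=> mA; rewrite -[X in measurable X]setTI; exact: mX.
have Gm : G `<=` measurable.
  move=> _ [A [mA ->]]; rewrite bigcap_mkord; apply: bigsetI_measurable => i _; exact: mXA.
have pF0 : (0 <= fine (P F)) by rewrite fine_ge0.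
pose r : {nonneg R} := NngNum pF0.
have GT : G setT.
  by exists (fun _ => setT); split => //; apply/seteqP; split.
have rE (A : set Om) : mscale r P A = (P A * P F)%E.
  rewrite (_ : mscale r P A = ((fine (P F))%:E * P A)%E)// muleC; congr (_ * _)%E.
  by apply: fineK; apply: fin_num_measure.
suff : mrestr P mF E = mscale r P E by rewrite rE.
apply: (@g_sigma_algebra_measure_unique _ _ _ G Gm (fun _ => setT) (fun _ => GT)
  _ (mrestr P mF) (mscale r P) _ _ _ E sE).
- by apply/seteqP; split => // w _; exists 0%N.
- move=> _ _ [A [mA ->]] [B [mB ->]]; exists (fun i => A i `&` B i).
  split; first by move=> i; exact: measurableI.
  apply/seteqP; split => w /=.
    by move=> [h1 h2] i ik; split; [exact: h1|exact: h2].
  by move=> h; split => i ik; have [] := h i ik.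
- by move=> _ [A [mA ->]]; rewrite /= rE; exact: H.
- by move=> _; rewrite /= /mrestr setTI -ge0_fin_numE// fin_num_measure.
Qed.

(** The copy [Y'] encodes stationarity: the increment of L over a length h enters the product
    formula through the law of [L h]. *)
Lemma indep_integral (X Y Y' : Om -> R) (f g : R -> R) :
  measurable_fun setT X -> measurable_fun setT Y -> measurable_fun setT Y' ->
  (forall A B : set R, measurable A -> measurable B ->
    P ([set w | A (X w)] `&` [set w | B (Y w)]) = (P [set w | A (X w)] * P [set w | B (Y' w)])%E) ->
  measurable_fun setT f -> measurable_fun setT g ->
  (forall x, 0 <= f x) -> (forall x, 0 <= g x) ->
  (\int[P]_w (f (X w) * g (Y w))%:E = (\int[P]_w (f (X w))%:E) * (\int[P]_w (g (Y' w))%:E))%E.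
Proof.
move=> mX mY mY' H mf mg f0 g0.
pose X1 : {mfun Om >-> R} := HB.pack X (isMeasurableFun.Build _ _ _ _ X mX).
pose Y1 : {mfun Om >-> R} := HB.pack Y' (isMeasurableFun.Build _ _ _ _ Y' mY').
have mXY : measurable_fun setT (fun w => (X w, Y w)) by exact: measurable_fun_pair.
pose XY : {mfun Om >-> (R * R)%type} := HB.pack (fun w => (X w, Y w)) (isMeasurableFun.Build _ _ _ _ _ mXY).
pose h (p : R * R) : \bar R := (f p.1 * g p.2)%:E.
have mh : measurable_fun setT h.
  apply/measurable_EFinP; apply: measurable_funM.
    by apply: measurableT_comp => //; exact: measurable_fst.
  by apply: measurableT_comp => //; exact: measurable_snd.
have h0 p : (0 <= h p)%E by rewrite lee_fin mulr_ge0.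
have -> : (\int[P]_w (f (X w) * g (Y w))%:E = \int[distribution P XY]_p h p)%E.
  by rewrite ge0_integral_distribution.
have -> : (\int[distribution P XY]_p h p = \int[distribution P X1 \x distribution P Y1]_p h p)%E.
  apply: eq_measure_integral => A mA _; apply/esym; apply: product_measure_unique.
  - by move=> B C mB mC; exact: H.
  - exact: mA.
rewrite fubini_tonelli1//.
have gE : (\int[P]_w (g (Y' w))%:E = \int[distribution P Y1]_y (g y)%:E)%E.
  by rewrite ge0_integral_distribution//; apply/measurable_EFinP.
have fE : (\int[P]_w (f (X w))%:E = \int[distribution P X1]_y (f y)%:E)%E.
  by rewrite ge0_integral_distribution//; apply/measurable_EFinP.
rewrite gE fE -ge0_integralZr//; last 3 first.
- by apply/measurable_EFinP.
- by move=> x _; rewrite lee_fin.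
- by apply: integral_ge0 => y _; rewrite lee_fin.
apply: eq_integral => x _; rewrite /fubini_F /h /=.
under eq_integral do rewrite EFinM.
by rewrite ge0_integralZl//; [apply/measurable_EFinP|move=> y _; rewrite lee_fin|rewrite lee_fin].
Qed.

End Independence.

(** * Laplace transforms, tails and maxima of the Levy process at dyadic times *)

Section Levy.
Variables (R : realType) (d : measure_display) (Om : measurableType d) (P : probability Om R).
Variables (L : R -> Om -> R) (gam sig : R) (pi : {measure set R -> \bar R}).
Hypothesis HL : levy_process P L gam sig pi.

Lemma levy_measurable t : 0 <= t -> measurable_fun setT (L t).
Proof. by have [+ _] := HL; exact. Qed.

Lemma levy_0 w : L 0 w = 0.
Proof. by have [_ [+ _]] := HL; exact. Qed.

Lemma levy_right_cont w t : 0 <= t -> L x w @[x --> t^'+] --> L t w.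
Proof.
by move=> t0; have [_ [_ [+ _]]] := HL => /(_ w)[+ _]; apply; rewrite /= in_itv/= t0.
Qed.

(** Compares the product formula for the first k + 1 increments with the one for the first k. The
    last increment may be long, which the maximal inequality exploits. *)
Lemma levy_indep (k : nat) (t : nat -> R) (A : nat -> set R) (B : set R) :
  t 0%N = 0 -> (forall i, t i <= t i.+1) -> (forall i, measurable (A i)) -> measurable B ->
  let E := \bigcap_(i in [set i | (i < k)%N]) [set w | A i (L (t i.+1) w - L (t i) w)] in
  (P (E `&` [set w | B (L (t k.+1) w - L (t k) w)%R]) =
   P E * P [set w | B (L (t k.+1 - t k)%R w)])%E.
Proof.
move=> t0 tm mA mB E; have [_ [_ [_ [H _]]]] := HL.
pose A' i := if (i < k)%N then A i else B.
have mA' i : measurable (A' i) by rewrite /A'; case: ifP.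
have := H k.+1 t A' t0 tm mA'; rewrite big_ord_recr/=.
have := H k t A' t0 tm mA'.
have EE : E = \bigcap_(i in [set i | (i < k)%N]) [set w | A' i (L (t i.+1) w - L (t i) w)].
  by apply: eq_bigcapr => i /= ik; rewrite /A' ik.
rewrite -EE => <-; rewrite {2}/A' ltnn => <-; congr (P _).
apply/seteqP; split => w /=.
  move=> [Ew Bw] i /=; rewrite ltnS leq_eqVlt => /predU1P[->|ik]; first by rewrite /A' ltnn.
  by rewrite /A' ik; apply: Ew.
move=> h; split; last by have := h k (ltnSn k); rewrite /= /A' ltnn.
by rewrite EE => i ik; apply: h; rewrite /= ltnS ltnW.
Qed.

Lemma levy_indep2 (s h : R) (A B : set R) : 0 <= s -> 0 <= h -> measurable A -> measurable B ->
  (P ([set w | A (L s w)] `&` [set w | B (L (s + h)%R w - L s w)%R]) =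
   P [set w | A (L s w)] * P [set w | B (L h w)])%E.
Proof.
move=> s0 h0 mA mB.
pose t (i : nat) : R := match i with 0%N => 0 | 1%N => s | _ => s + h end.
have tm i : t i <= t i.+1 by case: i => [//|[|i]] //=; rewrite lerDl.
have := @levy_indep 1 t (fun _ => A) B erefl tm (fun _ => mA) mB.
rewrite /= (_ : s + h - s = h); last by ring.
have -> : \bigcap_(i in [set i | (i < 1)%N]) [set w | A (L (t i.+1) w - L (t i) w)] = [set w | A (L s w)].
  apply/seteqP; split => w /=.
    by move=> /(_ 0%N isT) /=; rewrite levy_0 subr0.
  by move=> Aw [|//] _ /=; rewrite levy_0 subr0.
by [].
Qed.

Let M (lam t : R) : \bar R := (\int[P]_w (expR (- (lam * L t w)))%:E)%E.

Let mexp (lam : R) : measurable_fun setT (fun y : R => expR (- (lam * y))).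
Proof.
by apply: measurableT_comp => //; apply: measurableT_comp => //.
Qed.

Let M_ge0 lam t : (0 <= M lam t)%E.
Proof. by apply: integral_ge0 => w _; rewrite lee_fin expR_ge0. Qed.

Lemma levy_laplace_add (lam s h : R) : 0 <= s -> 0 <= h -> M lam (s + h) = (M lam s * M lam h)%E.
Proof.
move=> s0 h0; have sh0 : 0 <= s + h by rewrite addr_ge0.
rewrite /M -(@indep_integral _ _ _ P (L s) (fun w => L (s + h) w - L s w) (L h)
  (fun y => expR (- (lam * y))) (fun y => expR (- (lam * y)))).
- apply: eq_integral => w _; rewrite -expRD; congr (expR _)%:E; ring.
- exact: levy_measurable.
- by apply: measurable_funB; exact: levy_measurable.
- exact: levy_measurable.
- by move=> A B mA mB; exact: levy_indep2.
- exact: mexp.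
- exact: mexp.
- by move=> x; exact: expR_ge0.
- by move=> x; exact: expR_ge0.
Qed.

(** Halving a time takes a square root, determined because the transform is nonnegative; multiples
    follow from additivity. *)
Lemma levy_laplace_dyadic (lam : R) (k m : nat) : 0 <= lam ->
  M lam (k%:R / 2 ^+ m) = (expR (k%:R / 2 ^+ m * Psi gam sig pi lam))%:E.
Proof.
move=> l0; set Ps := Psi _ _ _ _.
have base : M lam (2 ^+ m)^-1 = (expR ((2 ^+ m)^-1 * Ps))%:E.
  elim: m => [|m IH]; first by have [_ [_ [_ [_ H]]]] := HL; rewrite /M expr0 invr1 mul1r H.
  have e2 : (2 ^+ m)^-1 = (2 ^+ m.+1)^-1 + (2 ^+ m.+1)^-1 :> R.
    by rewrite exprS; field; rewrite expf_neq0.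
  have p0 : 0 <= (2 ^+ m.+1)^-1 :> R by rewrite invr_ge0 exprn_ge0.
  move: IH; rewrite {1}e2 levy_laplace_add// e2 mulrDl expRD.
  have := M_ge0 lam (2 ^+ m.+1)^-1; case: (M _ _) => [r||]//.
  rewrite lee_fin -EFinM => r0 [] rr; congr (_%:E).
  by apply/eqP; rewrite -(@eqrXn2 _ 2)// ?expR_ge0// !expr2 rr.
elim: k => [|k IH].
  rewrite !mul0r expR0 /M; under eq_integral do rewrite levy_0 mulr0 oppr0 expR0.
  by rewrite integral_cst//= probability_setT mule1.
rewrite -[k.+1]addn1 natrD !mulrDl mul1r levy_laplace_add ?IH ?base ?expRD//.
Qed.

Let kap lam := Psi gam sig pi lam - gam * lam.

Let mY t : 0 <= t -> measurable_fun setT (fun w => L t w + gam * t).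
Proof. by move=> t0; apply: measurable_funD => //; exact: levy_measurable. Qed.

(* With W = exp(-Y/u) one has E(1-W)^2 = 1 - 2 E W + E W^2 and (1-W)^2 >= 1/4
   on |Y| >= u, so two values of the Laplace exponent control both tails and no
   moment of Y has to be computed. *)
Lemma levy_tail (k m : nat) (u : R) : 0 < u -> 0 <= kap u^-1 ->
  (P [set w | (u <= `|L (k%:R / 2 ^+ m) w + gam * (k%:R / 2 ^+ m)|)%R] <=
   (4 * (expR (k%:R / 2 ^+ m * kap (2 / u)) - 1))%:E)%E.
Proof.
move=> u0 k0; set t : R := k%:R / 2 ^+ m; have t0 : 0 <= t by rewrite divr_ge0// exprn_ge0.
pose W w := expR (- (u^-1 * (L t w + gam * t))).
have W0 w : 0 <= W w by exact: expR_ge0.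
have mW : measurable_fun setT W.
  by apply: (@measurableT_comp _ _ _ _ _ _ (fun y => expR (- (u^-1 * y)))); [exact: mexp|exact: mY].
have Wint (lam : R) : 0 <= lam ->
    (\int[P]_w (expR (- (lam * (L t w + gam * t))))%:E = (expR (t * kap lam))%:E)%E.
  move=> l0; have -> : (\int[P]_w (expR (- (lam * (L t w + gam * t))))%:E =
      \int[P]_w ((expR (- (lam * (gam * t))))%:E * (expR (- (lam * L t w)))%:E))%E.
    apply: eq_integral => w _; rewrite -EFinM -expRD; congr (expR _)%:E; ring.
  rewrite ge0_integralZl; [|by []| |by move=> w _; rewrite lee_fin expR_ge0|by rewrite lee_fin expR_ge0]; last first.
    apply/measurable_EFinP; apply: (@measurableT_comp _ _ _ _ _ _ (fun y => expR (- (lam * y)))); first exact: mexp.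
    exact: levy_measurable.
  have := levy_laplace_dyadic k m l0; rewrite -/t /M => ->.
  rewrite -EFinM -expRD; congr (expR _)%:E; rewrite /kap; ring.
have W1 : (\int[P]_w (W w)%:E = (expR (t * kap u^-1))%:E)%E by apply: Wint; rewrite invr_ge0 ltW.
have W2 : (\int[P]_w (W w ^+ 2)%:E = (expR (t * kap (2 / u)))%:E)%E.
  rewrite -Wint; last by rewrite divr_ge0// ltW.
  by apply: eq_integral => w _; rewrite /W expr2 -expRD; congr (expR _)%:E; ring.
have mD : measurable_fun setT (fun w => (1 - W w) ^+ 2).
  by apply: measurable_funX; exact: measurable_funB.
have E : (\int[P]_w ((1 - W w) ^+ 2)%:E + \int[P]_w (2 * W w)%:E = \int[P]_w 1%:E + \int[P]_w (W w ^+ 2)%:E)%E.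
  rewrite -!ge0_integralD//.
  - by apply: eq_integral => w _; rewrite -!EFinD; congr (_%:E); ring.
  - by move=> w _; rewrite lee_fin sqr_ge0.
  - by apply/measurable_EFinP; exact: measurable_funX.
  - by move=> w _; rewrite lee_fin sqr_ge0.
  - by apply/measurable_EFinP.
  - by move=> w _; rewrite lee_fin mulr_ge0.
  - by apply/measurable_EFinP; exact: measurable_funM.
have I1 : (\int[P]_w 1%:E = 1%:E)%E by rewrite integral_cst//= probability_setT mule1.
have I2 : (\int[P]_w (2 * W w)%:E = (2 * expR (t * kap u^-1))%:E)%E.
  under eq_integral do rewrite EFinM.
  rewrite ge0_integralZl// ?W1 -?EFinM//; first exact/measurable_EFinP.
  by move=> w _; rewrite lee_fin.
have D0 : (0 <= \int[P]_w ((1 - W w) ^+ 2)%:E)%E by apply: integral_ge0 => w _; rewrite lee_fin sqr_ge0.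
have mA : measurable [set w | u <= `|L t w + gam * t|].
  have mn : measurable_fun setT (fun w => `|L t w + gam * t|) by apply: measurableT_comp => //; exact: mY.
  have := mn measurableT _ (measurable_itv `[u, +oo[); rewrite setTI.
  by congr measurable; apply/seteqP; split => w; rewrite /= in_itv/= andbT.
have lower : (4^-1%:E * P [set w | (u <= `|L t w + gam * t|)%R] <= \int[P]_w ((1 - W w) ^+ 2)%:E)%E.
  rewrite -integral_cst//= integral_mkcond; apply: ge0_le_integral => //.
  - by move=> w _; rewrite patchE; case: ifP => // _; rewrite lee_fin.
  - by apply/(measurable_restrictT _ mA).1 => //; exact: measurable_cst.
  - exact/measurable_EFinP.
  - move=> w _; rewrite patchE; case: ifPn; last by rewrite lee_fin sqr_ge0.
    rewrite inE/= lee_fin => Yu.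
    have e12 : 2 <= expR 1 :> R by have := expR_ge1Dx (1 : R); lra.
    move: Yu; rewrite ler_normr => /orP[Yu|Yu].
      have : W w <= expR (-1).
        by rewrite ler_expR lerN2 mulrC ler_pdivlMr// mul1r.
      have : expR (-1) <= 1/2 :> R.
        by rewrite expRN -div1r ler_pdivrMr ?expR_gt0//; lra.
      by have := W0 w; nra.
    have : expR 1 <= W w.
      by rewrite ler_expR -mulrN mulrC ler_pdivlMr// mul1r.
    by nra.
(* This says E W >= 1, which turns 1 - 2 E W + E W^2 into at most E W^2 - 1; the factor 4 inverts
   the lower bound 1/4. *)
have K0 : 1 <= expR (t * kap u^-1) by rewrite -expR0 ler_expR mulr_ge0.
move: E lower; rewrite I1 I2 W2; move: D0; case: (\int[P]_w _)%E => [r||]//.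
have fP : P [set w | u <= `|L t w + gam * t|] \is a fin_num by apply: fin_num_measure.
rewrite -(fineK fP) -!EFinD -EFinM !lee_fin => _ [] E; lra.
Qed.

(** By stationarity the increment from grid point k to N has the law of the process at index N - k,
    so the assumed bound 1/2 is the condition of Ottaviani's inequality. Independence is needed from
    the first-exceedance event, which belongs to the sigma-algebra of the first k increments. *)
Lemma levy_maximal (N m : nat) (u : R) :
  (forall j, (j <= N)%N -> (P [set w | (u < `|L (j%:R / 2 ^+ m) w + gam * (j%:R / 2 ^+ m)|)%R] <= 2^-1%:E)%E) ->
  (P (\bigcup_(j in [set j | (j < N.+1)%N]) [set w | (2 * u < `|L (j%:R / 2 ^+ m) w + gam * (j%:R / 2 ^+ m)|)%R]) <=
   2%:E * P [set w | (u < `|L (N%:R / 2 ^+ m) w + gam * (N%:R / 2 ^+ m)|)%R])%E.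
Proof.
move=> Hu; pose tau (j : nat) : R := j%:R / 2 ^+ m.
have tau0' j : 0 <= tau j by rewrite divr_ge0// exprn_ge0.
have tauS j : tau j <= tau j.+1.
  by rewrite ler_pM2r ?invr_gt0 ?exprn_gt0// ler_nat.
pose S (j : nat) w := L (tau j) w + gam * tau j.
have mS j : measurable_fun setT (S j) by exact: mY.
apply: (@ottaviani _ _ _ P S u N) => // k kN.
set E := seqDU _ k; set F := [set w | (u < _)%R].
pose X (i : nat) w := L (tau i.+1) w - L (tau i) w.
have mX i : measurable_fun setT (X i) by apply: measurable_funB; exact: levy_measurable.
pose B := [set y : R | u < `|y + gam * tau (N - k)%N|].
have mB : measurable B.
  have mn : measurable_fun setT (fun y : R => `|y + gam * tau (N - k)%N|).
    by apply: measurableT_comp => //; exact: measurable_funD.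
  have := mn measurableT _ (measurable_itv `]u, +oo[); rewrite setTI.
  by congr measurable; apply/seteqP; split => w; rewrite /= in_itv/= andbT.
have tauB : tau N - tau k = tau (N - k)%N by rewrite /tau natrB// mulrBl.
have FE : F = [set w | B (L (tau N) w - L (tau k) w)].
  apply/seteqP; split => w; rewrite /F /B /S /=; rewrite -tauB;
  by rewrite (_ : L (tau N) w - L (tau k) w + _ = L (tau N) w + gam * tau N - (L (tau k) w + gam * tau k))//; ring.
have mF : measurable F.
  rewrite FE -[X in measurable X]setTI.
  by apply: (measurable_funB (levy_measurable (tau0' N)) (levy_measurable (tau0' k))).
(* These times follow the grid up to index k and then jump to N, so that the increment of index k is
   the whole remaining one. *)
pose t i := if (i <= k)%N then tau i else tau N.
have tm i : t i <= t i.+1.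
  rewrite /t; case: (ltnP i k) => ik1; first by rewrite (ltnW ik1).
  case: leqP => ik //.
  by rewrite /tau ler_pM2r ?invr_gt0 ?exprn_gt0// ler_nat (leq_trans ik).
have t0 : t 0%N = 0 by rewrite /t /tau/= mul0r.
have tk : t k = tau k by rewrite /t leqnn.
have tk1 : t k.+1 = tau N by rewrite /t ltnn.
have XE (A : nat -> set R) : \bigcap_(i in [set i | (i < k)%N]) [set w | A i (X i w)] =
    \bigcap_(i in [set i | (i < k)%N]) [set w | A i (L (t i.+1) w - L (t i) w)].
  by apply: eq_bigcapr => i /= ik; rewrite /t ik ltnW.
have PF : P F = P [set w | B (L (tau (N - k)%N) w)].
  have := @levy_indep k t (fun _ => setT) B t0 tm (fun _ => measurableT) mB.
  rewrite /= tk tk1 tauB -FE.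
  have -> : \bigcap_(i in [set i | (i < k)%N]) [set w : Om | [set: R] (L (t i.+1) w - L (t i) w)] = setT.
    by apply/seteqP; split.
  by rewrite setTI probability_setT mul1e.
have PF2 : (P F <= 2^-1%:E)%E by rewrite PF; apply: Hu; rewrite leq_subr.
have -> : (P (E `&` F) = P E * P F)%E.
  apply: (@indep_generated _ _ _ P X k F mX mF).
    move=> A mA /=; rewrite XE FE -tk -tk1 levy_indep// tk1 tk tauB; congr (_ * _)%E.
    by rewrite -PF FE.
  set G := [set _ | _].
  have mXG i : (i < k)%N -> @measurable_fun _ _ (g_sigma_algebraType G) R setT (X i).
    move=> ik _ A mA; rewrite setTI; apply: sub_sigma_algebra.
    exists (fun j => if j == i then A else setT); split; first by move=> j; case: ifP.
    apply/seteqP; split => w /=.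
      by move=> Aw j _; case: eqP => // ->.
    by move=> /(_ i ik); rewrite eqxx.
  have mLG j : (j <= k)%N -> @measurable_fun _ _ (g_sigma_algebraType G) R setT (fun w => L (tau j) w).
    elim: j => [|j IH] jk.
      rewrite (_ : (fun w => _) = cst 0); first exact: measurable_cst.
      by apply/funext => w; rewrite /tau mul0r levy_0.
    rewrite (_ : (fun w => _) = (fun w => L (tau j) w + X j w)).
      by apply: measurable_funD; [exact: (IH (ltnW jk))|exact: mXG].
    by apply/funext => w; rewrite /X; ring.
  have mAG j : (j <= k)%N -> @measurable _ (g_sigma_algebraType G) [set w | 2 * u < `|S j w|].
    move=> jk; have mn : @measurable_fun _ _ (g_sigma_algebraType G) R setT (fun w => `|S j w|).
      apply: measurableT_comp => //; apply: measurable_funD => //; exact: mLG.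
    have := mn measurableT _ (measurable_itv `]2 * u, +oo[); rewrite setTI.
    by congr measurable; apply/seteqP; split => w; rewrite /= in_itv/= andbT.
  rewrite /E /seqDU; apply: (@measurableD _ (g_sigma_algebraType G)); first exact: mAG.
  by apply: (@bigsetU_measurable _ (g_sigma_algebraType G)) => i _; apply: mAG; exact/ltnW/ltn_ord.
by rewrite muleC; apply: lee_pmul.
Qed.

End Levy.

(** * Probabilities of countable unions *)

Section GeometricUnion.
Variables (R : realType) (d : measure_display) (Om : measurableType d) (P : probability Om R).

Lemma measure_bigcup_geometric (B : nat -> set Om) (a q : R) : 0 <= a -> 0 <= q -> q < 1 ->
  (forall k, measurable (B k)) -> (forall k, (P (B k) <= (a * q ^+ k)%:E)%E) ->
  (P (\bigcup_k B k) <= (a / (1 - q))%:E)%E.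
Proof.
move=> a0 q0 q1 mB H.
have := @measure_sigma_subadditive _ _ _ P (\bigcup_k B k) B mB
  (bigcupT_measurable B mB) (@subset_refl _ _).
move=> /le_trans; apply; apply: lime_le; first exact: is_cvg_nneseries.
apply: nearW => n; apply: (@le_trans _ _ (\sum_(0 <= k < n) (a * q ^+ k)%:E)%E).
  by apply: lee_sum => k _; exact: H.
have -> : (\sum_(0 <= k < n) (a * q ^+ k)%:E = (a / (1 - q) * (1 - q ^+ n))%:E)%E.
  elim: n => [|n IH]; first by rewrite big_nil expr0 subrr mulr0.
  rewrite big_nat_recr//= IH -EFinD; congr (_%:E); rewrite exprS; field.
  by rewrite subr_eq0 gt_eqF.
rewrite lee_fin ler_piMr//; first by rewrite divr_ge0// subr_ge0 ltW.
by rewrite lerBlDr lerDl exprn_ge0.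
Qed.

Lemma measure_bigcup_nondecreasing (A : nat -> set Om) (c : \bar R) :
  (forall m, measurable (A m)) -> (forall m, A m `<=` A m.+1) ->
  (forall m, (P (A m) <= c)%E) -> (P (\bigcup_m A m) <= c)%E.
Proof.
move=> mA AS H; have nd : nondecreasing_seq A.
  by apply/nondecreasing_seqP => m; apply/subsetPset; exact: AS.
have := @nondecreasing_cvg_mu _ _ _ P A mA (bigcupT_measurable A mA) nd.
move=> cv; rewrite -(cvg_lim _ cv)//; apply: lime_le.
  by apply/cvg_ex; eexists; exact: cv.
by apply: nearW => m; exact: H.
Qed.

End GeometricUnion.

Lemma expR_sub1_le (R : realType) (z : R) : 0 <= z -> z <= 1 / 2 -> expR z - 1 <= 2 * z.
Proof.
move=> z0 z1; have h := expR_ge1Dx (- z); have e0 := expR_gt0 z.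
have : expR z * (1 - z) <= 1.
  apply: (@le_trans _ _ (expR z * expR (- z))); first by rewrite ler_pM2l.
  by rewrite expRxMexpNx_1.
have : 0 <= (1 - z) by lra.
nra.
Qed.

(** * A linear envelope for the Levy process at all times *)

Section LevyAllTime.
Variables (R : realType) (d : measure_display) (Om : measurableType d) (P : probability Om R).
Variables (L : R -> Om -> R) (gam sig : R) (pi : {measure set R -> \bar R}).
Hypothesis HL : levy_process P L gam sig pi.
Variables (C dl l0 : R).
Hypothesis C0 : 0 < C.
Hypothesis dl0 : 0 < dl.
Hypothesis l00 : 0 < l0.
Hypothesis kapb : forall lam, 0 < lam -> lam <= l0 ->
  0 <= Psi gam sig pi lam - gam * lam <= C * lam `^ (1 + dl).

Let Y t w := L t w + gam * t.

Let mYgt (t c : R) : 0 <= t -> measurable [set w | c < `|Y t w|].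
Proof.
move=> t0; have mn : measurable_fun setT (fun w => `|Y t w|).
  by apply: measurableT_comp => //; apply: measurable_funD => //; exact: (levy_measurable HL).
have := mn measurableT _ (measurable_itv `]c, +oo[); rewrite setTI.
by congr measurable; apply/seteqP; split => w; rewrite /= in_itv/= andbT.
Qed.

Let dy (j m : nat) : R := j%:R / 2 ^+ m.

Let dy_ge0 j m : 0 <= dy j m.
Proof. by rewrite divr_ge0// exprn_ge0. Qed.

(** The successor in the index bound includes the endpoint T, where the maximal inequality evaluates
    the process. *)
Let A (c : R) (T m : nat) : set Om :=
  \bigcup_(j in [set j | (j < (T * 2 ^ m).+1)%N]) [set w | c < `|Y (dy j m) w|].

Let mA c T m : measurable (A c T m).
Proof. by apply: bigcup_measurable => j _; exact: mYgt. Qed.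

Let A_incr c T m : A c T m `<=` A c T m.+1.
Proof.
move=> w [j /= jT Yj]; exists (j * 2)%N; rewrite /=.
  by move: jT; rewrite !ltnS expnSr mulnA leq_mul2r orbC => ->.
by rewrite (_ : dy (j * 2) m.+1 = dy j m)// /dy natrM exprS; field; rewrite expf_neq0.
Qed.

(** With u = e T/4, the product of T and the exponent at 2/u is at most z, of order T T^-(1+dl) =
    T^-dl. The tail estimate then gives 4 (exp z - 1) <= 8 z; z <= 1/16 makes this at most 1/2, and
    the maximal inequality doubles it to 16 z. *)
Let bound_T (e : R) : 0 < e -> exists C1 T0 : R, [/\ 0 < C1, 0 < T0 &
  forall (T : nat) m, T0 <= T%:R -> (P (A (e * T%:R / 2) T m) <= (C1 * T%:R `^ (- dl))%:E)%E].
Proof.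
move=> e0; pose C1 := C * (8 / e) `^ (1 + dl).
have C10 : 0 < C1 by rewrite mulr_gt0// powR_gt0// divr_gt0.
have := powRN_cvg_pinfty dl0 => /cvgrPdist_lt /(_ (1 / (16 * C1))).
have -> : 0 < 1 / (16 * C1) by rewrite divr_gt0// mulr_gt0.
move=> /(_ isT) /near_pinftyP[T1 [T10 T1P]].
exists (16 * C1), (Num.max T1 (8 / (e * l0))); split.
- by rewrite mulr_gt0.
- by rewrite lt_max T10.
move=> T m; rewrite ge_max => /andP[TT1 TT2].
have T0 : 0 < T%:R :> R by apply: lt_le_trans TT1.
have := T1P _ TT1; rewrite sub0r normrN ger0_norm ?powR_ge0// => Tsmall.
pose z := C1 * T%:R `^ (- dl); have z0 : 0 <= z by rewrite mulr_ge0 ?powR_ge0// ltW.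
have z1 : z <= 1 / 16.
  rewrite /z -ler_pdivlMl//; apply: (le_trans (ltW Tsmall)).
  by rewrite le_eqVlt; apply/orP; left; apply/eqP; field; rewrite gt_eqF.
pose u := e * T%:R / 4; have u0 : 0 < u by rewrite divr_gt0// mulr_gt0.
have lu : 2 / u <= l0.
  have -> : 2 / u = 8 / e / T%:R by rewrite /u; field; rewrite !gt_eqF.
  rewrite ler_pdivrMr// (mulrC l0) -ler_pdivrMr//.
  by have -> : 8 / e / l0 = 8 / (e * l0) by field; rewrite !gt_eqF.
have lu0 : 0 < 2 / u by rewrite divr_gt0.
have lu1 : u^-1 <= l0 by apply: le_trans lu; rewrite ler_peMl ?invr_ge0 ?(ltW u0)// ler1n.
have /andP[k1 _] : 0 <= Psi gam sig pi u^-1 - gam * u^-1 <= C * u^-1 `^ (1 + dl).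
  by apply: kapb => //; rewrite invr_gt0.
have /andP[k2 k3] := kapb lu0 lu.
have Tz t : 0 <= t -> t <= T%:R -> t * (Psi gam sig pi (2 / u) - gam * (2 / u)) <= z.
  move=> t0 tT; apply: (@le_trans _ _ (T%:R * (C * (2 / u) `^ (1 + dl)))).
    exact: ler_pM.
  have -> : 2 / u = 8 / e * T%:R^-1 by rewrite /u; field; rewrite !gt_eqF.
  rewrite powRM ?invr_ge0 ?divr_ge0 ?(ltW e0) ?(ltW T0)//.
  have -> : T%:R^-1 `^ (1 + dl) = T%:R^-1 * T%:R `^ (- dl) :> R.
    rewrite -[T%:R^-1]powR_inv1 ?(ltW T0)// -powRrM mulN1r opprD powRD ?powR_inv1 ?(ltW T0)//.
    by rewrite (gt_eqF T0) implybT.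
  rewrite /z /C1 le_eqVlt; apply/orP; left; apply/eqP; field; rewrite gt_eqF//.
have tail j : (j <= T * 2 ^ m)%N -> (P [set w | (u < `|Y (dy j m) w|)%R] <= (8 * z)%:E)%E.
  move=> jT; have dT : dy j m <= T%:R.
    by rewrite ler_pdivrMr ?exprn_gt0// -natrX -natrM ler_nat.
  apply: (@le_trans _ _ (P [set w | (u <= `|Y (dy j m) w|)%R])).
    apply: le_measure; rewrite ?inE; first exact: mYgt.
      have mn : measurable_fun setT (fun w => `|Y (dy j m) w|).
        by apply: measurableT_comp => //; apply: measurable_funD => //; exact: (levy_measurable HL).
      have := mn measurableT _ (measurable_itv `[u, +oo[); rewrite setTI.
      by congr measurable; apply/seteqP; split => w; rewrite /= in_itv/= andbT.
    by move=> w /= /ltW.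
  have := levy_tail HL j m u0 k1; move=> /le_trans; apply; rewrite lee_fin.
  have zt := Tz (dy j m) (dy_ge0 j m) dT.
  have zt0 : 0 <= dy j m * (Psi gam sig pi (2 / u) - gam * (2 / u)) by rewrite mulr_ge0.
  have := expR_sub1_le zt0 (le_trans zt _); rewrite -/(dy j m).
  move=> /(_ ltac:(lra)); lra.
have TE : dy (T * 2 ^ m) m = T%:R by rewrite /dy natrM natrX mulfK// expf_neq0.
have Hm j : (j <= T * 2 ^ m)%N -> (P [set w | (u < `|Y (dy j m) w|)%R] <= 2^-1%:E)%E.
  move=> jT; apply: (le_trans (tail j jT)); rewrite lee_fin; lra.
have := @levy_maximal _ _ _ P L gam sig pi HL (T * 2 ^ m) m u Hm.
rewrite (_ : 2 * u = e * T%:R / 2); last by rewrite /u; field.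
move=> /le_trans; apply.
rewrite -/(dy (T * 2 ^ m) m).
have := tail (T * 2 ^ m)%N (leqnn _) => t1.
apply: (@le_trans _ _ (2%:E * (8 * z)%:E)%E); first by rewrite lee_pmul2l.
by rewrite -EFinM lee_fin /z; lra.
Qed.

(** Uses the horizons 2^k n with thresholds half as large as the slope [e] would allow. A time
    between two consecutive horizons exceeds half of the larger one, so the threshold there is below
    e u. The failure probabilities form a geometric series of ratio 2^-dl. *)
Lemma levy_linear_bound (e : R) : 0 < e -> exists C' n0 : R, [/\ 0 < C', 0 < n0 &
  forall n : nat, n0 <= n%:R -> exists Bad : set Om, [/\ measurable Bad,
    (P Bad <= (C' * n%:R `^ (- dl))%:E)%E &
    forall w, ~ Bad w -> forall u, 0 <= u -> `|L u w + gam * u| <= e * (n%:R + u)]].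
Proof.
move=> e0; have [C1 [T0 [C10 T00 H]]] := bound_T e0.
pose q : R := 2 `^ (- dl).
have q0 : 0 < q by rewrite powR_gt0.
have q1 : q < 1.
  by rewrite /q /powR gt_eqF// -[X in _ < X]expR0 ltr_expR pmulr_llt0 ?ln_gt0 ?ltr1n// oppr_lt0.
exists (C1 / (1 - q)), T0; split => //; first by rewrite divr_gt0// subr_gt0.
move=> n nT0; have n0 : 0 < n%:R :> R by apply: lt_le_trans nT0.
pose Tk k := (2 ^ k * n)%N.
have TkE k : (Tk k)%:R = 2 ^+ k * n%:R :> R by rewrite natrM natrX.
have Tk0 k : T0 <= (Tk k)%:R.
  by rewrite TkE (le_trans nT0)// ler_peMl ?(ltW n0)// exprn_ege1// ler1n.
pose B k := \bigcup_m A (e * (Tk k)%:R / 2) (Tk k) m.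
have mB k : measurable (B k) by apply: bigcupT_measurable => m; exact: mA.
exists (\bigcup_k B k); split; first exact: bigcupT_measurable.
  have -> : C1 / (1 - q) * n%:R `^ (- dl) = C1 * n%:R `^ (- dl) / (1 - q) by ring.
  apply: measure_bigcup_geometric => //; [|exact: ltW|].
    by rewrite mulr_ge0 ?powR_ge0// ltW.
  move=> k; apply: measure_bigcup_nondecreasing => // m.
  have := H (Tk k) m (Tk0 k); rewrite TkE powRM ?exprn_ge0 ?(ltW n0)//.
  have -> : (2 ^+ k) `^ (- dl) = q ^+ k :> R.
    rewrite -[in LHS]powR_mulrn// -powRrM (mulrC k%:R) powRrM powR_mulrn//; exact: powR_ge0.
  by rewrite (mulrC (q ^+ k)) (mulrA C1).
move=> w nB.
have dyb j m : `|Y (dy j m) w| <= e * (n%:R + dy j m).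
  have small k : dy j m <= (Tk k)%:R -> `|Y (dy j m) w| <= e * (Tk k)%:R / 2.
    move=> jk; rewrite leNgt; apply/negP => Yj; apply: nB; exists k => //; exists m => //.
    exists j => //=; rewrite ltnS; move: jk.
    by rewrite ler_pdivrMr ?exprn_gt0// -natrX -natrM ler_nat.
  have ex : exists k, dy j m <= (Tk k)%:R.
    exists (Num.truncn (dy j m / n%:R)).+1; rewrite TkE -ler_pdivrMr//.
    apply: (le_trans (ltW (truncnS_gt _))).
    by rewrite -natrX ler_nat ltnW// ltn_expl.
  case: (ex_minnP ex) => k kP kmin; have b := small k kP.
  case: k kP kmin b => [|k] kP kmin b.
    apply: (le_trans b); rewrite TkE expr0 mul1r -mulrA ler_pM2l//.
    by have := dy_ge0 j m; have := ltW n0; lra.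
  have : (Tk k)%:R < dy j m by rewrite ltNge; apply/negP => /kmin; rewrite ltnn.
  move=> kd; apply: (le_trans b); rewrite -mulrA ler_pM2l//.
  move: kd; rewrite !TkE exprS; have := ltW n0; lra.
move=> u u0; rewrite leNgt; apply/negP => Yu.
(* A strict violation at u persists on a right neighbourhood by right continuity, and a fine enough
   dyadic grid has a point there. *)
pose f s := `|L s w + gam * s| - e * (n%:R + s).
have idc : x @[x --> u^'+] --> u by apply: cvg_at_right_filter; exact: cvg_id.
have cf : f x @[x --> u^'+] --> f u.
  apply: cvgB.
    apply: cvg_norm; apply: cvgD; first exact: (levy_right_cont HL).
    by apply: cvgM => //; exact: cvg_cst.
  by apply: cvgM; [exact: cvg_cst|apply: cvgD => //; exact: cvg_cst].
have fu : 0 < f u by rewrite subr_gt0.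
have nU : nbhs (f u) [set y | 0 < y] by apply: open_nbhs_nbhs; split => //; exact: open_gt.
have [h [h0 hP]] := right_cont_near cf nU.
have [m mh] : exists m : nat, (2 ^+ m)^-1 < h.
  exists (Num.truncn h^-1).+1; rewrite invf_plt ?posrE ?exprn_gt0//.
  apply: (lt_le_trans (truncnS_gt _)); rewrite -natrX ler_nat ltnW// ltn_expl//.
pose j := (Num.truncn (u * 2 ^+ m)).+1.
have m0 : 0 < 2 ^+ m :> R by rewrite exprn_gt0.
have /truncn_itv/andP[j1 j2] : 0 <= u * 2 ^+ m by rewrite mulr_ge0// ltW.
have ju : u <= dy j m by rewrite ler_pdivlMr// ltW.
have jh : dy j m < u + h.
  rewrite ltr_pdivrMr// mulrDl /j -addn1 natrD.
  have : 1 < h * 2 ^+ m by rewrite -ltr_pdivrMr// div1r.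
  lra.
have := hP _ ju jh; rewrite /f /= subr_gt0 ltNge => /negP; apply; exact: dyb.
Qed.

End LevyAllTime.

(** * Power bounds on the Laplace exponent near 0 *)

Section LaplaceExponent.
Variables (R : realType) (gam sig : R) (pi : {measure set R -> \bar R}).

Lemma expR_ge_quadratic (y : R) : 0 <= y -> y ^+ 2 / 4 <= expR y - 1 - y.
Proof.
move=> y0; have h := expR_ge1Dx (y / 2).
have -> : expR y = expR (y / 2) ^+ 2 by rewrite expr2 -expRD; congr expR; field.
have : (1 + y / 2) ^+ 2 <= expR (y / 2) ^+ 2 by rewrite lerXn2r ?nnegrE ?expR_ge0//; lra.
rewrite !expr2; lra.
Qed.

Lemma expRN_le_quadratic (y : R) : 0 <= y -> expR (- y) - 1 + y <= y ^+ 2.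
Proof.
move=> y0; have h := expR_ge1Dx y.
have : expR (- y) * (1 + y) <= 1.
  apply: (@le_trans _ _ (expR (- y) * expR y)); first by rewrite ler_pM2l// expR_gt0.
  by rewrite -expRD addNr expR0.
rewrite expr2 => h2; have e0 := expR_gt0 (- y).
have : (expR (- y) - 1 + y - y * y) * (1 + y) <= 0 by nra.
by rewrite pmulr_lle0; lra.
Qed.

Let comp_ge0 (lam z : R) : 0 <= expR (- (lam * z)) - 1 + lam * z.
Proof. by have := expR_ge1Dx (- (lam * z)); lra. Qed.

Let mcomp (lam : R) : measurable_fun (`]0, +oo[%classic : set R) (fun z : R => (expR (- (lam * z)) - 1 + lam * z)%:E).
Proof.
apply: measurable_funTS; apply/measurable_EFinP; apply: measurable_funD => //.
apply: measurable_funB => //; apply: measurableT_comp => //; apply: measurableT_comp => //.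
Qed.

(** Finiteness of Psi at -nu is an exponential moment condition. It yields the second moment of pi
    through y^2/4 <= e^y - 1 - y with y = nu z, and then e^-y - 1 + y <= y^2 bounds the jump part at
    positive arguments. *)
Lemma Psi_quadratic (nu : R) : 0 < nu -> PsiE gam sig pi (- nu) = 0%E ->
  exists C : R, 0 < C /\ forall lam, 0 <= lam ->
    0 <= Psi gam sig pi lam - gam * lam <= C * lam ^+ 2.
Proof.
move=> nu0 Pnu.
set I := (\int[pi]_(z in `]0%R, +oo[) (expR (- (- nu * z)) - 1 + - nu * z)%:E)%E.
have I0 : (0 <= I)%E by apply: integral_ge0 => z _; rewrite lee_fin comp_ge0.
have Ifin : I \is a fin_num.
  rewrite ge0_fin_numE//; move: Pnu; rewrite /PsiE -/I.
  by case: I I0 => [r||]//; rewrite ltry.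
have mz2 : measurable_fun (`]0, +oo[%classic : set R) (fun z : R => (z ^+ 2)%:E).
  by apply: measurable_funTS; apply/measurable_EFinP; exact: measurable_funX.
pose K := (\int[pi]_(z in `]0%R, +oo[) (z ^+ 2)%:E)%E.
have K0 : (0 <= K)%E by apply: integral_ge0 => z _; rewrite lee_fin sqr_ge0.
have KI : ((nu ^+ 2 / 4)%:E * K <= I)%E.
  rewrite -ge0_integralZl//; last 2 first.
  - by move=> z _; rewrite lee_fin sqr_ge0.
  - by rewrite lee_fin divr_ge0// sqr_ge0.
  apply: ge0_le_integral => //.
  - by move=> z _; rewrite -EFinM lee_fin mulr_ge0 ?sqr_ge0// divr_ge0// sqr_ge0.
  - exact: measurable_funeM.
  - move=> z /=; rewrite in_itv/= andbT => z0; rewrite -EFinM lee_fin.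
    have nz : 0 <= nu * z by rewrite mulr_ge0// ltW.
    have := expR_ge_quadratic nz; rewrite mulNr opprK exprMn; lra.
have Kfin : K \is a fin_num.
  rewrite ge0_fin_numE//; move: KI; case: K K0 => [r||]//; first by rewrite ltry.
  by move=> _; rewrite gt0_muley ?lte_fin ?divr_gt0 ?exprn_gt0// leye_eq => /eqP IE; rewrite IE in Ifin.
exists (sig ^+ 2 / 2 + fine K + 1); split.
  by rewrite ltr_wpDl// addr_ge0 ?fine_ge0// divr_ge0// sqr_ge0.
move=> lam l0; set J := (\int[pi]_(z in `]0%R, +oo[) (expR (- (lam * z)) - 1 + lam * z)%:E)%E.
have J0 : (0 <= J)%E by apply: integral_ge0 => z _; rewrite lee_fin comp_ge0.
have JK : (J <= (lam ^+ 2)%:E * K)%E.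
  rewrite -ge0_integralZl//; last 2 first.
  - by move=> z _; rewrite lee_fin sqr_ge0.
  - by rewrite lee_fin sqr_ge0.
  apply: ge0_le_integral => //.
  - by move=> z _; rewrite lee_fin comp_ge0.
  - exact: measurable_funeM.
  - move=> z /=; rewrite in_itv/= andbT => z0; rewrite -EFinM lee_fin.
    have nz : 0 <= lam * z by rewrite mulr_ge0// ltW.
    by have := expRN_le_quadratic nz; rewrite exprMn.
have Jfin : J \is a fin_num.
  by rewrite ge0_fin_numE// (le_lt_trans JK)// -(fineK Kfin) -EFinM ltry.
have -> : Psi gam sig pi lam = gam * lam + sig ^+ 2 / 2 * lam ^+ 2 + fine J.
  by rewrite /Psi /PsiE -/J -(fineK Jfin).
move: JK; rewrite -(fineK Jfin) -(fineK Kfin) -EFinM lee_fin => JK.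
have := fine_ge0 J0; have := fine_ge0 K0; have s2 := sqr_ge0 lam; have s3 := sqr_ge0 sig.
have : 0 <= sig ^+ 2 * lam ^+ 2 by rewrite mulr_ge0.
move=> h1 h2 h3; apply/andP; split; lra.
Qed.

Lemma Psi_power_bound :
  (exists delta c : R, 0 < delta < 1 /\ 0 < c /\
      ((Psi gam sig pi lam - gam * lam) / (c * lam `^ (1 + delta)))
         @[lam --> 0^'+] --> (1 : R))
   \/ (exists nu : R, 0 < nu /\ PsiE gam sig pi (- nu) = 0%E) ->
  exists C dl l0 : R, [/\ 0 < C, 0 < dl, 0 < l0 &
    forall lam, 0 < lam -> lam <= l0 -> 0 <= Psi gam sig pi lam - gam * lam <= C * lam `^ (1 + dl)].
Proof.
move=> [[dl [c [/andP[dl0 dl1] [c0 H]]]]|[nu [nu0 H]]].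
  (* Closeness 1 to the limit 1 puts the ratio in (0, 2), which gives both the sign and the constant
     2c. *)
  exists (2 * c), dl; move/cvgrPdist_lt : H => /(_ _ ltr01).
  rewrite near_withinE => /nbhs_ballP[l0 /= l00 H].
  exists (l0 / 2); split => //; rewrite ?mulr_gt0 ?divr_gt0//.
  move=> lam lam0 laml; have : ball (0 : R) l0 lam.
    by rewrite /ball/= sub0r normrN gtr0_norm//; lra.
  move=> /H /(_ lam0); have D0 : 0 < c * lam `^ (1 + dl) by rewrite mulr_gt0// powR_gt0.
  rewrite ltr_norml => /andP[h1 h2].
  set x := Psi _ _ _ _ - _ in h1 h2 *; set D := c * _ in D0 h1 h2.
  have xE : x = x / D * D by rewrite divfK// gt_eqF.
  rewrite -mulrA -/D xE; have : 0 < x / D by lra.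
  have : x / D < 2 by lra.
  by move=> h3 h4; apply/andP; split; [exact/ltW/mulr_gt0|rewrite ler_pM2r// ltW].
have [C [C0 HC]] := Psi_quadratic nu0 H.
(* On (0, 1] the quadratic bound is relaxed to the exponent 3/2, the common form of both cases. *)
exists C, (1 / 2), 1; split => // lam l0 l1.
have /andP[h1 h2] := HC lam (ltW l0); rewrite h1/= (le_trans h2)// ler_pM2l//.
rewrite -powR_mulrn ?(ltW l0)//; apply: ger_powR; first by rewrite l0.
lra.
Qed.

End LaplaceExponent.

(** * Transition probabilities of X from large and from moderate states *)

Section KernelBounds.
Variables (R : realType) (gam sig : R) (pi : {measure set R -> \bar R}) (Rf : R -> R) (th : R).
Variables (d : measure_display) (Om : measurableType d) (P : probability Om R) (L : R -> Om -> R).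
Hypothesis Rf_cont : {within `[0%R, +oo[%classic, continuous Rf}.
Hypothesis Rf_gt0 : forall x : R, 0 < x -> 0 < Rf x.
Hypothesis gam0 : 0 < gam.
Hypothesis th1 : 1 < th.
Hypothesis Rf_rv : regvar_infty Rf th.
Hypothesis HL : levy_process P L gam sig pi.
Variables (C dl l0 : R).
Hypothesis C0 : 0 < C.
Hypothesis dl0 : 0 < dl.
Hypothesis l00 : 0 < l0.
Hypothesis kapb : forall lam, 0 < lam -> lam <= l0 ->
  0 <= Psi gam sig pi lam - gam * lam <= C * lam `^ (1 + dl).

Let ph := phi gam Rf.

Lemma measurable_Xevent (h x : R) (B : set R) : measurable B ->
  measurable [set w | B (Xpath Rf x (fun s => L s w) h)].
Proof.
move=> mB; rewrite -[X in measurable X]setTI.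
apply: (measurable_Xpath (levy_measurable HL) (levy_right_cont HL) x Rf_cont h) => //.
Qed.

Lemma levy_path_measurable w : measurable_fun (`[0%R, +oo[%classic : set R) (fun s => L s w).
Proof.
have mj := measurable_joint (levy_measurable HL) (levy_right_cont HL).
have mp := measurable_fun_pair1 w mj.
move=> mD A mA; have := measurableI _ _ mD (mp measurableT A mA).
congr measurable; apply/seteqP; split => s /=; rewrite in_itv/= andbT => -[s0].
  by rewrite (max_idPl s0) => -[].
by rewrite (max_idPl s0).
Qed.

(** Outside an exceptional event the pathwise step estimate holds, so a set B avoiding the predicted
    window is reached only on that event. Its probability, of order y^-dl, is rewritten as a power
    of phi(y) so that it can be summed on the phi scale. *)
Lemma kernel_good (e : R) : 0 < e -> exists rho K ts : R,
  [/\ 0 < rho, rho <= 1 / 2, 0 < K, 0 < ts & forall y h (B : set R),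
    0 < y -> ph y <= ts -> 0 <= h -> h <= 4 * rho * ph y -> measurable B ->
    (forall z, 0 < z -> `|ph z - ph y - h| <= e * rho * ph y -> ~ B z) ->
    (Xkernel P L Rf h y B <= (K * ph y `^ (dl / th))%:E)%E].
Proof.
move=> e0; have [rho [e1 [x0 [r0 r1 e10 x00 S]]]] := Xpath_step Rf_cont Rf_gt0 gam0 th1 Rf_rv e0.
have [C' [n0 [C'0 n00 LB]]] := levy_linear_bound HL C0 dl0 l00 kapb e10.
have [c [x1 [c0 x10 PL]]] := phi_power_lower Rf_cont Rf_gt0 gam0 th1 Rf_rv.
have th0 : 0 < th by have := th1; lra.
pose x2 := x0 + x1 + n0 + 2.
have x20 : 0 < x2 by rewrite /x2; lra.
have p2 : 0 < ph x2 by exact: (phi_gt0 Rf_cont Rf_gt0 gam0 th1 Rf_rv).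
exists rho, (C' * 2 `^ dl * c `^ (dl / th)), (ph x2 / 2); split => //.
- by rewrite !mulr_gt0 ?powR_gt0.
- by rewrite divr_gt0.
move=> y h B y0 yt h0 hr mB HB.
have yx2 : x2 <= y.
  rewrite leNgt; apply/negP => yx.
  have := phi_lt Rf_cont Rf_gt0 gam0 th1 Rf_rv y0 yx; rewrite -/ph; lra.
have y1 : 2 <= y by move: yx2; rewrite /x2; lra.
(* Rounding down keeps e1 (n + u) <= e1 (y + u), and y >= 2 gives n >= y/2, so that n^-dl is
   comparable with y^-dl. *)
pose n := Num.truncn y.
have /truncn_itv/andP[ny yn] := ltW y0; rewrite -/n -addn1 natrD in ny yn.
have n2 : y / 2 <= n%:R by lra.
have [Bad [mBad PBad goodP]] := LB n ltac:(move: yx2; rewrite /x2; lra).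
rewrite /Xkernel; apply: (@le_trans _ _ (P Bad)).
  apply: le_measure; rewrite ?inE//; first exact: measurable_Xevent.
  move=> w /= Bw; apply: contrapT => nBad.
  have [|||X1 X2] := S y h (fun s => L s w) _ h0 hr _ _.
  - by move: yx2; rewrite /x2; lra.
  - exact: levy_path_measurable.
  - move=> u u0; apply: (le_trans (goodP w nBad u u0)); rewrite ler_pM2l//; lra.
  - by apply: (HB _ _ X2 Bw); apply: lt_le_trans X1; rewrite divr_gt0.
apply: (le_trans PBad); rewrite lee_fin.
have n00' : 0 < n%:R :> R by lra.
have yp : y `^ (- dl) <= (c * ph y) `^ (dl / th).
  have -> : y `^ (- dl) = (y `^ (- th)) `^ (dl / th).
    by rewrite -powRrM; congr (_ `^ _); field; rewrite gt_eqF.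
  apply: ge0_ler_powR; rewrite ?nnegrE ?powR_ge0//.
  - by rewrite divr_ge0// ltW.
  - by rewrite mulr_ge0 ?(ltW c0)// ltW// (phi_gt0 Rf_cont Rf_gt0 gam0 th1 Rf_rv).
  - by apply: PL; move: yx2; rewrite /x2; lra.
have np : n%:R `^ (- dl) <= 2 `^ dl * y `^ (- dl).
  have -> : 2 `^ dl * y `^ (- dl) = (y / 2) `^ (- dl).
    by rewrite powRM ?(ltW y0)// -powR_inv1// -powRrM mulN1r opprK mulrC.
  rewrite !powRN lef_pV2 ?posrE ?powR_gt0 ?divr_gt0//.
  by apply: ge0_ler_powR; rewrite ?nnegrE ?(ltW dl0) ?(ltW n00')// divr_ge0// ltW.
rewrite -!mulrA ler_pM2l//; apply: (le_trans np); rewrite ler_pM2l ?powR_gt0//.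
apply: (le_trans yp); rewrite powRM ?(ltW c0)//.
by rewrite ltW// (phi_gt0 Rf_cont Rf_gt0 gam0 th1 Rf_rv).
Qed.

(** With e1 <= gam the envelope gives L_u <= e1 n for all u at once: the drift absorbs the growing
    part. The path then never climbs above (1 + e) b, whatever the time change does, which is why h
    is arbitrary. *)
Lemma kernel_low (e : R) : 0 < e -> exists b0 : R, 0 < b0 /\ forall b y h (B : set R),
  b0 <= b -> y <= b -> measurable B -> (forall z, B z -> (1 + e) * b < z) ->
  (Xkernel P L Rf h y B <= (1 / 2)%:E)%E.
Proof.
move=> e0; pose e1 := Num.min e gam.
have e10 : 0 < e1 by rewrite lt_min e0.
have e1e : e1 <= e by rewrite ge_min lexx.
have e1g : e1 <= gam by rewrite ge_min lexx orbT.
have [C' [n0 [C'0 n00 LB]]] := levy_linear_bound HL C0 dl0 l00 kapb e10.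
have := powRN_cvg_pinfty dl0 => /cvgrPdist_lt /(_ (1 / (2 * C'))).
have -> : 0 < 1 / (2 * C') by rewrite divr_gt0// mulr_gt0.
move=> /(_ isT) /near_pinftyP[T1 [T10 T1P]].
exists (n0 + T1 + 1); split; first by lra.
move=> b y h B bb yb mB HB; have bp : 0 < b by lra.
pose n := Num.truncn b.
have /truncn_itv/andP[nb bn] := ltW bp; rewrite -/n -addn1 natrD in nb bn.
have [Bad [mBad PBad goodP]] := LB n ltac:(lra).
rewrite /Xkernel; apply: (@le_trans _ _ (P Bad)).
  apply: le_measure; rewrite ?inE//; first exact: measurable_Xevent.
  move=> w /= /HB Bw; apply: contrapT => nBad.
  have lc u : 0 <= u -> L u w <= e1 * n%:R.
    move=> u0; have := goodP w nBad u u0; rewrite ler_norml => /andP[_].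
    have : e1 * u <= gam * u by rewrite ler_wpM2r.
    lra.
  have := Xpath_le_sup Rf y h lc; rewrite le_max => /orP[X0|X1].
    have : 0 < (1 + e) * b by rewrite mulr_gt0// addr_gt0.
    lra.
  have : e1 * n%:R <= e * b by apply: ler_pM => //; exact: ltW.
  lra.
apply: (le_trans PBad); rewrite lee_fin.
have := T1P n%:R ltac:(lra); rewrite sub0r normrN ger0_norm ?powR_ge0// => h1.
have : C' * n%:R `^ (- dl) <= C' * (1 / (2 * C')) by rewrite ler_pM2l// ltW.
rewrite (_ : C' * (1 / (2 * C')) = 1 / 2)//; field; rewrite gt_eqF//.
Qed.

End KernelBounds.

(** Compares the simple functions below f with those below the constant. In this form it applies to
    the kernel as a function of its starting point, for which only pointwise bounds are at hand. *)
Lemma integral_le_cst (R : realType) (d : measure_display) (T : measurableType d)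
    (mu : {measure set T -> \bar R}) (D : set T) (f : T -> \bar R) (c : R) :
  measurable D -> 0 <= c -> (forall x, D x -> (0 <= f x)%E) -> (forall x, D x -> (f x <= c%:E)%E) ->
  (\int[mu]_(x in D) f x <= c%:E * mu D)%E.
Proof.
move=> mD c0 f0 fc; rewrite -integral_cst// [leLHS]integral_mkcond [leRHS]integral_mkcond.
rewrite ge0_integralTE; last by move=> x; rewrite patchE; case: ifPn => // /set_mem/f0.
rewrite ge0_integralTE; last by move=> x; rewrite patchE; case: ifPn => // _; rewrite lee_fin.
apply: ereal_sup_le => _ [h hf <-]; exists h => // x.
apply: (le_trans (hf x)); rewrite !patchE; case: ifPn => // /set_mem; exact: fc.
Qed.

Lemma exprn_unbounded (R : realType) (c rho : R) : 0 < rho -> exists n, c <= (1 + rho) ^+ n.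
Proof.
move=> r0; have bern n : 1 + n%:R * rho <= (1 + rho) ^+ n.
  elim: n => [|n IH]; first by rewrite mul0r addr0 expr0.
  rewrite exprS; have nr : 0 <= n%:R * rho by rewrite mulr_ge0// ltW.
  apply: (@le_trans _ _ ((1 + rho) * (1 + n%:R * rho))); last by rewrite ler_pM2l//; lra.
  by rewrite -natr1; have := mulr_ge0 nr (ltW r0); lra.
exists (Num.truncn (c / rho)).+1; apply: le_trans (bern _).
have : c <= (Num.truncn (c / rho)).+1%:R * rho.
  by rewrite -ler_pdivrMr// ltW// truncnS_gt.
lra.
Qed.

Lemma exprn_small (R : realType) (q e : R) : 0 < q -> q < 1 -> 0 < e -> exists n, q ^+ n <= e.
Proof.
move=> q0 q1 e0; have r0 : 0 < q^-1 - 1 by rewrite subr_gt0 invf_gt1.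
have [n nP] := exprn_unbounded e^-1 r0; exists n.
by rewrite -[leRHS]invrK -[leLHS]invrK lef_pV2 ?posrE ?invr_gt0 ?exprn_gt0// -exprVn;
  move: nP; rewrite addrC subrK.
Qed.

(** * Windows for phi(Y), derived from two abstract kernel bounds *)

Section MarkovWindows.
Variables (R : realType) (d : measure_display) (Om : measurableType d) (P : probability Om R).
Variables (Y : R -> Om -> R) (ker : R -> R -> set R -> \bar R) (ph : R -> R) (kap : R).

(** The conditioning events available in [law_P_infty]. The event that a given grid point is the
    first bad one on a finite grid has this form. *)
Definition past_event (s : R) (E : set Om) := exists (n : nat) (ts : nat -> R) (As : nat -> set R),
  [/\ forall i, (i < n)%N -> 0 < ts i <= s, forall i, measurable (As i) &
      E = \bigcap_(i in [set i | (i < n)%N]) [set w | As i (Y (ts i) w)]].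

Hypothesis mY : forall t, 0 < t -> measurable_fun setT (Y t).
Hypothesis ker_ge0 : forall h y B, (0 <= ker h y B)%E.
Hypothesis markov : forall s h E B, 0 < s -> 0 <= h -> past_event s E -> measurable B ->
  P (E `&` [set w | B (Y (s + h)%R w)]) = (\int[P]_(w in E) ker h (Y s w) B)%E.
Hypothesis ph_gt0 : forall x, 0 < x -> 0 < ph x.
Hypothesis ph_lt : forall x y, 0 < x -> x < y -> ph y < ph x.
Hypothesis ph_small : forall e, 0 < e -> exists x0, 0 < x0 /\ forall x, x0 <= x -> ph x < e.
Hypothesis kap0 : 0 < kap.
Hypothesis Yoo : forall w, Y t w @[t --> 0^'+] --> +oo.
Hypothesis ker_good : forall e, 0 < e -> exists rho K ts : R,
  [/\ 0 < rho, rho <= 1 / 2, 0 < K, 0 < ts & forall y h (B : set R),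
    0 < y -> ph y <= ts -> 0 <= h -> h <= 4 * rho * ph y -> measurable B ->
    (forall z, 0 < z -> `|ph z - ph y - h| <= e * rho * ph y -> ~ B z) ->
    (ker h y B <= (K * ph y `^ kap)%:E)%E].
Hypothesis ker_low : forall e, 0 < e -> exists ts : R, 0 < ts /\ forall tau y h (B : set R),
    0 < tau -> tau <= ts -> (0 < y -> tau < ph y) -> measurable B ->
    (forall z, B z -> 0 < z /\ ph z <= (1 - e) * tau) ->
    (ker h y B <= (1 / 2)%:E)%E.

Let pr (X : set Om) : R := fine (P X).

Let prE X : measurable X -> P X = (pr X)%:E.
Proof. by move=> mX; rewrite fineK// fin_num_measure. Qed.

Let pr_ge0 X : 0 <= pr X.
Proof. exact: fine_ge0. Qed.

Let pr_le A B : measurable A -> measurable B -> A `<=` B -> pr A <= pr B.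
Proof.
by move=> mA mB AB; rewrite -lee_fin -!prE//; apply: le_measure; rewrite ?inE.
Qed.

Let prU_le A B : measurable A -> measurable B -> pr (A `|` B) <= pr A + pr B.
Proof.
move=> mA mB; rewrite -lee_fin EFinD -!prE//; last exact: measurableU.
exact: measureU2.
Qed.

Let prU_disj A B : measurable A -> measurable B -> [disjoint A & B]%classic -> pr (A `|` B) = pr A + pr B.
Proof.
move=> mA mB /disj_set2P AB; apply: EFin_inj; rewrite EFinD -!prE//; last exact: measurableU.
exact: measureU.
Qed.

Lemma measurable_at t (A : set R) : 0 < t -> measurable A -> measurable [set w | A (Y t w)].
Proof. by move=> t0 mA; rewrite -[X in measurable X]setTI; exact: mY. Qed.

Lemma past_eventT s : past_event s setT.
Proof.
by exists 0%N, (fun _ => 0), (fun _ => setT); split => //; apply/seteqP; split.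
Qed.

Lemma past_eventW s s' E : s <= s' -> past_event s E -> past_event s' E.
Proof.
move=> ss [n [ts [As [h1 h2 h3]]]]; exists n, ts, As; split => // i /h1 /andP[-> h].
exact: le_trans h ss.
Qed.

Lemma measurable_past_event s E : past_event s E -> measurable E.
Proof.
move=> [n [ts [As [h1 h2 ->]]]]; rewrite bigcap_mkord; apply: bigsetI_measurable => i _.
by have /andP[t0 _] := h1 i (ltn_ord i); exact: measurable_at.
Qed.

Lemma past_eventI s t E (A : set R) : 0 < t -> t <= s -> measurable A -> past_event s E ->
  past_event s (E `&` [set w | A (Y t w)]).
Proof.
move=> t0 ts mA [n [us [As [h1 h2 ->]]]].
exists n.+1, (fun i => if i == n then t else us i), (fun i => if i == n then A else As i); split.
- move=> i; rewrite ltnS leq_eqVlt => /predU1P[->|it]; first by rewrite eqxx t0.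
  by rewrite ltn_eqF//; exact: h1.
- by move=> i; case: ifP.
- apply/seteqP; split => w /=.
    move=> [Hw Aw] i /=; rewrite ltnS leq_eqVlt => /predU1P[->|it]; first by rewrite eqxx.
    by rewrite ltn_eqF//; exact: Hw.
  move=> Hw; split; last by have := Hw n (ltnSn n); rewrite eqxx.
  by move=> i /= it; have := Hw i (ltnW it); rewrite ltn_eqF.
Qed.

Lemma markov_step s h c E (A B : set R) : 0 < s -> 0 <= h -> 0 <= c -> past_event s E ->
  measurable A -> measurable B -> (forall y, A y -> (ker h y B <= c%:E)%E) ->
  pr (E `&` [set w | A (Y s w)] `&` [set w | B (Y (s + h) w)]) <= c * pr (E `&` [set w | A (Y s w)]).
Proof.
move=> s0 h0 c0 pE mA mB H.
have pE' := past_eventI s0 (lexx s) mA pE; have mE' := measurable_past_event pE'.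
have sh : 0 < s + h by rewrite ltr_pwDl.
rewrite -lee_fin EFinM -!prE//; last by apply: measurableI => //; exact: measurable_at.
by rewrite markov//; apply: integral_le_cst => // w [_ /=]; exact: H.
Qed.

Let win (tau e : R) : set R := [set y | 0 < y /\ `|ph y - tau| <= e * tau].

Let ph_le x y : 0 < x -> x <= y -> ph y <= ph x.
Proof. by move=> x0; rewrite le_eqVlt => /predU1P[->//|xy]; exact/ltW/ph_lt. Qed.

Let band (a b : R) : set R := [set y | 0 < y /\ a <= ph y <= b].

(** By monotonicity of [ph] the preimage of an interval is an interval. *)
Lemma measurable_phi_interval (a b : R) : measurable (band a b).
Proof.
apply: is_interval_measurable => x y [x0 /andP[x1 x2]] [y0 /andP[y1 y2]] z /andP[xz zy].
have z0 := lt_le_trans x0 xz; split => //; apply/andP; split.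
  by apply: le_trans y1 _; exact: ph_le.
by apply: le_trans x2; exact: ph_le.
Qed.

Lemma measurable_phi_interval_oc (a b : R) : measurable [set y | 0 < y /\ a < ph y <= b].
Proof.
apply: is_interval_measurable => x y [x0 /andP[x1 x2]] [y0 /andP[y1 y2]] z /andP[xz zy].
have z0 := lt_le_trans x0 xz; split => //; apply/andP; split.
  by apply: lt_le_trans y1 _; exact: ph_le.
by apply: le_trans x2; exact: ph_le.
Qed.

Lemma measurable_win tau e : measurable (win tau e).
Proof.
rewrite (_ : win tau e = [set y | 0 < y /\ tau - e * tau <= ph y <= tau + e * tau]).
  exact: measurable_phi_interval.
by apply/seteqP; split => y; rewrite /win/= ler_distl.
Qed.

Lemma measurable_winC tau e : measurable (~` win tau e).
Proof. by apply: measurableC; exact: measurable_win. Qed.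

Let powk_le x y : 0 <= x -> x <= y -> x `^ kap <= y `^ kap.
Proof. by move=> x0 xy; apply: ge0_ler_powR; rewrite ?nnegrE ?(ltW kap0)// (le_trans x0). Qed.

(** A full step goes from tau to (1 + rho) tau. The initial error e tau and the kernel error, at
    most e rho tau, add up to e (1 + rho) tau, so the relative error stays e; only the last, shorter
    step widens it to 2e. Halving [e] in the kernel bound pays for phi(y) <= (1 + e) tau. The bound
    is proportional to the probability of the starting event, so that it can be summed over disjoint
    starts. *)
Lemma window_chain e : 0 < e -> e <= 1 / 2 -> exists K ts : R, [/\ 0 < K, 0 < ts &
  forall tau H s E (A : set R), 0 < s -> 0 < tau -> 0 <= H -> tau + H <= ts ->
    past_event s E -> measurable A -> A `<=` win tau e ->
    pr (E `&` [set w | A (Y s w)] `&` [set w | (~` win (tau + H) (2 * e)) (Y (s + H) w)]) <=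
    K * (tau + H) `^ kap * pr (E `&` [set w | A (Y s w)])].
Proof.
move=> e0 e1; have [rho [K [ts [r0 r1 K0 ts0 G]]]] := ker_good (divr_gt0 e0 (ltr0n R 2 : 0 < 2)).
have kapnz : kap != 0 by rewrite gt_eqF.
pose K2 := K * 2 `^ kap; have K20 : 0 < K2 by rewrite mulr_gt0// powR_gt0.
have D0 : 0 < (1 + rho) `^ kap - 1.
  rewrite subr_gt0 -[X in X < _](powRr0 (1 + rho)) /powR gt_eqF; last lra.
  by rewrite ltr_expR mul0r mulr_gt0// ln_gt0//; lra.
(* Makes K3 (t1^kap - tau^kap) equal to the failure probability K2 tau^kap of a full step, t1 = (1 +
   rho) tau, so the sum over the chain telescopes. *)
pose K3 := K2 / ((1 + rho) `^ kap - 1); have K30 : 0 < K3 by rewrite divr_gt0.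
have step tau h y : 0 < tau -> 2 * tau <= ts -> 0 <= h -> h <= rho * tau -> win tau e y ->
    forall B, measurable B ->
    (forall z, 0 < z -> `|ph z - (tau + h)| <= e * tau + e * rho * tau -> ~ B z) ->
    (ker h y B <= (K2 * tau `^ kap)%:E)%E.
  move=> t0 tts h0 hr [y0 yt] B mB HB.
  have p0 := ph_gt0 y0; move: (yt); rewrite ler_norml => /andP[yt1 yt2].
  have et : e * tau <= 1 / 2 * tau by rewrite ler_pM2r.
  have pt : ph y <= (1 + e) * tau by rewrite mulrDl mul1r; lra.
  apply: (@le_trans _ _ (K * ph y `^ kap)%:E); last first.
    rewrite lee_fin /K2 -mulrA ler_pM2l// -powRM//; last exact: ltW.
    by apply: powk_le; [exact: ltW|lra].
  apply: G => //; first lra.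
    by apply: (le_trans hr); rewrite (mulrC 4) -mulrA ler_pM2l//; lra.
  move=> z z0 zd; apply: HB => //.
  have -> : ph z - (tau + h) = (ph z - ph y - h) + (ph y - tau) by ring.
  apply: (le_trans (ler_normD _ _)).
  have : e / 2 * rho * ph y <= e / 2 * rho * ((1 + e) * tau) by rewrite ler_pM2l// mulr_gt0// divr_gt0.
  have : e / 2 * rho * ((1 + e) * tau) <= e * rho * tau.
    rewrite (_ : e / 2 * rho * ((1 + e) * tau) = e * rho * tau * ((1 + e) / 2)); last by field.
    by rewrite ler_piMr//; [rewrite !mulr_ge0// ltW|lra].
  lra.
have last_step tau H s E (A : set R) : 0 < s -> 0 < tau -> 0 <= H -> 2 * (tau + H) <= ts ->
    H <= rho * tau -> past_event s E -> measurable A -> A `<=` win tau e ->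
    pr (E `&` [set w | A (Y s w)] `&` [set w | (~` win (tau + H) (2 * e)) (Y (s + H) w)]) <=
    (K3 * ((tau + H) `^ kap - tau `^ kap) + K2 * (tau + H) `^ kap) * pr (E `&` [set w | A (Y s w)]).
  move=> s0 t0 H0 tts Hr pE mA AW.
  have TH : tau `^ kap <= (tau + H) `^ kap by apply: powk_le; lra.
  have TK : 0 <= K3 * ((tau + H) `^ kap - tau `^ kap) by rewrite mulr_ge0 ?subr_ge0// ltW.
  have TK2 : K2 * tau `^ kap <= K2 * (tau + H) `^ kap by rewrite ler_pM2l.
  apply: (@le_trans _ _ (K2 * tau `^ kap * pr (E `&` [set w | A (Y s w)]))); last first.
    by rewrite ler_wpM2r ?pr_ge0//; lra.
  apply: markov_step => //; [by rewrite mulr_ge0 ?powR_ge0// ltW|exact: measurable_winC|].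
  move=> y /AW Wy; apply: (step tau) => //; [lra|exact: measurable_winC|].
  move=> z z0 zd; apply; split => //; apply: (le_trans zd).
  have : e * rho * tau <= e * tau by rewrite -mulrA ler_pM2l// ler_piMl ?(ltW t0)//; move: r1; hide_comparisons; lra.
  have : 0 <= e * H by rewrite mulr_ge0// ltW.
  move: e0 t0; hide_comparisons; lra.
have key n tau H s E (A : set R) : 0 < s -> 0 < tau -> 0 <= H -> 2 * (tau + H) <= ts ->
    tau + H <= (1 + rho) ^+ n * tau -> past_event s E -> measurable A -> A `<=` win tau e ->
    pr (E `&` [set w | A (Y s w)] `&` [set w | (~` win (tau + H) (2 * e)) (Y (s + H) w)]) <=
    (K3 * ((tau + H) `^ kap - tau `^ kap) + K2 * (tau + H) `^ kap) * pr (E `&` [set w | A (Y s w)]).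
  elim: n tau H s E A => [|n IH] tau H s E A s0 t0 H0 tts Tn pE mA AW.
    apply: last_step => //; have := mulr_ge0 (ltW r0) (ltW t0); move: Tn; rewrite expr0 mul1r; lra.
  have [Hr|Hr] := leP H (rho * tau); first exact: last_step.
  have pE' := past_eventI s0 (lexx s) mA pE; have mE' := measurable_past_event pE'.
  set pA := pr (E `&` [set w | A (Y s w)]).
  pose t1 := (1 + rho) * tau; have t1E : tau + rho * tau = t1 by rewrite /t1; ring.
  have t10 : 0 < t1 by rewrite /t1 mulr_gt0//; move: r0; hide_comparisons; lra.
  have tH : t1 + (H - rho * tau) = tau + H by rewrite -t1E; ring.
  have sH : (s + rho * tau) + (H - rho * tau) = s + H by ring.
  have rt : 0 < rho * tau by rewrite mulr_gt0.
  have sr : 0 < s + rho * tau by rewrite addr_gt0.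
  have Hr0 : 0 <= H - rho * tau by rewrite subr_ge0 ltW.
  have := IH t1 (H - rho * tau) (s + rho * tau) (E `&` [set w | A (Y s w)]) (win t1 e).
  rewrite tH sH => /(_ sr t10 Hr0 tts).
  move=> /(_ _ (past_eventW _ pE') (measurable_win _ _) (@subset_refl _ _)).
  have -> : tau + H <= (1 + rho) ^+ n * t1 by rewrite /t1 mulrA -exprSr.
  move=> /(_ isT ltac:(move: rt; hide_comparisons; lra)) I1.
  have I2 : pr (E `&` [set w | A (Y s w)] `&` [set w | (~` win t1 e) (Y (s + rho * tau) w)]) <=
      K2 * tau `^ kap * pA.
    apply: markov_step => //; first exact: ltW.
    - by rewrite mulr_ge0 ?powR_ge0// ltW.
    - exact: measurable_winC.
    - move=> y /AW Wy; apply: (step tau) => //; [move: tts H0; hide_comparisons; lra|exact: ltW|exact: measurable_winC|].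
      move=> z z0 zd; apply; split => //; rewrite -t1E; apply: (le_trans zd).
      by rewrite le_eqVlt; apply/orP; left; apply/eqP; ring.
  have sH0 : 0 < s + H by rewrite ltr_pwDl.
  set E1 := E `&` [set w | A (Y s w)] in pE' mE' pA I1 I2 *.
  set Fw := [set w | (~` win (tau + H) (2 * e)) (Y (s + H) w)] in I1 *.
  have mF : measurable Fw by apply: measurable_at => //; exact: measurable_winC.
  set W1 := [set w | win t1 e (Y (s + rho * tau) w)] in I1.
  have mW1 : measurable W1 by apply: measurable_at => //; exact: measurable_win.
  have W1C : [set w | (~` win t1 e) (Y (s + rho * tau) w)] = ~` W1 by [].
  rewrite W1C in I2.
  have : pr (E1 `&` Fw) <= pr (E1 `&` W1 `&` Fw) + pr (E1 `&` ~` W1).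
    apply: (le_trans _ (prU_le _ _)).
    - apply: pr_le.
      + exact: measurableI.
      + by apply: measurableU; apply: measurableI => //; [exact: measurableI|exact: measurableC].
      + move=> w [hE hF]; have [hW|hW] := pselect (W1 w); first by left.
        by right.
    - by apply: measurableI => //; exact: measurableI.
    - by apply: measurableI => //; exact: measurableC.
  have p1 : pr (E1 `&` W1) <= pA by apply: pr_le => //; exact: measurableI.
  have t1k : t1 `^ kap = (1 + rho) `^ kap * tau `^ kap by rewrite powRM ?(ltW t0)//; move: r0; hide_comparisons; lra.
  have K3E : K3 * (t1 `^ kap - tau `^ kap) = K2 * tau `^ kap.
    by rewrite t1k /K3; field; rewrite gt_eqF.
  have tt : t1 `^ kap <= (tau + H) `^ kap.
    by apply: powk_le; [exact: ltW|move: t1E Hr; hide_comparisons; lra].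
  have c0 : 0 <= K3 * ((tau + H) `^ kap - t1 `^ kap) + K2 * (tau + H) `^ kap.
    by rewrite addr_ge0// mulr_ge0 ?subr_ge0 ?powR_ge0 ?(ltW K30) ?(ltW K20).
  have := ler_wpM2l c0 p1.
  have -> : K3 * ((tau + H) `^ kap - tau `^ kap) + K2 * (tau + H) `^ kap =
    (K3 * ((tau + H) `^ kap - t1 `^ kap) + K2 * (tau + H) `^ kap) + K2 * tau `^ kap.
    by rewrite -K3E; ring.
  rewrite [leRHS]mulrDl; move: I1 I2; hide_comparisons; lra.
exists (K3 + K2), (ts / 2); split; [by rewrite addr_gt0|by rewrite divr_gt0|].
move=> tau H s E A s0 t0 H0 tts pE mA AW.
have [n Tn] : exists n, tau + H <= (1 + rho) ^+ n * tau.
  have [n nP] := exprn_unbounded ((tau + H) / tau) r0.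
  by exists n; rewrite -ler_pdivrMr.
apply: (le_trans (key n tau H s E A _ _ _ _ _ _ _ _)) => //; first by move: tts; hide_comparisons; lra.
rewrite ler_wpM2r ?pr_ge0// mulrDl lerD2r ler_pM2l// gerBl powR_ge0//.
Qed.

(** Only the upper bound [eta] on phi(Y_s) is known, so a single window does not fit. The range is
    cut into shells with ends (1 - e)^(N+1) eta and (1 - e)^N eta, each inside a window of relative
    width e, and the chain bounds add up over the shells. The resulting band neglects the start from
    below and counts it fully from above. *)
Lemma window_from_large_state e : 0 < e -> e <= 1 / 2 -> exists K ts : R, [/\ 0 < K, 0 < ts &
  forall eta H s E, 0 < s -> 0 < eta -> 0 <= H -> eta + H <= ts -> past_event s E ->
    pr (E `&` [set w | band 0 eta (Y s w)] `&`
        [set w | (~` band ((1 - 2 * e) * H) ((1 + 2 * e) * (eta + H))) (Y (s + H) w)]) <=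
    K * (eta + H) `^ kap * pr (E `&` [set w | band 0 eta (Y s w)])].
Proof.
move=> e0 e1; have [K [ts [K0 ts0 CH]]] := window_chain e0 e1; exists K, ts; split => //.
move=> eta H s E s0 eta0 H0 eHt pE.
set F := band 0 eta; set V := band _ _.
have mF : measurable F by exact: measurable_phi_interval.
have mV : measurable V by exact: measurable_phi_interval.
have mE := measurable_past_event pE; have sH : 0 < s + H by lra.
pose c := K * (eta + H) `^ kap; have c0 : 0 <= c by rewrite mulr_ge0 ?powR_ge0// ltW.
rewrite -/c; set NV := [set w | (~` V) (Y (s + H) w)].
have mNV : measurable NV by apply: measurable_at => //; exact: measurableC.
pose q := 1 - e; have q0 : 0 < q by rewrite /q; lra.
have q1 : q < 1 by rewrite /q; lra.
pose G N := [set w | 0 < Y s w /\ q ^+ N * eta < ph (Y s w) <= eta].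
have mG N : measurable (G N).
  exact: (measurable_at s0 (measurable_phi_interval_oc (q ^+ N * eta) eta)).
have GF N : G N `<=` [set w | F (Y s w)].
  by move=> w [y0 /andP[_ h]]; split => //; rewrite h ltW// ph_gt0.
pose A N := [set y | 0 < y /\ q ^+ N.+1 * eta < ph y <= q ^+ N * eta].
have mA N : measurable (A N) by exact: measurable_phi_interval_oc.
have qS N : q ^+ N.+1 * eta <= q ^+ N * eta.
  by rewrite ler_pM2r// exprS ler_piMl ?exprn_ge0// ltW.
have qe N : q ^+ N * eta <= eta by rewrite ler_piMl ?(ltW eta0)// exprn_ile1// ltW.
have piece N : pr (E `&` [set w | A N (Y s w)] `&` NV) <= c * pr (E `&` [set w | A N (Y s w)]).
  have t0 : 0 < q ^+ N * eta by rewrite mulr_gt0// exprn_gt0.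
  have AW : A N `<=` win (q ^+ N * eta) e.
    move=> y [y0 /andP[y1 y2]]; split => //; rewrite ler_norml.
    move: y1; rewrite exprS -mulrA /q mulrBl mul1r -/q => y1.
    have : 0 <= e * (q ^+ N * eta) by rewrite mulr_ge0// ltW.
    by move=> h; apply/andP; split; lra.
  have tH : q ^+ N * eta + H <= ts by have := qe N; lra.
  have := CH _ H s E (A N) s0 t0 H0 tH pE (mA N) AW => h.
  apply: (@le_trans _ _ (K * (q ^+ N * eta + H) `^ kap * pr (E `&` [set w | A N (Y s w)]))).
    apply: le_trans h; have mAN := measurable_at s0 (mA N).
    apply: pr_le; first by apply: measurableI => //; exact: measurableI.
      apply: measurableI; first exact: measurableI.
      by apply: measurable_at => //; exact: measurable_winC.
    move=> w [EA nV]; split => //; apply: contra_not nV => -[z0 zW]; split => //.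
    move: zW; rewrite ler_norml => /andP[z1 z2].
    set x := q ^+ N * eta in t0 z1 z2 *; have xe : x <= eta by exact: qe.
    have h1 : 0 <= (1 - 2 * e) * x by rewrite mulr_ge0//; lra.
    have h2 : (1 + 2 * e) * (x + H) <= (1 + 2 * e) * (eta + H) by rewrite ler_pM2l//; lra.
    by apply/andP; split; lra.
  rewrite ler_wpM2r ?pr_ge0// ler_pM2l//; apply: powk_le; first lra.
  by have := qe N; lra.
have fin N : pr (E `&` G N `&` NV) <= c * pr (E `&` G N).
  elim: N => [|N IH].
    rewrite (_ : E `&` G 0%N = set0); first by rewrite set0I /pr measure0 mulr0.
    rewrite -subset0 => w [_ [_]]; rewrite expr0 mul1r => /andP[h1 h2].
    by move: (lt_le_trans h1 h2); rewrite ltxx.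
  have GS : G N.+1 = G N `|` [set w | A N (Y s w)].
    apply/seteqP; split => w /=.
      move=> [y0 /andP[y1 y2]]; have [h|h] := leP (ph (Y s w)) (q ^+ N * eta).
        by right; split => //; rewrite y1.
      by left; split => //; rewrite h.
    move=> [[y0 /andP[y1 y2]]|[y0 /andP[y1 y2]]]; split => //; rewrite ?y1 ?y2 ?andbT/=.
      exact: le_lt_trans y1.
    exact: le_trans y2 _.
  have mAN := measurable_at s0 (mA N).
  have -> : E `&` G N.+1 = (E `&` G N) `|` (E `&` [set w | A N (Y s w)]) by rewrite GS setIUr.
  rewrite setIUl [in leRHS]prU_disj; last 3 first.
  - exact: measurableI.
  - exact: measurableI.
  - apply/disj_set2P; rewrite -subset0 => w [[_ [_ /andP[h1 _]]] [_ [_ /andP[_ h2]]]].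
    by move: (lt_le_trans h1 h2); rewrite ltxx.
  apply: (le_trans (prU_le _ _)); [| |by have := piece N; rewrite mulrDr; lra].
    by apply: measurableI => //; exact: measurableI.
  by apply: measurableI => //; exact: measurableI.
have mEF : measurable (E `&` [set w | F (Y s w)]).
  by apply: measurableI => //; exact: measurable_at.
have -> : E `&` [set w | F (Y s w)] `&` NV = \bigcup_N (E `&` G N `&` NV).
  apply/seteqP; split => w.
    move=> [[Ew [y0 /andP[_ ye]]] Nw]; have py := ph_gt0 y0.
    have r0 : 0 < ph (Y s w) / eta / 2 by rewrite !divr_gt0.
    have [N qN] := exprn_small q0 q1 r0; exists N => //; split => //; split => //; split => //.
    rewrite ye andbT; apply: (@le_lt_trans _ _ (ph (Y s w) / 2)); last lra.
    rewrite -ler_pdivlMr// (le_trans qN)// le_eqVlt; apply/orP; left; apply/eqP; field.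
    by rewrite gt_eqF.
  by move=> [N _ [[Ew Gw] Nw]]; split => //; split => //; exact: GF Gw.
rewrite -lee_fin -prE; last first.
  by apply: bigcupT_measurable => N; apply: measurableI => //; exact: measurableI.
apply: measure_bigcup_nondecreasing => N.
- by apply: measurableI => //; exact: measurableI.
- move=> w [[Ew [y0 /andP[y1 y2]]] Nw]; split => //; split => //; split => //.
  by rewrite y2 andbT (le_lt_trans (qS N)).
- rewrite prE; last by apply: measurableI => //; exact: measurableI.
  rewrite lee_fin (le_trans (fin N))// ler_wpM2l//; apply: pr_le => //.
    exact: measurableI.
  by move=> w [Ew Gw]; split => //; exact: GF Gw.
Qed.

(* Starting [window_from_large_state] at times s decreasing to 0 uses only Y_s -> oo. *)
Lemma window_fixed_time e : 0 < e -> e <= 1 / 2 -> exists K ts : R, [/\ 0 < K, 0 < ts &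
  forall t, 0 < t -> t <= ts -> pr [set w | (~` win t (4 * e)) (Y t w)] <= K * t `^ kap].
Proof.
move=> e0 e1; have [K [ts [K0 ts0 FAR]]] := window_from_large_state e0 e1.
exists (K * 2 `^ kap), (ts / 2); split; rewrite ?divr_gt0// ?mulr_gt0 ?powR_gt0//.
move=> t t0 tts; pose sn n := e * t / n.+1%:R.
have et0 : 0 < e * t by rewrite mulr_gt0.
have etl : e * t <= 1 / 2 * t by rewrite ler_pM2r.
have sn0 n : 0 < sn n by rewrite divr_gt0.
have snle n : sn n <= e * t by rewrite ler_pdivrMr// ler_peMr ?(ltW et0)// ler1n.
set NW := [set w | (~` win t (4 * e)) (Y t w)].
have mNW : measurable NW by apply: measurable_at => //; exact: measurable_winC.
pose F := band 0 (e * t).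
have mF : measurable F by exact: measurable_phi_interval.
(* As Y tends to infinity at 0, almost all sampled points lie in F, so the bad event is the
   increasing union of the [D m]. On [D m] the process is in F at time [sn m], from which the chain
   can start. *)
pose D m := NW `&` \bigcap_(n in [set n | (m <= n)%N]) [set w | F (Y (sn n) w)].
have mD m : measurable (D m).
  apply: measurableI => //; apply: bigcap_measurable; first by exists m => /=.
  by move=> n _; exact: measurable_at.
have NWD : NW = \bigcup_m D m.
  apply/seteqP; split => w; last by move=> [m _ []].
  move=> Nw; have [x0 [x00 x0P]] := ph_small et0.
  have /cvgryPge/(_ x0) := Yoo w; rewrite near_withinE => /nbhs_ballP[h /= h0 hP].
  exists (Num.truncn (e * t / h)) => //; split => // n /= mn.
  have hs : x0 <= Y (sn n) w.
    apply: hP => //; rewrite /ball/= sub0r normrN gtr0_norm// /sn ltr_pdivrMr//.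
    rewrite -ltr_pdivrMl// mulrC; apply: (lt_le_trans (truncnS_gt _)).
    by rewrite ler_nat ltnS.
  have y0 := lt_le_trans x00 hs; split => //.
  by rewrite (ltW (ph_gt0 y0))/= ltW// x0P.
rewrite -lee_fin -prE// NWD; apply: measure_bigcup_nondecreasing => m //.
  by move=> w [Nw Fw]; split => // n /= mn; apply: Fw => /=; exact: ltnW.
rewrite prE// lee_fin.
have H0 : 0 <= t - sn m by have := snle m; lra.
have eH : e * t + (t - sn m) <= ts by have := sn0 m; lra.
have := FAR (e * t) (t - sn m) (sn m) setT (sn0 m) et0 H0 eH (past_eventT _).
have -> : sn m + (t - sn m) = t by ring.
rewrite -/F setTI; set V := band _ _ => h.
have mV : measurable V by exact: measurable_phi_interval.
apply: (@le_trans _ _ (K * (e * t + (t - sn m)) `^ kap * 1)).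
  apply: le_trans (le_trans h _).
    apply: pr_le => //; first by apply: measurableI; apply: measurable_at => //; exact: measurableC.
    move=> w [Nw Fw]; split; first exact: (Fw m (leqnn m)).
    apply: contra_not Nw => -[z0 /andP[z1 z2]]; split => //; rewrite ler_norml.
    (* For e <= 1/2, the factors (1 - 2e)(1 - e) and (1 + 2e)(1 + e) lie within 4e of 1; this is the
       origin of the width 4e. *)
    have s1 : (1 - 2 * e) * ((1 - e) * t) <= (1 - 2 * e) * (t - sn m).
      by rewrite ler_wpM2l; have := snle m; lra.
    have s2 : (1 + 2 * e) * (e * t + (t - sn m)) <= (1 + 2 * e) * ((1 + e) * t).
      by rewrite ler_wpM2l; have := sn0 m; lra.
    have s3 : e * (e * t) <= 1 / 2 * (e * t) by rewrite ler_pM2r.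
    have s4 : 0 <= e * (e * t) by rewrite mulr_ge0// ltW.
    by apply/andP; split; lra.
  rewrite ler_wpM2l ?mulr_ge0 ?powR_ge0 ?(ltW K0)//.
  by rewrite -lee_fin -prE ?probability_le1//; apply: measurable_at.
rewrite mulr1 -mulrA ler_pM2l// -powRM ?(ltW t0)//; apply: powk_le; first lra.
by have := sn0 m; lra.
Qed.


Lemma powk_small (K c : R) : 0 < K -> 0 < c -> exists t0, 0 < t0 /\ forall t, 0 <= t -> t <= t0 -> K * t `^ kap <= c.
Proof.
move=> K0 c0; exists ((c / K) `^ kap^-1); split; first by rewrite powR_gt0// divr_gt0.
move=> t t0 tt; have := powk_le t0 tt.
rewrite -powRrM mulVf ?gt_eqF// powRr1; last by rewrite divr_ge0// ltW.
by rewrite ler_pdivlMr// mulrC.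
Qed.

(** Let G be the window of width 4e at the end b of the block, and stop at the first grid time r
    outside the width 10e. If phi(Y_r) is too small, it stays too small for G except with
    probability 1/4, since 6 e b < 10 e r (1 + 2e). If it is too large, reaching G requires a climb,
    of probability at most 1/2. So P(U and G) <= 3/4 P(U) for the exit event U, and P(U) is at most
    four times the fixed-time failure probability. As only grid times are controlled, the conclusion
    concerns some s just after r. *)
Lemma window_time_block e : 0 < e -> e <= 1 / 16 -> exists K ts : R, [/\ 0 < K, 0 < ts &
  forall b, 0 < b -> b <= ts -> exists B : set Om, [/\ measurable B, pr B <= K * b `^ kap &
    forall w, ~ B w -> forall r del, b <= (1 + e) * r -> r < b -> 0 < del ->
      exists s, [/\ r <= s, s < r + del & win s (10 * e) (Y s w)]]].
Proof.
move=> e0 e16; have e2 : e <= 1 / 2 by lra.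
have [K1 [ts1 [K10 ts10 ONE]]] := window_fixed_time e0 e2.
have [K2 [ts2 [K20 ts20 FAR]]] := window_from_large_state e0 e2.
have [ts3 [ts30 LOW]] := ker_low e0.
have [ts4 [ts40 SM]] := powk_small K20 (ltac:(lra) : 0 < 1 / 4).
pose ts := Num.min (Num.min ts1 ts2) (Num.min (ts3 / 2) ts4).
exists (4 * K1), ts; split; first by rewrite mulr_gt0.
  by rewrite !lt_min ts10 ts20 ts40 divr_gt0.
move=> b b0; rewrite !le_min => /andP[/andP[bt1 bt2] /andP[bt3 bt4]].
pose a := b / (1 + e); have e1 : 0 < 1 + e by lra.
have aE : (1 + e) * a = b by rewrite /a mulrC divfK// gt_eqF.
have a0 : 0 < a by rewrite divr_gt0.
have ab : a < b by have := mulr_gt0 e0 a0; lra.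
clearbody a.
pose g (m j : nat) := a + (b - a) * (j%:R / 2 ^+ m).
have ga m j : a <= g m j.
  by rewrite lerDl mulr_ge0 ?divr_ge0 ?exprn_ge0// subr_ge0 ltW.
have g0 m j : 0 < g m j by exact: lt_le_trans (ga m j).
have gb m j : (j < 2 ^ m)%N -> g m j <= b.
  move=> jm; have : j%:R / 2 ^+ m <= 1 :> R.
    by rewrite ler_pdivrMr ?exprn_gt0// mul1r -natrX ler_nat ltnW.
  move=> h; have : (b - a) * (j%:R / 2 ^+ m) <= b - a by rewrite ler_piMr// subr_ge0 ltW.
  by rewrite /g; lra.
have gmono m i j : (i <= j)%N -> g m i <= g m j.
  move=> ij; rewrite lerD2l ler_pM2l ?subr_gt0// ler_pM2r ?invr_gt0 ?exprn_gt0//.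
  by rewrite ler_nat.
pose bad m j := [set w | (~` win (g m j) (10 * e)) (Y (g m j) w)].
have mbad m j : measurable (bad m j) by apply: measurable_at => //; exact: measurable_winC.
pose U m := \bigcup_(j in [set j | (j < 2 ^ m)%N]) bad m j.
have mU m : measurable (U m) by apply: bigcup_measurable.
pose G := [set w | win b (4 * e) (Y b w)].
have mG : measurable G by apply: measurable_at => //; exact: measurable_win.
have UU m : U m `<=` U m.+1.
  move=> w [j /= jm bw]; exists (j * 2)%N.
    by rewrite /= expnSr ltn_mul2r.
  by rewrite /bad (_ : g m.+1 (j * 2) = g m j)// /g natrM exprS; field; rewrite expf_neq0.
have first_bad m j : (j < 2 ^ m)%N -> pr (seqDU (bad m) j `&` G) <= 3 / 4 * pr (seqDU (bad m) j).
  move=> jm; set r := g m j; set E := seqDU (bad m) j.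
  have r0 : 0 < r by exact: g0.
  have rb : r <= b by exact: gb.
  have br : b <= (1 + e) * r by rewrite -aE ler_pM2l// ga.
  have pE : past_event r E.
    rewrite /E seqDU_first setIC; apply: past_eventI => //; first exact: measurable_winC.
    exists j, (g m), (fun i => win (g m i) (10 * e)); split.
    - by move=> i ij; rewrite g0/= gmono// ltnW.
    - by move=> i; exact: measurable_win.
    - apply: eq_bigcapr => i _; apply/seteqP; split => w /=; first by move/contrapT.
      by move=> h; apply.
  have mE := measurable_past_event pE.
  have EB : E `<=` bad m j by rewrite /E seqDU_first => w [].
  clearbody E; have H0 : 0 <= b - r by rewrite subr_ge0.
  have rbE : r + (b - r) = b by ring.
  have er : 0 < e * r by rewrite mulr_gt0.
  have eer : 0 < e * (e * r) by rewrite mulr_gt0.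
  have er16 : 10 * (e * r) < r.
    by rewrite mulrA -[ltRHS]mul1r ltr_pM2r//; move: e16; hide_comparisons; lra.
  have eta0 : 0 < (1 - 10 * e) * r by move: er16; hide_comparisons; lra.
  have etb : (1 - 10 * e) * r + (b - r) <= ts2 by move: er bt2; hide_comparisons; lra.
  have erb : e * b <= e * ((1 + e) * r) by rewrite ler_pM2l.
  have eer16 : e * (e * r) <= 1 / 16 * (e * r) by rewrite ler_pM2r.
  pose F := [set w | band 0 ((1 - 10 * e) * r) (Y r w)].
  have mF : measurable F by apply: measurable_at => //; exact: measurable_phi_interval.
  have far_bad : pr (E `&` F `&` G) <= 1 / 4 * pr E.
    have := FAR ((1 - 10 * e) * r) (b - r) r E r0 eta0 H0 etb pE.
    rewrite rbE -/F; set V := band _ _ => h; have mV : measurable V by exact: measurable_phi_interval.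
    apply: (@le_trans _ _ (K2 * ((1 - 10 * e) * r + (b - r)) `^ kap * pr (E `&` F))).
      apply: le_trans h; apply: pr_le.
      - by apply: measurableI => //; exact: measurableI.
      - apply: measurableI; first exact: measurableI.
        by apply: measurable_at => //; exact: measurableC.
      - move=> w [EF [z0 zG]]; split => // -[_ /andP[_ z2]].
        by move: zG; rewrite ler_norml => /andP[z3 _]; move: z2 z3 er eer erb eer16; hide_comparisons; lra.
    apply: ler_pM; rewrite ?pr_ge0 ?mulr_ge0 ?powR_ge0 ?(ltW K20)//.
      by apply: SM; [move: eta0 H0|move: bt4 er]; hide_comparisons; lra.
    by apply: pr_le => //; exact: measurableI.
  (* States y <= 0, where phi is not controlled, are counted among the low ones. *)
  pose Lo := [set y | 0 < y -> (1 + 10 * e) * r < ph y].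
  have mLo : measurable Lo.
    apply: is_interval_measurable => x y Hx Hy z /andP[xz zy] z0.
    by apply: lt_le_trans (Hy (lt_le_trans z0 zy)) _; exact: ph_le.
  have low_bad : pr (E `&` [set w | Lo (Y r w)] `&` G) <= 1 / 2 * pr E.
    have mL := measurable_at r0 mLo.
    apply: (@le_trans _ _ (1 / 2 * pr (E `&` [set w | Lo (Y r w)]))); last first.
      by rewrite ler_pM2l//; apply: pr_le => //; exact: measurableI.
    have := @markov_step r (b - r) (1 / 2) E Lo (win b (4 * e)) r0 H0 (ltac:(hide_comparisons; lra)) pE mLo
      (measurable_win _ _).
    rewrite rbE; apply => y Ly; apply: (LOW ((1 + 10 * e) * r)) => //.
    - by rewrite mulr_gt0//; move: e0; hide_comparisons; lra.
    - by move: rb bt3 er16; hide_comparisons; lra.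
    - exact: measurable_win.
    - move=> z [z0]; rewrite ler_norml => /andP[_ z1]; split => //.
      by move: z1 br erb er eer16; hide_comparisons; lra.
  apply: (@le_trans _ _ (pr (E `&` F `&` G) + pr (E `&` [set w | Lo (Y r w)] `&` G))); last first.
    by move: far_bad low_bad; hide_comparisons; lra.
  have mL := measurable_at r0 mLo.
  apply: le_trans (prU_le _ _); try by apply: measurableI => //; exact: measurableI.
  apply: pr_le; first exact: measurableI.
    by apply: measurableU; apply: measurableI => //; exact: measurableI.
  move=> w [Ew Gw]; have bw := EB w Ew.
  have [Lw|nL] := pselect (Lo (Y r w)); first by right.
  left; split => //; split => //; move/not_implyP : nL => [y0 /negP]; rewrite -leNgt => yr.
  split => //; rewrite (ltW (ph_gt0 y0))/= leNgt; apply/negP => yr2; apply: bw.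
  by split => //; rewrite ler_norml -/r; apply/andP; split; move: yr yr2; hide_comparisons; lra.
exists (\bigcup_m U m); split; first exact: bigcupT_measurable.
  rewrite -lee_fin -prE; last exact: bigcupT_measurable.
  apply: measure_bigcup_nondecreasing => // m.
  rewrite prE// lee_fin -mulrA.
  have := ONE b b0 bt1.
  have mS k : measurable (seqDU (bad m) k) by exact: measurable_seqDU.
  have UG : pr (U m `&` G) <= 3 / 4 * pr (U m).
    rewrite -lee_fin EFinM -!prE//; last exact: measurableI.
    apply: first_passage => // k km; rewrite !prE//; last exact: measurableI.
    by rewrite -EFinM lee_fin; exact: first_bad.
  have : pr (U m) <= pr (U m `&` G) + pr (~` G).
    apply: le_trans (prU_le _ _); [|exact: measurableI|exact: measurableC].
    apply: pr_le => //; first by apply: measurableU; [exact: measurableI|exact: measurableC].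
    by move=> w Uw; have [?|?] := pselect (G w); [left|right].
  rewrite (_ : [set w | (~` win b (4 * e)) (Y b w)] = ~` G)//; move: UG; hide_comparisons; lra.
move=> w nB r del br rb del0.
have ar : a <= r by rewrite -(ler_pM2l e1) aE.
have ba0 : 0 < b - a by rewrite subr_gt0.
pose x := (r - a) / (b - a).
have x0 : 0 <= x by rewrite divr_ge0 ?subr_ge0// ltW.
have x1 : x < 1 by rewrite ltr_pdivrMr// mul1r ltrD2r.
have rE : r = a + (b - a) * x by rewrite /x mulrC divfK ?gt_eqF//; ring.
(* The mesh must be small enough for the next grid point after r to come both before b and before r
   + del. *)
have ep0 : 0 < Num.min (1 - x) (del / (b - a)) / 2 by rewrite divr_gt0// lt_min subr_gt0 x1 divr_gt0.
have [m mP] := exprn_small (ltac:(hide_comparisons; lra) : 0 < 1 / 2 :> R) (ltac:(hide_comparisons; lra) : 1 / 2 < 1 :> R) ep0.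
have m0 : 0 < 2 ^+ m :> R by rewrite exprn_gt0.
rewrite div1r exprVn in mP.
have min1 : Num.min (1 - x) (del / (b - a)) <= 1 - x by rewrite ge_min lexx.
have min2 : Num.min (1 - x) (del / (b - a)) <= del / (b - a) by rewrite ge_min lexx orbT.
have xm0 : 0 <= x * 2 ^+ m by rewrite mulr_ge0// ltW.
pose j := (Num.truncn (x * 2 ^+ m)).+1.
have /truncn_itv/andP[j1 j2] := xm0.
have jx : j%:R / 2 ^+ m <= x + (2 ^+ m)^-1.
  by rewrite ler_pdivrMr// mulrDl mulVf ?gt_eqF// /j -natr1 lerD2r.
have xj : x <= j%:R / 2 ^+ m by rewrite ler_pdivlMr// ltW.
exists (g m j); split.
- by rewrite {1}rE lerD2l ler_pM2l.
- rewrite {1}rE /g -addrA ltrD2l -ltr_pdivlMl// mulrDr mulrA mulVf ?gt_eqF// mul1r.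
  by rewrite (mulrC _ del); move: jx mP min2 ep0; hide_comparisons; lra.
- apply: contrapT => nW; apply: nB; exists m => //; exists j => //=.
  have : j%:R / 2 ^+ m < 1 :> R by move: jx mP min1 ep0; hide_comparisons; lra.
  by rewrite ltr_pdivrMr// mul1r -natrX ltr_nat.
Qed.

(** Borel-Cantelli along the blocks with right ends ts (1 + e)^-k, whose exceptional probabilities
    form a geometric series. Outside the limsup N, all blocks from some index on are good, and they
    cover a right neighbourhood of 0. *)
Lemma window_ae e : 0 < e -> e <= 1 / 16 -> exists N : set Om, [/\ measurable N, P N = 0%E &
  forall w, ~ N w -> exists t0, 0 < t0 /\ forall r del, 0 < r -> r < t0 -> 0 < del ->
    exists s, [/\ r <= s, s < r + del, 0 < Y s w & `|ph (Y s w) - s| <= 10 * e * s]].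
Proof.
move=> e0 e16; have [K [ts [K0 ts0 BL]]] := window_time_block e0 e16.
pose q := (1 + e)^-1; have e1 : 0 < 1 + e by lra.
have q0 : 0 < q by rewrite invr_gt0.
have q1 : q < 1 by rewrite invf_lt1//; lra.
have qE : (1 + e) * q = 1 by rewrite /q mulfV// gt_eqF.
clearbody q.
pose t k := ts * q ^+ k.
have tk0 k : 0 < t k by rewrite mulr_gt0// exprn_gt0.
have tkts k : t k <= ts by rewrite ger_pMr// exprn_ile1// ltW.
have [B HB] := choice (fun k => BL (t k) (tk0 k) (tkts k)).
pose Q := q `^ kap; have Q0 : 0 < Q by rewrite powR_gt0.
have Q1 : Q < 1.
  by rewrite /Q /powR gt_eqF// -[X in _ < X]expR0 ltr_expR pmulr_rlt0// ln_lt0// q0.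
pose c := K * ts `^ kap; have c0 : 0 < c by rewrite mulr_gt0// powR_gt0.
have PB k : (P (B k) <= (c * Q ^+ k)%:E)%E.
  have [mB pB _] := HB k; rewrite prE// lee_fin (le_trans pB)//.
  have -> : Q ^+ k = (q ^+ k) `^ kap.
    by rewrite -(powR_mulrn k (ltW q0)) -powRrM mulrC powRrM powR_mulrn// powR_ge0.
  by rewrite /t powRM ?exprn_ge0 ?(ltW ts0) ?(ltW q0)// mulrA.
have mB k : measurable (B k) by have [] := HB k.
pose T n := \bigcup_k B (n + k)%N.
have mT n : measurable (T n) by apply: bigcupT_measurable.
exists (\bigcap_n T n).
have mN : measurable (\bigcap_n T n) by apply: bigcapT_measurable.
split => //.
  rewrite prE//; congr (_%:E); apply/eqP; rewrite eq_le pr_ge0 andbT leNgt; apply/negP => N0.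
  have d0 : 0 < pr (\bigcap_n T n) * (1 - Q) / c / 2 by rewrite !divr_gt0// mulr_gt0// subr_gt0.
  have [n nP] := exprn_small Q0 Q1 d0.
  have : (P (T n) <= (c * Q ^+ n / (1 - Q))%:E)%E.
    apply: measure_bigcup_geometric => //; [by rewrite mulr_ge0 ?exprn_ge0// ltW|exact: ltW|].
    by move=> k; rewrite -mulrA -exprD; exact: PB.
  rewrite prE// lee_fin ler_pdivlMr ?subr_gt0// => h.
  have NT : pr (\bigcap_n T n) <= pr (T n) by apply: pr_le => // w; apply.
  have h1 : pr (\bigcap_n T n) * (1 - Q) <= pr (T n) * (1 - Q) by rewrite ler_pM2r// subr_gt0.
  have h2 : 0 < pr (\bigcap_n T n) * (1 - Q) by rewrite mulr_gt0// subr_gt0.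
  have : c * Q ^+ n <= pr (\bigcap_n T n) * (1 - Q) / 2.
    by rewrite mulrC -ler_pdivlMr// (le_trans nP)// le_eqVlt; apply/orP; left; apply/eqP; field; rewrite gt_eqF.
  lra.
move=> w nN; have [n nT] : exists n, ~ T n w.
  by apply: contrapT => h; apply: nN => n _; apply: contrapT => nT; apply: h; exists n.
exists (t n); split => // r del r0 rt del0.
(* The least such k selects the block containing r. *)
have ex : exists k, t (n + k).+1 <= r.
  have [k kP] := exprn_small q0 q1 (divr_gt0 r0 ts0); exists k.
  rewrite /t mulrC -ler_pdivlMr//; apply: le_trans kP.
  by apply: ler_wiXn2l; rewrite ?(ltW q0) ?(ltW q1)// leqW// leq_addl.
case: (ex_minnP ex) => k kr kmin.
have rk : r < t (n + k)%N.
  case: k kr kmin => [|k] kr kmin; first by rewrite addn0.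
  by rewrite ltNge; apply/negP; rewrite addnS => /kmin; rewrite ltnn.
have [_ _ Hw] := HB (n + k)%N.
have nBw : ~ B (n + k)%N w by move=> Bw; apply: nT; exists k.
have tS : t (n + k)%N <= (1 + e) * r.
  have : (1 + e) * t (n + k).+1 <= (1 + e) * r by rewrite ler_pM2l.
  rewrite {1}/t exprS (_ : _ * (ts * _) = (1 + e) * q * (ts * q ^+ (n + k))); last by ring.
  by rewrite qE mul1r.
have [s [s1 s2 [s3 s4]]] := Hw w nBw r del tS rk del0.
by exists s.
Qed.

End MarkovWindows.

(** * The no-climbing bound on the phi scale *)

Section LowKernel.
Variables (R : realType) (gam sig : R) (pi : {measure set R -> \bar R}) (Rf : R -> R) (th : R).
Variables (d : measure_display) (Om : measurableType d) (P : probability Om R) (L : R -> Om -> R).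
Hypothesis Rf_cont : {within `[0%R, +oo[%classic, continuous Rf}.
Hypothesis Rf_gt0 : forall x : R, 0 < x -> 0 < Rf x.
Hypothesis gam0 : 0 < gam.
Hypothesis th1 : 1 < th.
Hypothesis Rf_rv : regvar_infty Rf th.
Hypothesis HL : levy_process P L gam sig pi.
Variables (C dl l0 : R).
Hypothesis C0 : 0 < C.
Hypothesis dl0 : 0 < dl.
Hypothesis l00 : 0 < l0.
Hypothesis kapb : forall lam, 0 < lam -> lam <= l0 ->
  0 <= Psi gam sig pi lam - gam * lam <= C * lam `^ (1 + dl).

(** Opposite to [phi_sep]: [lam] solves lam^(1-th) = 1 - e/2, so stretching the argument by [lam]
    loses at most the fraction [e] of phi. *)
Lemma phi_stretch (e : R) : 0 < e -> e < 1 -> exists lam x0 : R, [/\ 1 < lam, 0 < x0 &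
  forall x z, x0 <= x -> 0 < z -> z <= lam * x -> (1 - e) * phi gam Rf x <= phi gam Rf z].
Proof.
move=> e0 e1; have th10 : 0 < th - 1 by rewrite subr_gt0.
have ln0 : ln (1 - e / 2) < 0 by apply: ln_lt0; apply/andP; split; lra.
pose lam := expR (- (ln (1 - e / 2) / (th - 1))).
have lam1 : 1 < lam by rewrite /lam expR_gt1 oppr_gt0 pmulr_llt0// invr_gt0.
have lam0 : 0 < lam by lra.
have lamE : lam `^ (1 - th) = 1 - e / 2.
  rewrite /powR gt_eqF// expRK (_ : (1 - th) * _ = ln (1 - e / 2)); last by field; rewrite gt_eqF.
  by rewrite lnK// posrE; lra.
clearbody lam.
have [x0 [x00 x0P]] := phi_scale Rf_cont Rf_gt0 gam0 th1 Rf_rv lam0 (divr_gt0 e0 (ltr0n R 2 : 0 < 2)).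
exists lam, x0; split => // x z xx z0 zx.
have h := phi_le Rf_cont Rf_gt0 gam0 th1 Rf_rv z0 zx; apply: le_trans h.
by have := x0P x xx; rewrite lamE ler_norml => /andP[h _]; lra.
Qed.

(** With bet the inverse of phi at tau, a start with phi(y) > tau is at most bet, while phi(z) <= (1
    - e) tau forces z above (1 + c) bet for a fixed c > 0. The estimate thus reduces to the one for
    climbs. *)
Lemma kernel_low_phi (e : R) : 0 < e -> exists ts : R, 0 < ts /\ forall tau y h (B : set R),
  0 < tau -> tau <= ts -> (0 < y -> tau < phi gam Rf y) -> measurable B ->
  (forall z, B z -> 0 < z /\ phi gam Rf z <= (1 - e) * tau) ->
  (Xkernel P L Rf h y B <= (1 / 2)%:E)%E.
Proof.
move=> e0; pose e1 := Num.min e (1 / 2).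
have e10 : 0 < e1 by rewrite lt_min e0 divr_gt0.
have e1e : e1 <= e by rewrite ge_min lexx.
have e12 : e1 < 1 by rewrite gt_min; apply/orP; right; lra.
clearbody e1.
have [lam [x0 [lam1 x00 ST]]] := phi_stretch e10 e12.
have c0 : 0 < (lam - 1) / 2 by rewrite divr_gt0// subr_gt0.
have [b0 [b00 KL]] := kernel_low Rf_cont gam0 HL C0 dl0 l00 kapb c0.
have M0 : 0 < b0 + lam * x0 by rewrite addr_gt0// mulr_gt0//; lra.
have [t0 [t00 PI]] := phi_inv_infty Rf_cont Rf_gt0 gam0 th1 Rf_rv M0.
exists (t0 / 2); split; first by rewrite divr_gt0.
move=> tau y h B tau0 taut Hy mB HB.
have lx0 : 0 < lam * x0 by rewrite mulr_gt0//; lra.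
have be := PI tau tau0 ltac:(lra); set bet := phi_inv gam Rf tau in be.
have bet0 : 0 < bet by lra.
apply: (KL bet) => //; first lra.
  have [y0|y0] := leP y 0; first lra.
  exact: (phi_inv_ge Rf_cont Rf_gt0 gam0 th1 Rf_rv tau0 y0 (Hy y0)).
move=> z /HB[z0 zt]; rewrite ltNge; apply/negP => zb.
have lam0 : 0 < lam by lra.
(* Chosen strictly below [bet], where phi exceeds tau, and such that stretching x by [lam] still
   reaches the climbing level. *)
pose x := (1 + (lam - 1) / 2) * bet / lam.
have xE : lam * x = (1 + (lam - 1) / 2) * bet by rewrite /x mulrC divfK// gt_eqF.
have xb : x < bet.
  by rewrite -(ltr_pM2l lam0) xE ltr_pM2r//; lra.
have xx0 : x0 <= x.
  rewrite -(ler_pM2l lam0) xE.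
  have : 0 <= (lam - 1) / 2 * bet by rewrite mulr_ge0// ltW.
  lra.
have x0' : 0 < x by lra.
have := phi_inv_gt Rf_cont Rf_gt0 gam0 th1 Rf_rv tau0 x0' xb => tp.
have zx : z <= lam * x by rewrite xE.
have := ST x z xx0 z0 zx.
have : (1 - e1) * tau < (1 - e1) * phi gam Rf x by rewrite ltr_pM2l// subr_gt0.
have : (1 - e) * tau <= (1 - e1) * tau by rewrite ler_pM2r//; lra.
lra.
Qed.

End LowKernel.

(** * Almost sure convergence of Y_t over the inverse of phi *)

Theorem theorem3p4 (R : realType) (gam sig : R) (pi : {measure set R -> \bar R})
  (Rf : R -> R) (theta : R)
  (d : measure_display) (Om : measurableType d) (P : probability Om R) (L : R -> Om -> R)
  (d' : measure_display) (Om' : measurableType d') (P' : probability Om' R)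
  (Y : R -> Om' -> R) :
  0 <= sig ->
  pi `]-oo, 0%R]%classic = 0%E ->
  (\int[pi]_(z in `]0%R, +oo[%classic) (Num.min z (z ^+ 2))%:E < +oo)%E ->
  {within `[0%R, +oo[%classic, continuous Rf} ->
  (forall x, 0 < x -> 0 < Rf x) ->
  levy_process P L gam sig pi ->
  law_P_infty P L Rf P' Y ->
  0 < gam ->
  1 < theta ->
  regvar_infty Rf theta ->
  ((exists delta c : R, 0 < delta < 1 /\ 0 < c /\
      ((Psi gam sig pi lam - gam * lam) / (c * lam `^ (1 + delta)))
         @[lam --> 0^'+] --> (1 : R) /\
      bigO_infty (fun z => Vfun Rf z (Num.sqrt z)^-1) (fun z => z `^ (- (delta / 2))))
   \/
   (exists nu : R, 0 < nu /\ PsiE gam sig pi (- nu) = 0%E /\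
      (\int[pi]_(u in `]0%R, 1%R]%classic) u%:E < +oo)%E /\
      bigO_infty (fun z => Vfun Rf z (2 * ln (ln z) / (nu * z)))
                 (fun z => (ln z ^+ 2)^-1))) ->
  {ae P', forall w, (Y t w / phi_inv gam Rf t) @[t --> 0^'+] --> (1 : R)}
  /\ regvar_0 (phi_inv gam Rf) (- (theta - 1)^-1).
Proof.
move=> _ _ _ Rc Rp HL HY gam0 th1 Rrv Hab.
split; last exact: (regvar_0_phi_inv Rc Rp gam0 th1 Rrv).
have [C [dl [l0 [C0 dl0 l00 kapb]]]] : exists C dl l0 : R, [/\ 0 < C, 0 < dl, 0 < l0 &
    forall lam, 0 < lam -> lam <= l0 -> 0 <= Psi gam sig pi lam - gam * lam <= C * lam `^ (1 + dl)].
  apply: Psi_power_bound; case: Hab => [[dl [c [h1 [h2 [h3 _]]]]]|[nu [h1 [h2 _]]]].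
    by left; exists dl, c.
  by right; exists nu.
have [mY [cY [Yoo HM]]] := HY.
have markov s h E B : 0 < s -> 0 <= h -> past_event Y s E -> measurable B ->
    P' (E `&` [set w | B (Y (s + h)%R w)]) = (\int[P']_(w in E) Xkernel P L Rf h (Y s w) B)%E.
  by move=> s0 h0 [n [ts [As [h1 h2 ->]]]] mB; exact: HM.
have ker0 h y B : (0 <= Xkernel P L Rf h y B)%E by exact: measure_ge0.
have kap0 : 0 < dl / theta by rewrite divr_gt0//; lra.
have WIN := window_ae mY ker0 markov (phi_gt0 Rc Rp gam0 th1 Rrv) (phi_lt Rc Rp gam0 th1 Rrv)
  (phi_cvg0 Rc Rp gam0 th1 Rrv) kap0 Yoo
  (kernel_good Rc Rp gam0 th1 Rrv HL C0 dl0 l00 kapb)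
  (kernel_low_phi Rc Rp gam0 th1 Rrv HL C0 dl0 l00 kapb).
have close n : exists N : set Om', [/\ measurable N, P' N = 0%E & forall w, ~ N w ->
    exists t0, 0 < t0 /\ forall t, 0 < t -> t < t0 -> `|Y t w / phi_inv gam Rf t - 1| <= n.+1%:R^-1].
  have n0 : 0 < n.+1%:R^-1 :> R by rewrite invr_gt0.
  have [e [t1 [e0 t10 CL]]] := phi_inv_close Rc Rp gam0 th1 Rrv n0.
  (* For s between t and (1 + e1) t the error 10 e1 s + (s - t) is at most 12 e1 t when e1 <=
     1/16. *)
  pose e1 := Num.min (e / 12) (1 / 16).
  have e10 : 0 < e1 by rewrite lt_min !divr_gt0.
  have e1e : e1 <= e / 12 by rewrite ge_min lexx.
  have e116 : e1 <= 1 / 16 by rewrite ge_min lexx orbT.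
  clearbody e1.
  have [N [mN PN HN]] := WIN e1 e10 e116; exists N; split => // w /HN[t0 [t00 Hw]].
  exists (Num.min t0 t1); split; first by rewrite lt_min t00.
  (* A failure at t would persist for Y_s / phi^-1(t) on a right neighbourhood of t, with the
     denominator fixed at t; but the window holds at some s in that neighbourhood. *)
  move=> t tp; rewrite lt_min => /andP[tt0 tt1]; rewrite leNgt; apply/negP => far_off.
  have cf : `|Y s w / phi_inv gam Rf t - 1| @[s --> t^'+] --> `|Y t w / phi_inv gam Rf t - 1|.
    apply: cvg_norm; apply: cvgB; last exact: cvg_cst.
    apply: cvgM; last exact: cvg_cst.
    by have [+ _] := cY w; apply; rewrite /= in_itv/= andbT.
  have nU : nbhs `|Y t w / phi_inv gam Rf t - 1| [set y | n.+1%:R^-1 < y].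
    by apply: open_nbhs_nbhs; split => //; exact: open_gt.
  have [del [del0 Hdel]] := right_cont_near cf nU.
  have et0 : 0 < e1 * t by rewrite mulr_gt0.
  have m0 : 0 < Num.min del (e1 * t) by rewrite lt_min del0.
  have [s [ts sd Ys0 Ysc]] := Hw t _ tp tt0 m0.
  have d1 : Num.min del (e1 * t) <= del by rewrite ge_min lexx.
  have d2 : Num.min del (e1 * t) <= e1 * t by rewrite ge_min lexx orbT.
  have := Hdel s ts ltac:(move: sd d1; hide_comparisons; lra); rewrite /= ltNge => /negP; apply; apply: CL => //.
  have -> : phi gam Rf (Y s w) - t = (phi gam Rf (Y s w) - s) + (s - t) by ring.
  apply: (le_trans (ler_normD _ _)); rewrite (ger0_norm (_ : 0 <= s - t)) ?subr_ge0//.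
  have : e1 * s <= e1 * (t + e1 * t) by rewrite ler_pM2l//; move: sd d2; hide_comparisons; lra.
  have : e1 * (e1 * t) <= 1 / 16 * (e1 * t) by rewrite ler_pM2r.
  have : e1 * t <= e / 12 * t by rewrite ler_pM2r.
  move: Ysc sd d2 et0; hide_comparisons; lra.
(* The tolerances 1/(n + 1) are countably many, so the exceptional sets have a null union. *)
have [N HN] := choice close.
have neg n : P'.-negligible (N n) by have [mN PN _] := HN n; apply/negligibleP.
apply: negligibleS (negligible_bigcup neg).
move=> w nw; apply: contrapT => nN; apply: nw; apply/cvgrPdist_le => eps eps0.
pose n := Num.truncn eps^-1.
have neps : n.+1%:R^-1 <= eps.
  by rewrite -[leRHS]invrK lef_pV2 ?posrE ?invr_gt0// ltW// truncnS_gt.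
have [_ _ Hw] := HN n; have [|t0 [t00 Ht]] := Hw w; first by move=> Nw; apply: nN; exists n.
near=> t; rewrite distrC; apply: le_trans neps; apply: Ht; near: t; first exact: nbhs_right_gt.
exact: nbhs_right_lt.
Unshelve. all: by end_near.
Qed.
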